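(* Let $L$ be a smooth branch on $S$. Let $\mathcal{B}$ be the set of branches at $O$ on $S$ and let $J$ be the set of finite (non-empty) subsets of $\mathcal{B}$. For $j\in J$, let $C_j$ be the reduced plane curve singularity whose branches are the elements of $j$, and let $\mathcal{V}_{L,j}=V_L(\Theta_L(C_j))$, a subtree of $\mathcal{V}_L$. The collection $(\mathcal{V}_{L,j})_{j\in J}$ forms a projective system for the inclusion partial order (for all $j,k\in J$ there is $l\in J$ with $\mathcal{V}_{L,j}\subset\mathcal{V}_{L,l}\supset\mathcal{V}_{L,k}$). If $\mathcal{V}_{L,j}\subset\mathcal{V}_{L,l}$, denote by $\pi^l_{L,j}:\mathcal{V}_{L,l}\to\mathcal{V}_{L,j}$ the corresponding attaching map. Then: 1. The maps $\pi^l_{L,j}$ form a projective system of continuous maps. 2. The attaching maps $\pi_{L,j}:\mathcal{V}_L\to\mathcal{V}_{L,j}$ glue into a homeomorphism $\pi_L:\mathcal{V}_L\to\varprojlim\mathcal{V}_{L,j}$.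
   Context: **Curves.** $S$ is a germ of smooth complex analytic surface with special point $O$, and $\mathcal{O}\simeq\mathbb{C}[[x,y]]$ is its formal local ring. A branch is a germ at $O$ of formal irreducible curve on $S$. $(D_1\cdot D_2)$ denotes the intersection number at $O$, and $Z(f)$ the divisor of $f$. **Newton-Puiseux series.** $\mathbb{C}[[x^{1/\mathbb{N}}]]=\bigcup_{n\ge1}\mathbb{C}[[x^{1/n}]]$, with order valuation $\nu_x$. Choose local coordinates $(x,y)$ with $L=Z(x)$. A branch $A\neq L$ is defined by a monic irreducible Weierstrass polynomial $f_A\in\mathbb{C}[[x]][y]$ of degree $(L\cdot A)$; $\mathrm{Zer}(f_A)$ is its set of roots in $\mathbb{C}[[x^{1/\mathbb{N}}]]$. For distinct branches $A,B\ne L$, $k_L(A,B)=\max\{\nu_x(\eta_A-\eta_B):\eta_A\in\mathrm{Zer}(f_A),\eta_B\in\mathrm{Zer}(f_B)\}$. If $\xi\in\mathbb{C}[[x^{1/\mathbb{N}}]]$ has positive order, $C_\xi$ is the branch defined by its minimal polynomial in $\mathbb{C}[[x]][y]$. **Eggers-Wall trees.** $\Theta_L(A)$ is a compact segment with an increasing homeomorphism $\mathbf{e}_L:\Theta_L(A)\to[0,\infty]$ (exponent function), smallest end labeled $L$ and greatest end labeled $A$. $\Theta_L(C)$ is the quotient of the disjoint union of the $\Theta_L(A)$, over the branches $A\ne L$ of $C$, obtained by gluing $\Theta_L(A)$ and $\Theta_L(B)$ along $\mathbf{e}_L^{-1}([0,k_L(A,B)])$, identifying points of equal exponent. It is rooted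 at $L$ (if $L$ is a branch of $C$, its label is at the root; $\Theta_L(L)$ is a point). **Semivaluations.** A semivaluation of $\mathcal{O}$ is a function $\nu:\mathcal{O}\to[0,\infty]$ with $\nu(fg)=\nu(f)+\nu(g)$, $\nu(f+g)\ge\min(\nu(f),\nu(g))$, $\nu(\lambda)=0$ for $\lambda\in\mathbb{C}^*$, $\nu(0)=\infty$; for a divisor $D=Z(f)$, $\nu(D):=\nu(f)$. $\mathcal{V}_L$ is the set of semivaluations with $\nu(L)=1$, with the topology of pointwise convergence and the partial order $\nu_1\preceq\nu_2\Leftrightarrow\nu_1(f)\le\nu_2(f)\ \forall f\in\mathcal{O}$. It is known (Favre-Jonsson) that $\mathcal{V}_L$ is a compact rooted $\mathbb{R}$-tree, with root $\mathrm{ord}^L$ (the order of vanishing along $L$), whose weak topology is that of pointwise convergence. **The map $V_L$.** For $\xi\in\mathbb{C}[[x^{1/\mathbb{N}}]]$ of positive order and $\alpha\in(0,\infty]$, put $\mathcal{NP}_x(\xi,\alpha)=\{\eta\in\mathbb{C}[[x^{1/\mathbb{N}}]]:\nu_x(\eta-\xi)\ge\alpha\}$ and $\nu^{\xi,\alpha}(f)=\inf\{\nu_x(f(x,\eta)):\eta\in\mathcal{NP}_x(\xi,\alpha)\}$; also $\nu^{\xi,0}=\mathrm{ord}^L$. The map $V_L:\Theta_L(C)\to\mathcal{V}_L$ sends the point $P$ of exponent $\alpha$ on the segment $[L,C_\xi]$ to $\nu^{\xi,\alpha}$, where $C_\xi$ is a branch of $C$ (this is well defined); $V_L(L)=\mathrm{ord}^L$.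 It is an embedding of rooted trees. **Attaching maps.** For a closed subtree $T'$ of an $\mathbb{R}$-tree $T$, the attaching map $\pi_{T'}:T\to T'$ sends $P$ to the unique $Q\in T'$ with $[Q,P]\cap T'=\{Q\}$, where $[Q,P]$ is the segment joining $Q$ and $P$. A rooted $\mathbb{R}$-tree is a poset with a smallest element (the root) in which each set $\{Q\preceq P\}$ is isomorphic to a compact real interval, each totally ordered convex subset is isomorphic to a real interval, and each non-empty subset has an infimum. The segment is $[P,Q]=\{A: P\wedge Q\preceq A\preceq P\text{ or }P\wedge Q\preceq A\preceq Q\}$. The weak topology is the coarsest one for which, for each $P$, the classes of the relation $Q_1\sim_P Q_2\Leftrightarrow(P,Q_1]\cap(P,Q_2]\neq\emptyset$ on the complement of $\{P\}$ are open. *)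

(* Defs.v *)
From HB Require Import structures.
From mathcomp Require Import all_boot all_order all_algebra.
From mathcomp Require Import generic_quotient archimedean.
From mathcomp Require Import complex.
From mathcomp Require Import all_classical all_reals.
From mathcomp Require Import ereal topology normedtype.
From Stdlib Require Import Relation_Operators.

Set Implicit Arguments.
Unset Strict Implicit.
Unset Printing Implicit Defensive.

Import Order.TTheory GRing.Theory Num.Theory.

Local Open Scope classical_set_scope.
Local Open Scope quotient_scope.
Local Open Scope ring_scope.

Record fps (K : Type) := Fps { fcoef : nat -> K }.

HB.instance Definition _ K := gen_eqMixin (fps K).
HB.instance Definition _ K := gen_choiceMixin (fps K).

Lemma fpsP K (f g : fps K) : fcoef f =1 fcoef g -> f = g.
Proof. by case: f g => [f] [g] /= /funext ->. Qed.

Section FpsRing.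
Variable K : comNzRingType.
Implicit Types (f g h : fps K) (p q : {poly K}).

Definition fpsC (c : K) : fps K := Fps (fun n => if n == 0%N then c else 0).
Definition fpsX : fps K := Fps (fun n => (n == 1%N)%:R).
Definition fps_opp f := Fps (fun n => - fcoef f n).
Definition fps_add f g := Fps (fun n => fcoef f n + fcoef g n).
Definition fps_mul f g :=
  Fps (fun n => \sum_(i < n.+1) fcoef f i * fcoef g (n - i)).

Fact fps_addA : associative fps_add.
Proof. by move=> f g h; apply: fpsP => n /=; rewrite addrA. Qed.
Fact fps_addC : commutative fps_add.
Proof. by move=> f g; apply: fpsP => n /=; rewrite addrC. Qed.
Fact fps_add0 : left_id (fpsC 0) fps_add.
Proof. by move=> f; apply: fpsP => n /=; rewrite if_same add0r. Qed.
Fact fps_addN : left_inverse (fpsC 0) fps_opp fps_add.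
Proof. by move=> f; apply: fpsP => n /=; rewrite if_same addNr. Qed.

HB.instance Definition _ := GRing.isZmodule.Build (fps K)
  fps_addA fps_addC fps_add0 fps_addN.

Let agree n f p := forall i, (i <= n)%N -> fcoef f i = p`_i.
Let tr n f := \poly_(i < n.+1) fcoef f i.

Let trP n f : agree n f (tr n f).
Proof. by move=> i le_in; rewrite coef_poly ltnS le_in. Qed.

Let agreeM n f g p q : agree n f p -> agree n g q -> agree n (fps_mul f g) (p * q).
Proof.
move=> fp gq i le_in; rewrite coefM /=; apply: eq_bigr => j _.
rewrite fp ?gq //; first exact: leq_trans (leq_subr _ _) le_in.
by apply: leq_trans le_in; rewrite -ltnS.
Qed.

Let agreeD n f g p q : agree n f p -> agree n g q -> agree n (fps_add f g) (p + q).
Proof. by move=> fp gq i le_in; rewrite coefD /= fp ?gq. Qed.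

Let agree1 n : agree n (fpsC 1) 1.
Proof. by move=> [|i] _; rewrite coef1. Qed.

Let agree_eq n f g p : agree n f p -> agree n g p -> fcoef f n = fcoef g n.
Proof. by move=> fp gp; rewrite fp ?gp. Qed.

Fact fps_mulA : associative fps_mul.
Proof.
move=> f g h; apply: fpsP => n.
apply: (@agree_eq n _ _ (tr n f * tr n g * tr n h)); last by do !apply: agreeM.
by rewrite -mulrA; do !apply: agreeM.
Qed.
Fact fps_mulC : commutative fps_mul.
Proof.
move=> f g; apply: fpsP => n.
apply: (@agree_eq n _ _ (tr n f * tr n g)); first exact: agreeM.
by rewrite mulrC; apply: agreeM.
Qed.
Fact fps_mul1 : left_id (fpsC 1) fps_mul.
Proof.
move=> f; apply: fpsP => n; apply: (@agree_eq n _ _ (1 * tr n f)).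
  exact: agreeM.
by rewrite mul1r.
Qed.
Fact fps_mulD : left_distributive fps_mul fps_add.
Proof.
move=> f g h; apply: fpsP => n.
apply: (@agree_eq n _ _ ((tr n f + tr n g) * tr n h)).
  by apply: agreeM => //; apply: agreeD.
by rewrite mulrDl; apply: agreeD; apply: agreeM.
Qed.
Fact fps_1neq0 : fpsC 1 != 0 :> fps K.
Proof. by apply/eqP => /(congr1 (fun f => fcoef f 0%N)) /eqP /=; rewrite oner_eq0. Qed.

HB.instance Definition _ := GRing.Zmodule_isComNzRing.Build (fps K)
  fps_mulA fps_mulC fps_mul1 fps_mulD fps_1neq0.

Definition fps_of_poly p : fps K := Fps (fun n => p`_n).

End FpsRing.

Arguments fpsX {K}.

(* A series is the function giving the coefficient of [x^q], for [q] rational. *)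
Record puiseux (K : nzRingType) := Puiseux {
  pcoef :> rat -> K;
  pcoefP : exists2 n, (0 < n)%N &
    forall q, pcoef q != 0 -> exists k : nat, q = k%:R / n%:R }.

HB.instance Definition _ K := gen_eqMixin (puiseux K).
HB.instance Definition _ K := gen_choiceMixin (puiseux K).

Lemma puiseuxP (K : nzRingType) (f g : puiseux K) : pcoef f =1 pcoef g -> f = g.
Proof.
case: f g => [f hf] [g hg] /= /funext fg.
by move: hg; rewrite -fg => hg; congr Puiseux; apply: Prop_irrelevance.
Qed.

Section PuiseuxRing.
Variable K : comNzRingType.
Implicit Types (f g h : puiseux K).

Definition pdenom n (f : rat -> K) :=
  (0 < n)%N /\ forall q, f q != 0 -> exists k : nat, q = k%:R / n%:R.

Lemma pdenomM n m f : (0 < m)%N -> pdenom n f -> pdenom (n * m) f.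
Proof.
move=> m0 [n0 hn]; split=> [|q /hn[k ->]]; first by rewrite muln_gt0 n0.
exists (k * m)%N; rewrite !natrM -mulf_div divff ?mulr1 //.
by rewrite pnatr_eq0 -lt0n.
Qed.

Lemma pdenom_common2 f g : exists n, pdenom n f /\ pdenom n g.
Proof.
have [n n0 hn] := pcoefP f; have [m m0 hm] := pcoefP g.
exists (n * m)%N; split; first exact: pdenomM.
by rewrite mulnC; apply: pdenomM.
Qed.

Lemma pdenom_common3 f g h : exists n, [/\ pdenom n f, pdenom n g & pdenom n h].
Proof.
have [n [nf ng]] := pdenom_common2 f g; have [m m0 hm] := pcoefP h.
exists (n * m)%N; split; try exact: pdenomM.
by case: nf => n0 _; rewrite mulnC; apply: pdenomM.
Qed.

Definition pser n (f : rat -> K) : fps K := Fps (fun k => f (k%:R / n%:R)).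

Lemma pser_inj n (f g : rat -> K) :
  pdenom n f -> pdenom n g -> pser n f = pser n g -> f =1 g.
Proof.
move=> [n0 hf] [_ hg] /(congr1 (@fcoef K)) e q.
case: (eqVneq (f q) 0) => [f0|/hf[k ->]]; last by have := congr1 (@^~ k) e.
case: (eqVneq (g q) 0) => [->//|/hg[k qE]].
by have := congr1 (@^~ k) e => /=; rewrite -qE.
Qed.

Definition pc_const (c : K) (q : rat) : K := if q == 0 then c else 0.
Definition pc_mul (f g : rat -> K) (q : rat) : K :=
  \sum_(a \in [set: rat]) f a * g (q - a).

Lemma pdenom_const n c : (0 < n)%N -> pdenom n (pc_const c).
Proof.
move=> n0; split=> // q; rewrite /pc_const; case: (q =P 0) => [->|_]; last by rewrite eqxx.
by exists 0%N; rewrite mul0r.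
Qed.

Lemma pdenom_opp n (f : rat -> K) : pdenom n f -> pdenom n (fun q => - f q).
Proof. by move=> [n0 hf]; split=> // q; rewrite oppr_eq0; apply: hf. Qed.

Lemma pdenom_add n (f g : rat -> K) :
  pdenom n f -> pdenom n g -> pdenom n (fun q => f q + g q).
Proof.
move=> [n0 hf] [_ hg]; split=> // q.
by case: (eqVneq (f q) 0) => [->|/hf//]; rewrite add0r; apply: hg.
Qed.

Lemma pdenom_mul n (f g : rat -> K) :
  pdenom n f -> pdenom n g -> pdenom n (pc_mul f g).
Proof.
move=> [n0 hf] [_ hg]; split=> // q.
case: (pselect (exists a, f a * g (q - a) != 0)) => [[a fg0] _|nofg].
  have [/hf[i ai]] : f a != 0 by apply: contra_neq fg0 => ->; rewrite mul0r.
  have [/hg[j qj]] : g (q - a) != 0 by apply: contra_neq fg0 => ->; rewrite mulr0.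
  by exists (i + j)%N; rewrite natrD mulrDl -ai -qj addrC subrK.
rewrite /pc_mul fsbig1 ?eqxx // => a _; apply/eqP/negPn/negP => h.
by apply: nofg; exists a.
Qed.

Lemma pser_mul n (f g : rat -> K) : pdenom n f -> pdenom n g ->
  pser n (pc_mul f g) = pser n f * pser n g.
Proof.
move=> [n0 hf] [_ hg]; apply: fpsP => k /=; rewrite /pc_mul.
have nz : n%:R != 0 :> rat by rewrite pnatr_eq0 -lt0n.
pose r (i : nat) : rat := i%:R / n%:R.
have rinj : injective r.
  by move=> i j /(mulIf (invr_neq0 nz)) /eqP; rewrite eqr_nat => /eqP.
rewrite -(@fsbig_widen _ _ _ _ (r @` `I_k.+1)) //; last first.
  move=> a /= [_ na]; apply: contrapT => /eqP fg0.
  apply: na.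
  have [/hf[i ai]] : f a != 0 by apply: contra_neq fg0 => ->; rewrite mul0r.
  have [/hg[j qj]] : g (k%:R / n%:R - a) != 0.
    by apply: contra_neq fg0 => ->; rewrite mulr0.
  exists i => //=; rewrite ltnS.
  have /rinj -> : r k = r (i + j)%N by rewrite /r natrD mulrDl -ai -qj addrC subrK.
  exact: leq_addr.
rewrite fsbig_image; last by move=> i j _ _; apply: rinj.
rewrite -fsbig_ord; apply: eq_bigr => i _ /=.
by rewrite /r -mulrBl natrB // -ltnS.
Qed.

Program Definition puiseux_const c : puiseux K := @Puiseux K (pc_const c) _.
Next Obligation.
by move=> c; have [n0 h] := @pdenom_const 1 c isT; exists 1%N.
Qed.
Program Definition puiseux_opp f : puiseux K := @Puiseux K (fun q => - f q) _.
Next Obligation.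
move=> f; have [n [nf _]] := pdenom_common2 f f.
by have [n0 h] := pdenom_opp nf; exists n.
Qed.
Program Definition puiseux_add f g : puiseux K := @Puiseux K (fun q => f q + g q) _.
Next Obligation.
move=> f g; have [n [nf ng]] := pdenom_common2 f g.
by have [n0 h] := pdenom_add nf ng; exists n.
Qed.
Program Definition puiseux_mul f g : puiseux K := @Puiseux K (pc_mul f g) _.
Next Obligation.
move=> f g; have [n [nf ng]] := pdenom_common2 f g.
by have [n0 h] := pdenom_mul nf ng; exists n.
Qed.

Fact puiseux_addA : associative puiseux_add.
Proof. by move=> f g h; apply: puiseuxP => q /=; rewrite addrA. Qed.
Fact puiseux_addC : commutative puiseux_add.
Proof. by move=> f g; apply: puiseuxP => q /=; rewrite addrC. Qed.
Fact puiseux_add0 : left_id (puiseux_const 0) puiseux_add.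
Proof. by move=> f; apply: puiseuxP => q /=; rewrite /pc_const if_same add0r. Qed.
Fact puiseux_addN : left_inverse (puiseux_const 0) puiseux_opp puiseux_add.
Proof. by move=> f; apply: puiseuxP => q /=; rewrite /pc_const if_same addNr. Qed.

HB.instance Definition _ := GRing.isZmodule.Build (puiseux K)
  puiseux_addA puiseux_addC puiseux_add0 puiseux_addN.

Fact puiseux_mulA : associative puiseux_mul.
Proof.
move=> f g h; have [n [nf ng nh]] := pdenom_common3 f g h.
apply: puiseuxP; apply: (@pser_inj n); try by do !apply: pdenom_mul.
by rewrite !pser_mul ?mulrA //; apply: pdenom_mul.
Qed.
Fact puiseux_mulC : commutative puiseux_mul.
Proof.
move=> f g; have [n [nf ng]] := pdenom_common2 f g.
apply: puiseuxP; apply: (@pser_inj n); try exact: pdenom_mul.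
by rewrite !pser_mul // mulrC.
Qed.
Fact puiseux_mul1 : left_id (puiseux_const 1) puiseux_mul.
Proof.
move=> f; have [n [nf _]] := pdenom_common2 f f; have [n0 _] := nf.
have n1 := @pdenom_const n 1 n0.
apply: puiseuxP; apply: (@pser_inj n) => //; first exact: pdenom_mul.
rewrite pser_mul //; suff -> : pser n (puiseux_const 1) = 1 by rewrite mul1r.
apply: fpsP => k /=; rewrite /pc_const mulf_eq0 invr_eq0 !pnatr_eq0.
by rewrite (gtn_eqF n0) orbF.
Qed.
Fact puiseux_mulD : left_distributive puiseux_mul puiseux_add.
Proof.
move=> f g h; have [n [nf ng nh]] := pdenom_common3 f g h.
have nfg := pdenom_add nf ng.
have nfh := pdenom_mul nf nh; have ngh := pdenom_mul ng nh.
apply: puiseuxP; apply: (@pser_inj n); first exact: pdenom_mul.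
  exact: pdenom_add.
rewrite pser_mul //.
have -> : pser n (puiseux_add f g) = pser n f + pser n g by exact: fpsP.
by rewrite mulrDl -!pser_mul //; apply: fpsP.
Qed.
Fact puiseux_1neq0 : puiseux_const 1 != 0 :> puiseux K.
Proof.
apply/eqP => /(congr1 (fun f : puiseux K => f 0)) /eqP /=.
by rewrite /pc_const eqxx oner_eq0.
Qed.

HB.instance Definition _ := GRing.Zmodule_isComNzRing.Build (puiseux K)
  puiseux_mulA puiseux_mulC puiseux_mul1 puiseux_mulD puiseux_1neq0.

Definition pc_fps (f : fps K) (q : rat) : K :=
  if q \is a Num.nat then fcoef f (Num.truncn q) else 0.

Lemma pdenom_fps n (f : fps K) : (0 < n)%N -> pdenom n (pc_fps f).
Proof.
move=> n0; split=> // q; rewrite /pc_fps; case: ifP => [|_]; last by rewrite eqxx.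
move=> /natrP[k ->] _; exists (k * n)%N.
by rewrite natrM mulfK // pnatr_eq0 -lt0n.
Qed.

Program Definition puiseux_of_fps (f : fps K) : puiseux K := @Puiseux K (pc_fps f) _.
Next Obligation. by move=> f; have [n0 h] := @pdenom_fps 1 f isT; exists 1%N. Qed.

Lemma pser_fps (f : fps K) : pser 1 (pc_fps f) = f.
Proof. by apply: fpsP => k /=; rewrite /pc_fps divr1 natr_nat natrK. Qed.

Fact puiseux_of_fps_additive : zmod_morphism puiseux_of_fps.
Proof.
move=> f g; apply: puiseuxP => q /=; rewrite /pc_fps.
by case: ifP => // _; rewrite subr0.
Qed.
Fact puiseux_of_fps_multiplicative : monoid_morphism puiseux_of_fps.
Proof.
have d (h : fps K) := @pdenom_fps 1 h isT.
split=> [|f g]; apply: puiseuxP.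
  apply: (pser_inj (d 1) (pdenom_const 1 (ltn0Sn 0))); rewrite pser_fps.
  by apply: fpsP => k; rewrite /= /pc_const divr1 pnatr_eq0.
apply: (pser_inj (d (f * g)) (pdenom_mul (d f) (d g))).
by rewrite pser_mul // !pser_fps.
Qed.
HB.instance Definition _ := GRing.isZmodMorphism.Build (fps K) (puiseux K)
  puiseux_of_fps puiseux_of_fps_additive.
HB.instance Definition _ := GRing.isMonoidMorphism.Build (fps K) (puiseux K)
  puiseux_of_fps puiseux_of_fps_multiplicative.

(* A series in [K[[x, y]]] is seen in [K[[x]][[y]]]: the coefficient of [y^j]
   in [f] is [fcoef f j : fps K]. When [g] has positive order, only finitely
   many [j] contribute to a given power of [x] in [\sum_j f_j(x) g^j], so that
   the finitely supported sum below is the one intended; it is not meaningful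
   for the other [g]. *)
Definition pc_subst (f : fps (fps K)) (g : puiseux K) (q : rat) : K :=
  \sum_(j \in [set: nat]) pcoef (puiseux_of_fps (fcoef f j) * g ^+ j) q.

Lemma pdenom_subst n (f : fps (fps K)) g : pdenom n g -> pdenom n (pc_subst f g).
Proof.
move=> ng; have [n0 _] := ng.
have nX j : pdenom n (g ^+ j).
  elim: j => [|j IH]; first exact: pdenom_const.
  by rewrite exprS; apply: pdenom_mul.
split=> // q; case: (pselect (exists k : nat, q = k%:R / n%:R)) => // nk.
rewrite /pc_subst fsbig1 ?eqxx // => j _; apply/eqP/negPn/negP => h; apply: nk.
have [_] : pdenom n (puiseux_of_fps (fcoef f j) * g ^+ j).
  by apply: pdenom_mul => //; apply: pdenom_fps.
exact.
Qed.

Program Definition puiseux_subst (f : fps (fps K)) (g : puiseux K) : puiseux K :=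
  @Puiseux K (pc_subst f g) _.
Next Obligation.
move=> f g; have [n [ng _]] := pdenom_common2 g g.
by have [n0 h] := pdenom_subst f ng; exists n.
Qed.

End PuiseuxRing.

Definition ordx (R : realType) (K : nzRingType) (f : puiseux K) : \bar R :=
  ereal_inf [set (ratr q)%:E | q in [set q | pcoef f q != 0]].

(* The divisor [Z(f)] is identified with the principal ideal of [f], that is
   with [f] up to multiplication by a unit, and a branch with its ideal. *)
Section Branches.
Variable A : comNzRingType.

Definition invertible (f : A) := exists g, f * g = 1.

Definition irreducible_elt (f : A) :=
  [/\ f != 0, ~ invertible f &
      forall g h, f = g * h -> invertible g \/ invertible h].

Definition Z (f : A) : set A := [set g | exists h, g = f * h].

Definition branch : set (set A) := [set Z f | f in irreducible_elt].

End Branches.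

Section Surface.
Variables (R : realType) (O : comAlgType R[i]).

(* [psi f] is the expansion of [f] in the coordinates; [x] is the variable of
   the inner series and [y] that of the outer one. *)
Definition local_coordinates (psi : {rmorphism O -> fps (fps R[i])}) :=
  bijective psi /\ forall c : R[i], psi c%:A = fpsC (fpsC c).

Definition adapted_coordinates (L : set O)
    (psi : {rmorphism O -> fps (fps R[i])}) :=
  local_coordinates psi /\ L = psi @^-1` Z (fpsC fpsX).

Definition smooth_branch (L : set O) :=
  exists psi : {rmorphism O -> fps (fps R[i])}, adapted_coordinates L psi.

Local Open Scope ereal_scope.

Definition semivaluation (nu : O -> \bar R) :=
  [/\ forall f, 0 <= nu f,
      forall f g, nu (f * g)%R = nu f + nu g,
      forall f g, mine (nu f) (nu g) <= nu (f + g)%R,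
      forall c : R[i], c != 0%R -> nu c%:A%R = 0 &
      nu 0%R = +oo].

Definition semivals_L (L : set O) : set {ptws O -> \bar R} :=
  [set nu | semivaluation nu /\ forall f, L = Z f -> nu f = 1].

Definition sval_le (nu1 nu2 : {ptws O -> \bar R}) := forall f, nu1 f <= nu2 f.

Definition ord_along (L : set O) : {ptws O -> \bar R} :=
  fun f => ereal_sup [set (n%:R)%:E |
    n in [set n | exists2 g, L = Z g & Z (g ^+ n)%R f]].

Section Coordinates.
Variables (L : set O) (psi : {rmorphism O -> fps (fps R[i])}).

Definition weierstrass_of (A : set O) (p : {poly fps R[i]}) :=
  [/\ p \is monic, irreducible_elt p,
      forall j, (j < (size p).-1)%N -> fcoef p`_j 0 = 0%R &
      A = psi @^-1` Z (fps_of_poly p)].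

Definition Zer (A : set O) : set (puiseux R[i]) :=
  [set eta | exists2 p, weierstrass_of A p &
     root (map_poly (@puiseux_of_fps R[i]) p) eta].

Definition kL (A B : set O) : \bar R :=
  ereal_sup [set ordx R (eta - zeta)%R | eta in Zer A & zeta in Zer B].

Definition NP (xi : puiseux R[i]) (alpha : \bar R) : set (puiseux R[i]) :=
  [set eta | alpha <= ordx R (eta - xi)%R].

Definition nu_xi (xi : puiseux R[i]) (alpha : \bar R) : {ptws O -> \bar R} :=
  fun f => if alpha == 0 then ord_along L f
           else ereal_inf [set ordx R (puiseux_subst (psi f) eta) |
                             eta in NP xi alpha].

(* The disjoint union of the segments [Theta_L(A)], for [A] in [C]: the point
   of exponent [alpha] of [Theta_L(A)] is [(A, alpha)], and [Theta_L(L)] is the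
   single point [(L, 0)]. *)
Definition EW_points (C : set (set O)) : set (set O * \bar R) :=
  [set p | [/\ C p.1, 0 <= p.2 & p.1 = L -> p.2 = 0]].

(* The points of [Theta_L(L)] and of exponent 0 are all glued to the root. *)
Definition EW_glue (C : set (set O)) (p q : set_type (EW_points C)) :=
  (val p).2 = (val q).2 /\
  [\/ (val p).1 = L, (val q).1 = L |
      (val p).2 <= kL (val p).1 (val q).1].

Definition EW_rel (C : set (set O)) : rel (set_type (EW_points C)) :=
  fun p q => `[< clos_refl_sym_trans _ (@EW_glue C) p q >].

Fact EW_refl C : reflexive (@EW_rel C).
Proof. by move=> p; apply/asboolP; apply: rst_refl. Qed.
Fact EW_sym C : symmetric (@EW_rel C).
Proof.
by move=> p q; apply/asboolP/asboolP => h; apply: rst_sym.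
Qed.
Fact EW_trans C : transitive (@EW_rel C).
Proof.
by move=> q p r /asboolP pq /asboolP qr; apply/asboolP; apply: rst_trans pq qr.
Qed.
Canonical EW_equiv C := EquivRel _ (@EW_refl C) (@EW_sym C) (@EW_trans C).

Definition Theta (C : set (set O)) : Type := {eq_quot EW_equiv C}.

(* Neither the representative [(A, alpha)] of the point nor the root of [f_A]
   matters. *)
Definition V_map (C : set (set O)) (P : Theta C) : {ptws O -> \bar R} :=
  let p := val (repr P) in
  if `[< p.1 = L >] then ord_along L else nu_xi (xget 0%R (Zer p.1)) p.2.

Definition V_image (C : set (set O)) : set {ptws O -> \bar R} := range (@V_map C).

End Coordinates.

End Surface.

Definition curve_index (A : comNzRingType) :=
  {j : set (set A) | [/\ j `<=` @branch A, finite_set j & j !=set0]}.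

Section Attaching.
Variables (X : choiceType) (le : X -> X -> Prop) (T : set X).

Definition is_meet (P Q M : X) :=
  [/\ T M, le M P, le M Q &
      forall M', T M' -> le M' P -> le M' Q -> le M' M].

Definition segment (P Q : X) : set X :=
  [set A | T A /\ exists2 M, is_meet P Q M &
     (le M A /\ le A P) \/ (le M A /\ le A Q)].

Definition attaching_pt (T' : set X) (P Q : X) :=
  T' Q /\ segment Q P `&` T' = [set Q].

(* For [P] in [T]; the default value is used only if there is no attaching
   point. *)
Definition attach (T' : set X) (P : X) : X := xget P (attaching_pt T' P).

End Attaching.

Section Projective.
Variables (I : Type) (X : topologicalType) (T : I -> set X).
(* [f j l] is the map from [T l] to [T j], when [T j `<=` T l]. *)
Variable f : I -> I -> X -> X.

Definition directed_by_inclusion :=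
  forall j k, exists l, T j `<=` T l /\ T k `<=` T l.

Definition projective_system :=
  [/\ forall j l, T j `<=` T l -> set_fun (T l) (T j) (f j l),
      forall j, {in T j, f j j =1 id} &
      forall j k l, T j `<=` T k -> T k `<=` T l ->
        {in T l, f j k \o f k l =1 f j l}].

Definition projective_system_continuous :=
  forall j l, T j `<=` T l -> {within T l, continuous (f j l)}.

Definition projective_limit : set {ptws I -> X} :=
  [set u | (forall j, T j (u j)) /\
           forall j l, T j `<=` T l -> f j l (u l) = u j].

End Projective.

Definition homeomorphism (X Y : topologicalType) (A : set X) (B : set Y)
    (f : X -> Y) :=
  [/\ set_bij A B f, {within A, continuous f} &
      exists2 g : Y -> X, {within B, continuous g} & {in A, cancel f g}].

(* Main.v *)
Require Import Defs.
From HB Require Import structures.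
From mathcomp Require Import all_boot all_order all_algebra.
From mathcomp Require Import archimedean complex.
From mathcomp Require Import all_classical all_reals.
From mathcomp Require Import ereal topology normedtype.
From mathcomp Require Import sequences trigo.
From mathcomp Require Import ring lra.

Set Implicit Arguments.
Unset Strict Implicit.
Unset Printing Implicit Defensive.

Import Order.TTheory GRing.Theory Num.Theory.

Local Open Scope classical_set_scope.
Local Open Scope ring_scope.

(** The theorem reduces to the description of the order of the space of
    semivaluations by Newton-Puiseux series.

    A semivaluation [nu] with [nu(x) = 1] is determined by its values at the
    minimal polynomials [minp eta] of the Puiseux series [eta] of positive order:
    by Weierstrass preparation and the Newton-Puiseux theorem, an element is a
    product of a power of [x], of a unit and of such polynomials. The points
    [nu_xi xi a] of the Eggers-Wall trees are computed at a polynomial from the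
    contacts of [xi] with its roots ([nu_xi_roots]), which shows that they are
    semivaluations.

    The main point is that, for each [nu] and [xi], there is a largest exponent
    [contact nu xi] such that [nu_xi xi (contact nu xi) <= nu], that this point
    and [nu] have the same value at [minp xi], and that the points obtained in
    this way for two series are comparable ([contact_pair]). To see this, extend
    [nu] to the polynomials in [y] whose coefficients are Puiseux series
    ([extension]). For an extension [w], let [z] be a conjugate of [xi] such that
    [w (y - z)] is the largest. By the ultrametric inequality it determines the
    values of [w] at the other factors [y - z'] of [minp xi], and bounds from below
    those at all the [y - z']; it is the contact. As the contact of two series is
    at least the minimum of [w (y - z)] and [w (y - z')], the points that they
    define are comparable. For this argument [w] only has to be submultiplicative,
    ultrametric, and multiplicative on products of finitely many given linear
    factors. Such a [w] is built from the smallest extension of [nu], defined by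
    the grading of Puiseux series by the classes of exponents modulo [Z]: smooth
    it, so that it commutes with powers, and then replace it, for each given
    factor [u], by the limit of [w (h u^k) - k w (u)].

    It follows that each tree is closed downwards ([downset]) and that the points
    of a tree below [nu] have a maximum ([projection_ex]), which is the attaching
    point ([attaching_ptP]). Hence attaching maps compose, and attaching in the
    whole space or in a larger tree are the same operation. A semivaluation and
    its projection to a tree that contains the branches of [f] have the same value
    at [f] ([projection_value]): this provides the inverse of the map to the
    projective limit, as the function whose value at [f] is that of any member of
    the family with a large enough index, and this inverse is continuous since
    each of its values is a coordinate. The projections are continuous because
    they depend on [nu] through its values at the minimal polynomials of finitely
    many branches ([attach_continuous]). *)

(** * Coefficients and orders of Puiseux series *)

Section PuiseuxBasics.
Variable K : comNzRingType.
Implicit Types (f g h : puiseux K) (a b : fps K).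

Lemma pcoefD f g q : pcoef (f + g) q = pcoef f q + pcoef g q. Proof. by []. Qed.
Lemma pcoefN f q : pcoef (- f) q = - pcoef f q. Proof. by []. Qed.
Lemma pcoefB f g q : pcoef (f - g) q = pcoef f q - pcoef g q. Proof. by []. Qed.
Lemma pcoef0 q : pcoef (0 : puiseux K) q = 0.
Proof. by rewrite /= /pc_const if_same. Qed.
Lemma pcoef1 q : pcoef (1 : puiseux K) q = (q == 0)%:R.
Proof. by rewrite /= /pc_const; case: ifP. Qed.
Lemma pcoef_sum (I : Type) (s : seq I) (F : I -> puiseux K) q :
  pcoef (\sum_(i <- s) F i) q = \sum_(i <- s) pcoef (F i) q.
Proof.
elim/big_rec2: _ => [|i x y _ <-]; first exact: pcoef0.
by rewrite pcoefD.
Qed.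

Lemma pcoef_lt0 f q : q < 0 -> pcoef f q = 0.
Proof.
move=> q0; have [n n0 hn] := pcoefP f; apply/eqP/negPn/negP => /hn[k qk].
by move: q0; rewrite qk ltNge divr_ge0.
Qed.

Lemma puiseux_neq0 f : f != 0 -> exists q, pcoef f q != 0.
Proof.
move=> f0; apply: contrapT => nf; case/eqP: f0; apply: puiseuxP => q.
by rewrite pcoef0; apply/eqP/negPn/negP => fq; apply: nf; exists q.
Qed.

Lemma ratn_le n (i j : nat) : (0 < n)%N ->
  ((i%:R / n%:R : rat) <= j%:R / n%:R) = (i <= j)%N.
Proof. by move=> n0; rewrite ler_pM2r ?invr_gt0 ?ltr0n // ler_nat. Qed.

Lemma pval_ex f : f != 0 ->
  exists2 q, pcoef f q != 0 & forall q', pcoef f q' != 0 -> q <= q'.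
Proof.
move=> /puiseux_neq0[q0 f0]; have [n n0 hn] := pcoefP f.
have [k0 k0E] := hn _ f0.
have ex : exists k : nat, pcoef f (k%:R / n%:R) != 0 by exists k0; rewrite -k0E.
case: (ex_minnP ex) => k fk kmin; exists (k%:R / n%:R) => // q' f'.
by have [k' k'E] := hn _ f'; rewrite k'E ratn_le // kmin // -k'E.
Qed.

(** The support of the second factor being non-negative, only finitely many
    exponents of the first one contribute. *)
Lemma pcoefM_sum f g n q (k : nat) : pdenom n f -> q <= k%:R / n%:R ->
  pcoef (f * g) q =
  \sum_(i < k.+1) pcoef f (i%:R / n%:R) * pcoef g (q - i%:R / n%:R).
Proof.
move=> [n0 hf] qk.
have nz : n%:R != 0 :> rat by rewrite pnatr_eq0 -lt0n.
pose r (i : nat) : rat := i%:R / n%:R.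
have rinj : injective r.
  by move=> i j /(mulIf (invr_neq0 nz)) /eqP; rewrite eqr_nat => /eqP.
transitivity (pc_mul f g q) => //; rewrite /pc_mul.
rewrite -(@fsbig_widen _ _ _ _ (r @` `I_k.+1)) //; last first.
  move=> a /= [_ na]; apply: contrapT => /eqP fg0.
  apply: na.
  have fa0 : pcoef f a != 0 by apply: contra_neq fg0 => ->; rewrite mul0r.
  have [i ai] := hf _ fa0.
  exists i => //=; rewrite ltnS -(ratn_le _ _ n0) -ai.
  apply: le_trans qk; rewrite -subr_ge0 leNgt; apply/negP => /(pcoef_lt0 g) g0.
  by move: fg0; rewrite g0 mulr0 eqxx.
rewrite fsbig_image; last by move=> i j _ _; apply: rinj.
by rewrite -fsbig_ord.
Qed.

Lemma pcoef_fps a q :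
  pcoef (puiseux_of_fps a) q = if q \is a Num.nat then fcoef a (Num.truncn q) else 0.
Proof. by []. Qed.
Lemma pcoef_fpsn a n : pcoef (puiseux_of_fps a) n%:R = fcoef a n.
Proof. by rewrite pcoef_fps natr_nat natrK. Qed.

Lemma puiseux_of_fps_inj : injective (@puiseux_of_fps K).
Proof. by move=> a b ab; apply: fpsP => n; rewrite -!pcoef_fpsn ab. Qed.

Lemma pcoef_fpsM a g q (k : nat) : q <= k%:R ->
  pcoef (puiseux_of_fps a * g) q = \sum_(i < k.+1) fcoef a i * pcoef g (q - i%:R).
Proof.
move=> qk; have d : pdenom 1 (puiseux_of_fps a) by exact: pdenom_fps.
rewrite (pcoefM_sum g (k := k) d) ?divr1 //.
by apply: eq_bigr => i _; rewrite divr1 pcoef_fpsn.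
Qed.

(** The order of [f] is at least [c]; unlike [ordx], it has values in [rat]. *)
Definition vanish_below (c : rat) f := forall q, q < c -> pcoef f q = 0.

Lemma vanish_below0 f : vanish_below 0 f.
Proof. by move=> q; apply: pcoef_lt0. Qed.
Lemma vanish_belowD c f g : vanish_below c f -> vanish_below c g -> vanish_below c (f + g).
Proof. by move=> fc gc q qc; rewrite pcoefD fc ?gc ?addr0. Qed.
Lemma vanish_belowN c f : vanish_below c f -> vanish_below c (- f).
Proof. by move=> fc q qc; rewrite pcoefN fc ?oppr0. Qed.
Lemma vanish_below_le c d f : c <= d -> vanish_below d f -> vanish_below c f.
Proof. by move=> cd fd q qc; apply: fd; apply: lt_le_trans cd. Qed.
Lemma vanish_belowM c d f g :
  vanish_below c f -> vanish_below d g -> vanish_below (c + d) (f * g).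
Proof.
move=> fc gd q qcd; have [n [nf _]] := pdenom_common2 f f.
have n0 : 0 < n%:R :> rat by rewrite ltr0n; case: nf.
have [k kq] : exists k : nat, q <= k%:R / n%:R.
  exists (Num.truncn (`|q| * n%:R)).+1; rewrite ler_pdivlMr //.
  apply: (@le_trans _ _ (`|q| * n%:R)); first by rewrite ler_pM2r // ler_norm.
  by rewrite ltW // truncnS_gt.
rewrite (pcoefM_sum g nf kq) big1 // => i _.
have [ic|ci] := ltP (i%:R / n%:R) c; first by rewrite fc ?mul0r.
by rewrite gd ?mulr0 //; lra.
Qed.
Lemma vanish_belowX c f n : vanish_below c f -> vanish_below (c *+ n) (f ^+ n).
Proof.
move=> fc; elim: n => [|n IH]; first by rewrite mulr0n; apply: vanish_below0.
by rewrite exprS mulrS; apply: vanish_belowM.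
Qed.
Lemma vanish_below_sum c (I : Type) (s : seq I) (F : I -> puiseux K) :
  (forall i, vanish_below c (F i)) -> vanish_below c (\sum_(i <- s) F i).
Proof.
move=> Fc; elim/big_rec: _ => [q _|i x _]; first exact: pcoef0.
exact: vanish_belowD.
Qed.

Lemma vanish_all f : (forall n : nat, vanish_below n%:R f) -> f = 0.
Proof.
move=> fn; apply: puiseuxP => q; rewrite pcoef0.
apply: (fn (Num.truncn `|q|).+1).
by apply: le_lt_trans (truncnS_gt _); apply: ler_norm.
Qed.

Lemma puiseux_pos_vanish f : pcoef f 0 = 0 -> exists2 c, 0 < c & vanish_below c f.
Proof.
move=> f0; have [n n0 hn] := pcoefP f; exists (n%:R^-1); first by rewrite invr_gt0 ltr0n.
move=> q qn; apply/eqP/negPn/negP => fq; have [[|k] qk] := hn _ fq.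
  by move: fq; rewrite qk mul0r f0 eqxx.
move: qn; rewrite qk -[X in _ < X]mul1r ltr_pM2r ?invr_gt0 ?ltr0n //.
by rewrite ltNge ler1n.
Qed.

Definition pc_X (r : rat) (q : rat) : K := ((q == r) && (0 <= r))%:R.
Fact pc_X_subproof r : exists2 n, (0 < n)%N &
  forall q, pc_X r q != 0 -> exists k : nat, q = k%:R / n%:R.
Proof.
rewrite /pc_X; exists `|denq r|%N; first by rewrite absz_gt0 denq_neq0.
move=> q; case: andP => [[/eqP -> r0] _|_]; last by rewrite eqxx.
exists `|numq r|%N; rewrite -[LHS]divq_num_den; congr (_ / _).
  by rewrite -[in LHS](gez0_abs (_ : 0 <= numq r)) ?numq_ge0.
by rewrite -[in LHS](gez0_abs (_ : 0 <= denq r)) ?denq_ge0.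
Qed.
Definition puiseux_X r : puiseux K := Puiseux (pc_X_subproof r).

Lemma pcoefXM r f q : 0 <= r -> pcoef (puiseux_X r * f) q = pcoef f (q - r).
Proof.
move=> r0; transitivity (pc_mul (puiseux_X r) f q) => //; rewrite /pc_mul.
rewrite -(@fsbig_widen _ _ _ _ [set r]) //; last first.
  by move=> a /= [_ /eqP/negbTE]; rewrite /pc_X => ->; rewrite mul0r.
by rewrite fsbig_set1 /= /pc_X eqxx r0 mul1r.
Qed.

Lemma puiseux_XD r s : 0 <= r -> 0 <= s ->
  puiseux_X (r + s) = puiseux_X r * puiseux_X s.
Proof.
move=> r0 s0; apply: puiseuxP => q; rewrite pcoefXM //= /pc_X addr_ge0 // s0.
by rewrite [r + s]addrC -subr_eq.
Qed.
Lemma puiseux_X0 : puiseux_X 0 = 1.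
Proof. by apply: puiseuxP => q; rewrite pcoef1 /= /pc_X lexx andbT. Qed.
Lemma puiseux_Xn r n : 0 <= r -> puiseux_X r ^+ n = puiseux_X (r *+ n).
Proof.
move=> r0; elim: n => [|n IH]; first by rewrite mulr0n puiseux_X0.
by rewrite exprS IH mulrS puiseux_XD // mulrn_wge0.
Qed.
Lemma puiseux_X_nat n : puiseux_X n%:R = puiseux_of_fps (fpsX ^+ n).
Proof.
have -> : puiseux_X n%:R = puiseux_X 1 ^+ n by rewrite puiseux_Xn.
rewrite rmorphXn; congr (_ ^+ _); apply: puiseuxP => q.
rewrite pcoef_fps /= /pc_X ler01 andbT.
case: ifP => [/natrP[k ->]|/negbT h]; first by rewrite natrK (eqr_nat _ k 1).
by case: eqP h => // ->; rewrite rpred1.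
Qed.

Lemma vanish_belowE r f : 0 <= r -> vanish_below r f ->
  exists2 g, f = puiseux_X r * g & forall q, pcoef g q = pcoef f (q + r).
Proof.
move=> r0 fr.
have hg : exists2 n, (0 < n)%N &
    forall q, pcoef f (q + r) != 0 -> exists k : nat, q = k%:R / n%:R.
  have [n [[n0 nf] [_ nX]]] := pdenom_common2 f (puiseux_X r).
  exists n => // q fq; have [k kE] := nf _ fq.
  have [|l lE] := nX r; first by rewrite /= /pc_X eqxx r0 oner_eq0.
  have q0 : 0 <= q.
    by rewrite leNgt; apply/negP => q0; move: fq; rewrite fr ?eqxx // gtrDr.
  have lk : (l <= k)%N by rewrite -(ratn_le _ _ n0) -kE -lE lerDr.
  by exists (k - l)%N; rewrite natrB // mulrBl -kE -lE addrK.
exists (Puiseux hg) => //; apply: puiseuxP => q.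
by rewrite pcoefXM //= subrK.
Qed.

End PuiseuxBasics.

Section ClassicalInverse.
Variable A : comNzRingType.

Definition inv_unit : {pred A} := [pred f | `[< invertible f >]].
Definition inv_fun (f : A) : A := if f \in inv_unit then xget 0 (fun g => f * g = 1) else f.

Lemma inv_fun_mulVr : {in inv_unit, left_inverse 1 inv_fun *%R}.
Proof.
move=> f fu; rewrite /inv_fun fu; move: fu => /asboolP[g fg].
by case: xgetP => [h _ /=|/(_ g)//]; rewrite mulrC.
Qed.
Lemma inv_fun_unitP (f g : A) : g * f = 1 -> f \in inv_unit.
Proof. by move=> gf; apply/asboolP; exists g; rewrite mulrC. Qed.
Lemma inv_fun_out : {in [predC inv_unit], inv_fun =1 id}.
Proof. by move=> f; rewrite inE /= /inv_fun => /negbTE ->. Qed.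

End ClassicalInverse.

Section PuiseuxDomain.
Variable K : idomainType.
Implicit Types f g : puiseux K.

(** No cancellation occurs at the sum of the orders. *)
Lemma pcoefM_min f g q q' :
  vanish_below q f -> vanish_below q' g -> pcoef (f * g) (q + q') = pcoef f q * pcoef g q'.
Proof.
move=> fq gq'; transitivity (pc_mul f g (q + q')) => //; rewrite /pc_mul.
rewrite -(@fsbig_widen _ _ _ _ [set q]) //; last first.
  move=> a /= [_ /eqP]; rewrite neq_lt => /orP[aq|qa]; first by rewrite fq ?mul0r.
  by rewrite gq' ?mulr0 //; lra.
by rewrite fsbig_set1 addrAC subrr add0r.
Qed.

Lemma pval_vanish f q : (forall q', pcoef f q' != 0 -> q <= q') -> vanish_below q f.
Proof.
move=> h q' q'q; apply/eqP/negPn/negP => /h.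
by rewrite leNgt q'q.
Qed.

Fact puiseux_integral f g : f * g = 0 -> (f == 0) || (g == 0).
Proof.
move=> fg0; apply/negPn/negP; rewrite negb_or => /andP[/pval_ex[q fq /pval_vanish fm]].
move=> /pval_ex[q' gq' /pval_vanish gm].
have := pcoefM_min fm gm; rewrite fg0 pcoef0 => /esym/eqP.
by rewrite mulf_eq0 (negbTE fq) (negbTE gq').
Qed.

HB.instance Definition _ := GRing.ComNzRing_hasMulInverse.Build (puiseux K)
  (@inv_fun_mulVr (puiseux K)) (@inv_fun_unitP (puiseux K)) (@inv_fun_out (puiseux K)).
HB.instance Definition _ := GRing.ComUnitRing_isIntegral.Build (puiseux K)
  puiseux_integral.

End PuiseuxDomain.

Section OrdX.
Variables (R : realType) (K : idomainType).
Implicit Types f g : puiseux K.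
Local Open Scope ereal_scope.

Lemma ordx_ge (c : rat) f : vanish_below c f -> (ratr c)%:E <= ordx R f.
Proof.
move=> fc; apply/ereal_infP => _ [q /= fq <-]; rewrite lee_fin ler_rat leNgt.
by apply/negP => /fc f0; rewrite f0 eqxx in fq.
Qed.

Lemma ordx_le q f : pcoef f q != 0%R -> ordx R f <= (ratr q)%:E.
Proof. by move=> fq; apply: ereal_inf_lbound; exists q. Qed.

Lemma ordxE q f : vanish_below q f -> pcoef f q != 0%R -> ordx R f = (ratr q)%:E.
Proof. by move=> fm fq; apply/eqP; rewrite eq_le ordx_le // ordx_ge. Qed.

Lemma ordx0 : ordx R (0%R : puiseux K) = +oo.
Proof.
apply/eqP; rewrite -leye_eq; by apply/ereal_infP => y [q]; rewrite /mkset pcoef0 eqxx.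
Qed.

Variant ordx_spec f : \bar R -> Prop :=
| OrdxZero of f = 0%R : ordx_spec f +oo
| OrdxFin q of vanish_below q f & pcoef f q != 0%R & (0 <= q)%R :
    ordx_spec f (ratr q)%:E.

Lemma ordxP f : ordx_spec f (ordx R f).
Proof.
case: (eqVneq f 0%R) => [->|f0]; first by rewrite ordx0; constructor.
have [q fq /pval_vanish fm] := pval_ex f0.
rewrite (ordxE fm fq); constructor => //.
by rewrite leNgt; apply/negP => /(pcoef_lt0 f) fq0; rewrite fq0 eqxx in fq.
Qed.

Lemma ordx_ge0 f : 0 <= ordx R f.
Proof. by case: ordxP => // q _ _ q0; rewrite lee_fin ler0q. Qed.

Lemma ordxM f g : ordx R (f * g)%R = ordx R f + ordx R g.
Proof.
case: (ordxP f) => [->|q fm fq q0].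
  by rewrite mul0r ordx0 addye // gt_eqF // (lt_le_trans _ (ordx_ge0 g)) ?ltNye.
case: (ordxP g) => [->|q' gm gq q'0]; first by rewrite mulr0 ordx0 addey.
rewrite -EFinD -rmorphD; apply: ordxE; first exact: vanish_belowM.
by rewrite pcoefM_min // mulf_neq0.
Qed.

Lemma ordxN f : ordx R (- f)%R = ordx R f.
Proof.
by congr ereal_inf; apply/seteqP; split=> _ [q /= fq <-]; exists q => //=; move: fq; rewrite oppr_eq0.
Qed.

Lemma ordxB f g : ordx R (f - g)%R = ordx R (g - f)%R.
Proof. by rewrite -ordxN opprB. Qed.

Lemma ordxD f g : mine (ordx R f) (ordx R g) <= ordx R (f + g)%R.
Proof.
apply/ereal_infP => _ [q /= fgq <-].
have [f0|/(ordx_le) fq] := eqVneq (pcoef f q) 0%R; last by rewrite ge_min fq.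
by rewrite ge_min (@ordx_le q g) ?orbT //; move: fgq; rewrite f0 add0r.
Qed.

Lemma ordx_tri f g h : mine (ordx R (f - g)%R) (ordx R (g - h)%R) <= ordx R (f - h)%R.
Proof. by have := ordxD (f - g)%R (g - h)%R; rewrite addrA subrK. Qed.

Lemma ordx1 : ordx R (1%R : puiseux K) = 0.
Proof.
rewrite (@ordxE 0 1%R) ?rmorph0 //; first exact: vanish_below0.
by rewrite pcoef1 eqxx oner_eq0.
Qed.

Lemma ordxX r : (0 <= r)%R -> ordx R (puiseux_X K r) = (ratr r)%:E.
Proof.
move=> r0; apply: ordxE => [q qr|] /=; rewrite /pc_X ?eqxx ?r0 ?oner_eq0 //.
by rewrite lt_eqF.
Qed.

Lemma ordx_gt0 f : 0 < ordx R f <-> pcoef f 0 = 0%R.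
Proof.
split=> [|f0]; last first.
  have [c c0 fc] := puiseux_pos_vanish f0.
  by apply: lt_le_trans (ordx_ge fc); rewrite lte_fin ltr0q.
case: ordxP => [-> _|q fm fq q0]; first exact: pcoef0.
by rewrite lte_fin ltr0q => q0'; rewrite fm.
Qed.

Lemma ordx_prod (I : Type) (s : seq I) (F : I -> puiseux K) :
  ordx R (\prod_(i <- s) F i)%R = \sum_(i <- s) ordx R (F i).
Proof. by elim/big_rec2: _ => [|i x y _ <-]; rewrite ?ordx1 ?ordxM. Qed.

End OrdX.

(** * Automorphisms of the ring of Puiseux series *)

Section Scaling.
Variable K : comNzRingType.
Implicit Types (f g : puiseux K).

Fact pscale_subproof (r : rat) f : 0 < r -> exists2 n, (0 < n)%N &
  forall q, pcoef f (q / r) != 0 -> exists k : nat, q = k%:R / n%:R.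
Proof.
move=> r0; have [n n0 hn] := pcoefP f.
exists (n * `|denq r|)%N; first by rewrite muln_gt0 n0 absz_gt0 denq_neq0.
move=> q /hn[k qk]; exists (k * `|numq r|)%N.
have -> : q = k%:R / n%:R * r by rewrite -qk divfK ?gt_eqF.
rewrite -{1}[r]divq_num_den !natrM -mulf_div; congr (_ * (_ / _)).
  by rewrite -[in LHS](gez0_abs (_ : 0 <= numq r)) // numq_ge0 ltW.
by rewrite -[in LHS](gez0_abs (_ : 0 <= denq r)).
Qed.

(** The substitution of [x^r] for [x]. *)
Definition pscale (r : rat) (r0 : 0 < r) f : puiseux K := Puiseux (pscale_subproof f r0).

Variables (r : rat) (r0 : 0 < r).

Fact pscale_additive : zmod_morphism (pscale r0).
Proof. by move=> f g; apply: puiseuxP. Qed.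
Fact pscale_multiplicative : monoid_morphism (pscale r0).
Proof.
have rU : r != 0 by rewrite gt_eqF.
split=> [|f g]; apply: puiseuxP => q /=.
  by rewrite /pc_const mulf_eq0 invr_eq0 (negbTE rU) orbF.
rewrite /pc_mul [RHS](reindex_fsbigT (fun a => a * r)) /=.
  by apply: eq_fsbigr => a _; rewrite mulrBl !mulfK.
by exists (fun a => a / r) => a; rewrite ?mulfK ?divfK.
Qed.
HB.instance Definition _ := GRing.isZmodMorphism.Build (puiseux K) (puiseux K)
  (pscale r0) pscale_additive.
HB.instance Definition _ := GRing.isMonoidMorphism.Build (puiseux K) (puiseux K)
  (pscale r0) pscale_multiplicative.

Lemma pscale_inj : injective (pscale r0).
Proof.
move=> f g fg; apply: puiseuxP => q; have rU : r != 0 by rewrite gt_eqF.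
by have := congr1 (fun h : puiseux K => h (q * r)) fg; rewrite /= mulfK.
Qed.

Lemma pscaleK (r1 : 0 < r^-1) : cancel (pscale r1) (pscale r0).
Proof.
by move=> f; apply: puiseuxP => q; rewrite /= invrK divfK // gt_eqF.
Qed.

End Scaling.

Lemma pscale_fps (K : comNzRingType) n (n0 : 0 < n%:R :> rat) (f : puiseux K) : pdenom n f ->
  pscale n0 f = puiseux_of_fps (pser n f).
Proof.
move=> [_ hf]; apply: puiseuxP => q; rewrite pcoef_fps /=.
case: ifP => [/natrP[k ->]|qn]; first by rewrite natrK.
apply/eqP/negPn/negP => /hf[k qk]; move/negP: qn; apply.
have -> : q = k%:R by rewrite -[q](divfK (lt0r_neq0 n0)) qk divfK // lt0r_neq0.
exact: natr_nat.
Qed.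

Section Galois.
Variable R : realType.
Local Notation C := R[i].
Local Notation P := (puiseux C).
Implicit Types (q : rat) (f g : P).

(** The character [exp (2 i pi q)] of [Q]. *)
Definition rot_char q : C := Complex (cos (pi *+ 2 * ratr q)) (sin (pi *+ 2 * ratr q)).

Lemma rot_charD q q' : rot_char (q + q') = rot_char q * rot_char q'.
Proof.
rewrite /rot_char rmorphD /= mulrDr cosD sinD /GRing.mul /=.
by congr Complex; rewrite addrC.
Qed.

Lemma rot_char0 : rot_char 0 = 1.
Proof. by rewrite /rot_char rmorph0 mulr0 cos0 sin0. Qed.

Lemma rot_charn (n : nat) : rot_char n%:R = 1.
Proof.
elim: n => [|n IH]; first exact: rot_char0.
rewrite -addn1 natrD rot_charD IH mul1r /rot_char rmorph1 mulr1.
by rewrite cos2pi sin2pi.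
Qed.

Lemma rot_char_neq0 q : rot_char q != 0.
Proof.
apply/eqP => q0; have := rot_charD q (- q).
by rewrite subrr rot_char0 q0 mul0r => /eqP; rewrite oner_eq0.
Qed.

Lemma rot_charX q n : rot_char (q *+ n) = rot_char q ^+ n.
Proof.
elim: n => [|n IH]; first by rewrite mulr0n rot_char0.
by rewrite mulrS exprS rot_charD IH.
Qed.

(** For [0 < t < 1], the real part [1 - 2 sin (pi t) ^ 2] is less than 1. *)
Lemma rot_char_eq1 q : 0 <= q -> rot_char q = 1 -> q \is a Num.nat.
Proof.
move=> q0 q1; set n := Num.truncn q.
have [nq qn] : n%:R <= q /\ q < n.+1%:R.
  by split; [rewrite truncn_le | exact: truncnS_gt].
suff -> : q = n%:R by exact: natr_nat.
apply/eqP; rewrite eq_le nq andbT leNgt; apply/negP => nq'.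
set t := q - n%:R; have t0 : 0 < t by rewrite subr_gt0.
have t1 : t < 1 by rewrite /t ltrBlDr addrC natr1.
have : rot_char t = 1.
  by have := rot_charD t n%:R; rewrite subrK q1 rot_charn mulr1.
move=> /(congr1 (@complex.Re R)) /= ct.
have : 0 < sin (pi * ratr t : R).
  apply: sin_gt0_pi; rewrite mulr_gt0 ?pi_gt0 ?ltr0q //=.
  rewrite -[X in _ < X]mulr1 ltr_pM2l ?pi_gt0 //.
  by rewrite -[X in _ < X](rmorph1 (@ratr R)) ltr_rat.
have e : pi *+ 2 * ratr t = pi * ratr t + pi * ratr t :> R by rewrite mulr2n mulrDl.
move: ct; rewrite e cosD => ct.
have := cos2Dsin2 (pi * ratr t : R); rewrite !expr2.
nra.
Qed.

Fact galois_subproof f : exists2 n, (0 < n)%N &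
  forall q, rot_char q * pcoef f q != 0 -> exists k : nat, q = k%:R / n%:R.
Proof.
have [n n0 hn] := pcoefP f; exists n => // q.
by rewrite mulf_eq0 negb_or => /andP[_ /hn].
Qed.

(** The substitution of [exp (2 i pi / n) x^(1/n)] for [x^(1/n)], for all [n]
    at once. *)
Definition galois f : P := Puiseux (galois_subproof f).

Fact galois_additive : zmod_morphism galois.
Proof. by move=> f g; apply: puiseuxP => q /=; rewrite mulrBr. Qed.
Fact galois_multiplicative : monoid_morphism galois.
Proof.
split=> [|f g]; apply: puiseuxP => q /=.
  by rewrite /pc_const; case: eqP => [->|_]; rewrite ?mulr0 // rot_char0 mulr1.
rewrite /pc_mul mulr_fsumr; apply: eq_fsbigr => a _.
by rewrite mulrACA -rot_charD [a + _]addrC subrK.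
Qed.
HB.instance Definition _ := GRing.isZmodMorphism.Build P P galois galois_additive.
HB.instance Definition _ := GRing.isMonoidMorphism.Build P P
  galois galois_multiplicative.

Lemma galois_inj : injective galois.
Proof.
move=> f g fg; apply: puiseuxP => q.
by have /(mulfI (rot_char_neq0 q)) := congr1 (fun h : P => h q) fg.
Qed.

Lemma galois_fps (a : fps C) : galois (puiseux_of_fps a) = puiseux_of_fps a.
Proof.
apply: puiseuxP => q /=; rewrite /pc_fps; case: ifP => [/natrP[n ->]|_].
  by rewrite rot_charn mul1r.
by rewrite mulr0.
Qed.

(** The exponents that are fixed by the faithful character of [Q / Z] are the
    integers. *)
Lemma galois_fixed f : galois f = f -> exists a, f = puiseux_of_fps a.
Proof.
move=> ff; exists (Fps (fun n => pcoef f n%:R)); apply: puiseuxP => q.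
rewrite pcoef_fps /=; case: ifP => [/natrP[n ->]|/negbT qn]; first by rewrite natrK.
apply/eqP/negPn/negP => fq; move/negP: qn; apply.
apply: rot_char_eq1.
  by rewrite leNgt; apply/negP => /(pcoef_lt0 f) f0; rewrite f0 eqxx in fq.
apply: (mulIf fq); rewrite mul1r.
exact: (congr1 (fun h : P => h q) ff).
Qed.

Lemma iter_galoisE m f q : pcoef (iter m galois f) q = rot_char q ^+ m * pcoef f q.
Proof. by elim: m => [|m IH]; rewrite ?mul1r //= IH mulrA -exprS. Qed.

Lemma galois_order n f : pdenom n f -> iter n galois f = f.
Proof.
move=> [n0 hf]; apply: puiseuxP => q; rewrite iter_galoisE.
case: (eqVneq (pcoef f q) 0) => [->|/hf[k ->]]; first by rewrite mulr0.
by rewrite -rot_charX -(mulr_natr (k%:R / n%:R)) divfK ?rot_charn ?mul1r // pnatr_eq0 -lt0n.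
Qed.

Lemma ordx_galois f : ordx R (galois f) = ordx R f.
Proof.
congr ereal_inf; apply/seteqP; split=> _ [q /= fq <-]; exists q => //=; move: fq.
  by rewrite mulf_eq0 negb_or => /andP[].
by move=> fq; rewrite mulf_neq0 // rot_char_neq0.
Qed.

End Galois.

(** * Substitution of a Puiseux series of positive order *)

Section Subst.
Variable K : idomainType.
Local Notation P := (puiseux K).
Local Notation iota := (@puiseux_of_fps K).
Implicit Types (f g : fps (fps K)) (eta : P).

Definition fps_trunc (A : nzRingType) n (f : fps A) : {poly A} := \poly_(i < n) fcoef f i.

(** Terms of degree at least [n] have order at least [n c], so that a coefficient
    of the substituted series is that of a polynomial. *)
Lemma pc_substE f eta c q (n : nat) : vanish_below c eta -> q < c *+ n ->
  pcoef (puiseux_subst f eta) q = pcoef (map_poly iota (fps_trunc n f)).[eta] q.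
Proof.
move=> ce qn.
transitivity (\sum_(j \in [set: nat]) pcoef (iota (fcoef f j) * eta ^+ j) q) => //.
rewrite -(@fsbig_widen _ _ _ _ `I_n) //; last first.
  move=> j [_ /negP]; rewrite -leqNgt => nj.
  suff : pcoef (iota (fcoef f j) * eta ^+ j) q = 0 by [].
  case: (leP 0 q) => [q0|q0]; last exact: pcoef_lt0.
  have c0 : 0 < c.
    rewrite ltNge; apply/negP => c0; move: (le_lt_trans q0 qn).
    by rewrite ltNge mulrn_wle0.
  have h : vanish_below (0 + c *+ j) (iota (fcoef f j) * eta ^+ j).
    by apply: vanish_belowM; [exact: vanish_below0 | exact: vanish_belowX].
  by apply: h; rewrite add0r (lt_le_trans qn) // ler_pMn2l.
rewrite -fsbig_ord (horner_coef_wide (n := n)); last first.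
  exact: leq_trans (size_poly _ _) (size_poly _ _).
rewrite pcoef_sum; apply: eq_bigr => i _.
by rewrite coef_map coef_poly ltn_ord.
Qed.

Lemma horner_vanish (p : {poly P}) eta c n : vanish_below c eta -> 0 <= c ->
  (forall i, (i < n)%N -> p`_i = 0) -> vanish_below (c *+ n) p.[eta].
Proof.
move=> ce c0 p0; rewrite horner_coef; apply: vanish_below_sum => i.
have [ni|ini] := ltnP i n; first by rewrite p0 // mul0r => q _; rewrite pcoef0.
rewrite -[c *+ n]add0r; apply: vanish_belowM; first exact: vanish_below0.
refine (vanish_below_le _ (vanish_belowX (n := i) ce)).
exact: ler_wpMn2l.
Qed.

Lemma subst_approx f eta c n : vanish_below c eta ->
  vanish_below (c *+ n) (puiseux_subst f eta - (map_poly iota (fps_trunc n f)).[eta]).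
Proof. by move=> ce q qn; rewrite pcoefB (pc_substE f ce qn) subrr. Qed.

Lemma vanish_multiples (h : P) c :
  0 < c -> (forall n : nat, vanish_below (c *+ n) h) -> h = 0.
Proof.
move=> c0 hn; apply: vanish_all => n.
refine (vanish_below_le _ (hn (Num.truncn (n%:R / c)).+1)).
rewrite -[c *+ _]mulr_natr mulrC -ler_pdivrMr //; apply: ltW; exact: truncnS_gt.
Qed.

Section Morphism.
Variable eta : P.
Hypothesis eta0 : pcoef eta 0 = 0.

(* A series is determined by its approximations by polynomials of degree [n]
   modulo the order [n c]; the morphism properties follow from it. *)
Let unique f (g : P) :
  (forall c n, 0 < c -> vanish_below c eta ->
    vanish_below (c *+ n) (g - (map_poly iota (fps_trunc n f)).[eta])) ->
  puiseux_subst f eta = g.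
Proof.
move=> h; have [c c0 ce] := puiseux_pos_vanish eta0.
apply/eqP; rewrite -subr_eq0; apply/eqP; apply: (vanish_multiples c0) => n.
set t := (map_poly iota (fps_trunc n f)).[eta].
have -> : puiseux_subst f eta - g = (puiseux_subst f eta - t) - (g - t) by ring.
apply: vanish_belowD; first exact: subst_approx.
by apply: vanish_belowN; apply: h.
Qed.

Lemma substD f g : puiseux_subst (f + g) eta = puiseux_subst f eta + puiseux_subst g eta.
Proof.
apply: unique => c n c0 ce.
have -> : fps_trunc n (f + g) = fps_trunc n f + fps_trunc n g.
  by apply/polyP => i; rewrite coefD !coef_poly; case: ifP; rewrite ?addr0.
rewrite rmorphD hornerD opprD addrACA.
by apply: vanish_belowD; apply: subst_approx.
Qed.

Lemma substM f g : puiseux_subst (f * g) eta = puiseux_subst f eta * puiseux_subst g eta.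
Proof.
apply: unique => c n c0 ce.
set F := puiseux_subst f eta; set G := puiseux_subst g eta.
set f' := fps_trunc n f; set g' := fps_trunc n g.
have -> : F * G - (map_poly iota (fps_trunc n (f * g))).[eta] =
  ((F - (map_poly iota f').[eta]) * G +
   (map_poly iota f').[eta] * (G - (map_poly iota g').[eta])) +
  (map_poly iota (f' * g' - fps_trunc n (f * g))).[eta].
  by rewrite rmorphB rmorphM hornerD hornerN hornerM; ring.
apply: vanish_belowD; first apply: vanish_belowD.
- rewrite -[c *+ n]addr0; apply: vanish_belowM (vanish_below0 _).
  exact: subst_approx.
- rewrite -[c *+ n]add0r; apply: vanish_belowM (vanish_below0 _) _.
  exact: subst_approx.
- apply: horner_vanish => // [|i ni]; first exact: ltW.
  rewrite coef_map coefB coefM coef_poly ni.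
  apply: (can_inj opprK); rewrite -rmorphN opprB oppr0.
  rewrite [X in _ - X](_ : _ = fcoef (f * g) i) ?subrr ?rmorph0 //=.
  apply: eq_bigr => j _; rewrite !coef_poly.
  have ji : (j <= i)%N by rewrite -ltnS.
  by rewrite (leq_ltn_trans ji ni) (leq_ltn_trans (leq_subr _ _) ni).
Qed.

Lemma subst_poly (p : {poly fps K}) :
  puiseux_subst (fps_of_poly p) eta = (map_poly iota p).[eta].
Proof.
apply: unique => c n c0 ce; rewrite -hornerN -hornerD -rmorphB.
apply: horner_vanish => // [|i ni]; first exact: ltW.
by rewrite coef_map coefB coef_poly ni subrr; exact: raddf0.
Qed.

End Morphism.
End Subst.

Section FpsOfPoly.
Variable K : comNzRingType.

Fact fps_of_poly_additive : zmod_morphism (@fps_of_poly K).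
Proof. by move=> p q; apply: fpsP => n /=; rewrite coefB. Qed.
Fact fps_of_poly_multiplicative : monoid_morphism (@fps_of_poly K).
Proof.
split=> [|p q]; apply: fpsP => n /=; last by rewrite coefM.
by rewrite coef1; case: n.
Qed.
HB.instance Definition _ := GRing.isZmodMorphism.Build {poly K} (fps K)
  (@fps_of_poly K) fps_of_poly_additive.
HB.instance Definition _ := GRing.isMonoidMorphism.Build {poly K} (fps K)
  (@fps_of_poly K) fps_of_poly_multiplicative.

Lemma fps_of_poly_inj : injective (@fps_of_poly K).
Proof. by move=> p q pq; apply/polyP => i; apply: (congr1 (fun f => fcoef f i) pq). Qed.

End FpsOfPoly.

(** * Weierstrass preparation *)

Section FpsBasics.
Variable A : comNzRingType.
Implicit Types f g h : fps A.

Lemma fcoefD f g n : fcoef (f + g) n = fcoef f n + fcoef g n. Proof. by []. Qed.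
Lemma fcoefM f g n : fcoef (f * g) n = \sum_(i < n.+1) fcoef f i * fcoef g (n - i).
Proof. by []. Qed.
Lemma fcoef0 n : fcoef (0 : fps A) n = 0. Proof. by case: n. Qed.
Lemma fcoef_sum (I : Type) (s : seq I) (P : pred I) (F : I -> fps A) n :
  fcoef (\sum_(i <- s | P i) F i) n = \sum_(i <- s | P i) fcoef (F i) n.
Proof. by elim/big_rec2: _ => [|i x y _ <-]; rewrite ?fcoef0. Qed.

Lemma fcoef0M f g : fcoef (f * g) 0 = fcoef f 0 * fcoef g 0.
Proof. by rewrite fcoefM big_ord_recl big_ord0 addr0. Qed.

Fact fcoef_at0_additive : zmod_morphism (fun f => fcoef f 0).
Proof. by []. Qed.
Fact fcoef_at0_multiplicative : monoid_morphism (fun f => fcoef f 0).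
Proof. by split=> // f g; apply: fcoef0M. Qed.
Definition fps_at0 f := fcoef f 0.
HB.instance Definition _ := GRing.isZmodMorphism.Build (fps A) A
  fps_at0 fcoef_at0_additive.
HB.instance Definition _ := GRing.isMonoidMorphism.Build (fps A) A
  fps_at0 fcoef_at0_multiplicative.

Fact fpsC_additive : zmod_morphism (@fpsC A).
Proof. by move=> a b; apply: fpsP => -[|n] /=; rewrite ?subr0. Qed.
Fact fpsC_multiplicative : monoid_morphism (@fpsC A).
Proof.
split=> // a b; apply: fpsP => n; rewrite fcoefM big_ord_recl big1 => [|i _].
  by rewrite addr0 /= subn0; case: n => [|n]; rewrite ?mulr0.
by rewrite /= mul0r.
Qed.
HB.instance Definition _ := GRing.isZmodMorphism.Build A (fps A)
  (@fpsC A) fpsC_additive.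
HB.instance Definition _ := GRing.isMonoidMorphism.Build A (fps A)
  (@fpsC A) fpsC_multiplicative.

Lemma fcoefXnM m f i : fcoef (fpsX ^+ m * f) i = if (i < m)%N then 0 else fcoef f (i - m).
Proof.
elim: m f i => [|m IH] f i; first by rewrite mul1r subn0.
rewrite exprS -mulrA fcoefM; case: i => [|i].
  by rewrite big_ord_recl big_ord0 /= mul0r addr0.
rewrite big_ord_recl mul0r add0r big_ord_recl mul1r subn1 IH ltnS subSS.
by rewrite big1 ?addr0 // => j _; rewrite mul0r.
Qed.

Lemma fps_X_factor f : f != 0 -> exists n g, f = fpsX ^+ n * g /\ fcoef g 0 != 0.
Proof.
move=> f0; have ex : exists n, fcoef f n != 0.
  apply: contrapT => nf; case/eqP: f0; apply: fpsP => n; rewrite fcoef0.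
  by apply/eqP/negPn/negP => fn; apply: nf; exists n.
case: (ex_minnP ex) => n fn nmin; exists n, (Fps (fun i => fcoef f (i + n))).
split=> //; apply: fpsP => i; rewrite fcoefXnM /=; case: ltnP => [ni|?]; last by rewrite subnK.
by apply/eqP/negPn/negP => /nmin; rewrite leqNgt ni.
Qed.

(** Course-of-values recursion: [Phi n] consults a sequence at indices less than
    [n] only, and is fed the list of the values already computed. *)
Lemma strong_rec (T : Type) (t0 : T) (Phi : nat -> (nat -> T) -> T) :
  (forall n s s', (forall i, (i < n)%N -> s i = s' i) -> Phi n s = Phi n s') ->
  exists s, forall n, s n = Phi n s.
Proof.
move=> hPhi; pose fix L n := if n is n'.+1 then rcons (L n') (Phi n' (nth t0 (L n'))) else [::].
have sL n : size (L n) = n by elim: n => //= n IH; rewrite size_rcons IH.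
have nL n k i : (i < n)%N -> nth t0 (L (n + k)%N) i = nth t0 (L n) i.
  move=> ni; elim: k => [|k IH]; first by rewrite addn0.
  by rewrite addnS /= nth_rcons sL ltn_addr.
exists (fun n => nth t0 (L n.+1) n) => n /=.
rewrite nth_rcons sL ltnn eqxx; apply: hPhi => i ni.
by rewrite -(nL i.+1 (n - i.+1)%N) // subnKC.
Qed.

Lemma invertibleM f g : invertible f -> invertible g -> invertible (f * g).
Proof.
by move=> [f' ff'] [g' gg']; exists (f' * g'); rewrite mulrACA ff' gg' mulr1.
Qed.

(** The coefficients of the inverse are determined one after the other. *)
Lemma fps_invertible f : invertible (fcoef f 0) <-> invertible f.
Proof.
split=> [[b fb]|[g /(congr1 (fun h => fcoef h 0))]]; last first.
  by rewrite fcoef0M => fg; exists (fcoef g 0).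
have [|s sE] := @strong_rec A 0 (fun n s => if n is n'.+1
    then - b * \sum_(i < n) fcoef f (n - i) * s i else b).
  case=> // n s s' ss'; congr (_ * _); apply: eq_bigr => i _.
  by rewrite ss'.
exists (Fps s); apply: fpsP => n; rewrite mulrC fcoefM /=.
case: n => [|n]; first by rewrite big_ord_recl big_ord0 addr0 /= sE mulrC.
rewrite big_ord_recr /= subnn sE mulrAC mulNr [b * _]mulrC fb mulN1r.
by apply/eqP; rewrite subr_eq0; apply/eqP/eq_bigr => i _; rewrite mulrC.
Qed.

End FpsBasics.

Fact fps_integral (K : idomainType) (f g : fps K) : f * g = 0 -> (f == 0) || (g == 0).
Proof.
move=> fg0; apply/negPn/negP; rewrite negb_or => /andP[].
move=> /fps_X_factor[n [f' [fE f'0]]] /fps_X_factor[m [g' [gE g'0]]].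
have /eqP : fcoef (fpsX ^+ (n + m) * (f' * g')) (n + m) = 0.
  by rewrite exprD mulrACA -fE -gE fg0 fcoef0.
by rewrite fcoefXnM ltnn subnn fcoef0M mulf_eq0 (negbTE f'0) (negbTE g'0).
Qed.
HB.instance Definition _ (K : idomainType) := GRing.ComNzRing_hasMulInverse.Build (fps K)
  (@inv_fun_mulVr (fps K)) (@inv_fun_unitP (fps K)) (@inv_fun_out (fps K)).
HB.instance Definition _ (K : idomainType) := GRing.ComUnitRing_isIntegral.Build (fps K)
  (@fps_integral K).

Lemma field_invertible (K : fieldType) (c : K) : invertible c <-> c != 0.
Proof.
split=> [[d cd]|c0]; last by exists c^-1; rewrite divff.
by apply/eqP => c0; move/eqP: cd; rewrite c0 mul0r eq_sym oner_eq0.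
Qed.

Lemma fps2_invertible (K : fieldType) (f : fps (fps K)) :
  invertible f <-> fcoef (fcoef f 0) 0 != 0.
Proof. by rewrite -fps_invertible -fps_invertible field_invertible. Qed.

Section Transpose.
Variable A : comNzRingType.
Implicit Types f g : fps (fps A).

(** The exchange of the two variables. *)
Definition fps_tr f : fps (fps A) := Fps (fun k => Fps (fun j => fcoef (fcoef f j) k)).

Lemma fps_trK : involutive fps_tr.
Proof. by move=> f; apply: fpsP => j; apply: fpsP. Qed.

Lemma fps_trM f g : fps_tr (f * g) = fps_tr f * fps_tr g.
Proof.
apply: fpsP => k; apply: fpsP => j /=; rewrite !fcoef_sum /= exchange_big /=.
done.
Qed.

Lemma fps_tr1 : fps_tr 1 = 1.
Proof. by apply: fpsP => k; apply: fpsP => j /=; case: j k => [|j] [|k]. Qed.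

Lemma fps_trX n : fps_tr (fpsX ^+ n) = fpsC fpsX ^+ n.
Proof.
elim: n => [|n IH]; first exact: fps_tr1.
rewrite !exprS fps_trM IH; congr (_ * _); apply: fpsP => k; apply: fpsP => j /=.
by case: k j => [|[|k]] [|[|j]].
Qed.

End Transpose.

Lemma fps2_X_factor (A : comNzRingType) (f : fps (fps A)) : f != 0 ->
  exists n g j, f = fpsC fpsX ^+ n * g /\ fcoef (fcoef g j) 0 != 0.
Proof.
move=> f0; have : fps_tr f != 0.
  apply: contra_neq f0 => f0; rewrite -[f]fps_trK f0.
  by apply: fpsP => -[|k]; apply: fpsP => -[|j].
move=> /fps_X_factor[n [g [fg g0]]]; exists n, (fps_tr g).
have [j gj] : exists j, fcoef (fcoef g 0) j != 0.
  apply: contrapT => ng; case/eqP: g0; apply: fpsP => j; rewrite fcoef0.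
  by apply/eqP/negPn/negP => gj; apply: ng; exists j.
by exists j; split=> //; rewrite -fps_trX -fps_trM -fg fps_trK.
Qed.

(** The condition is on the coefficients modulo [x]: the reduction of [p] is a
    power of the variable. *)
Definition weierstrass (A : comNzRingType) (p : {poly fps A}) :=
  p \is monic /\ forall j, (j < (size p).-1)%N -> fcoef p`_j 0 = 0.

(** Written as series in [x], the equation [f = u p] reads, modulo lower terms,
    [f_k = u_k y^m + u_0 p_k], where [u_0] is invertible and [deg p_k < m]: this
    is a Euclidean division by [y^m], and determines [u_k] and [p_k] from the
    terms of lower index. *)
Lemma weierstrass_preparation (K : fieldType) (f : fps (fps K)) m :
  (forall j, (j < m)%N -> fcoef (fcoef f j) 0 = 0) -> fcoef (fcoef f m) 0 != 0 ->
  exists u p, [/\ invertible u, weierstrass p, size p = m.+1 & f = u * fps_of_poly p].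
Proof.
move=> fj fm; pose F := fps_tr f; pose v : fps K := Fps (fun i => fcoef (fcoef F 0) (i + m)).
have F0 : fcoef F 0 = fpsX ^+ m * v.
  apply: fpsP => i; rewrite fcoefXnM; case: ltnP => [/fj//|mi].
  by rewrite /= subnK.
have [w vw] : invertible v by apply/fps_invertible/field_invertible.
(* Remainder and quotient of the division by [y^m]. *)
pose lo (h : fps K) : fps K := Fps (fun i => if (i < m)%N then fcoef h i else 0).
pose hi (h : fps K) : fps K := Fps (fun i => fcoef h (i + m)).
have lohi h : h = lo h + fpsX ^+ m * hi h.
  apply: fpsP => i; rewrite fcoefD fcoefXnM /=; case: ltnP => [_|mi].
    by rewrite addr0.
  by rewrite add0r subnK.
(* What remains of [f_k] when the products of already known terms are removed. *)
pose E k (s : nat -> fps K * fps K) :=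
  fcoef F k - \sum_(i < k.-1) (s i.+1).1 * (s (k - i.+1)%N).2.
have [|s sE] := @strong_rec _ (0, 0) (fun k s => if k is 0%N then (v, fpsX ^+ m)
    else (v * hi (w * E k s), lo (w * E k s))).
  move=> [//|k] s s' ss'; suff -> : E k.+1 s = E k.+1 s' by [].
  congr (_ - _); apply: eq_bigr => i _; rewrite ss' ?ltnS // ss' //.
  by rewrite subSS ltnS leq_subr.
pose U : fps (fps K) := Fps (fun k => (s k).1).
pose Q : fps (fps K) := Fps (fun k => (s k).2).
have FUQ : F = U * Q.
  apply: fpsP => -[|k]; first by rewrite fcoef0M F0 /= sE mulrC.
  rewrite fcoefM big_ord_recl big_ord_recr /= subnn subn0 !sE /=.
  set e := w * _; rewrite addrCA.
  have -> : v * lo e + v * hi e * fpsX ^+ m = E k.+1 s.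
    by rewrite -mulrA -mulrDr [hi e * _]mulrC -lohi /e mulrA vw mul1r.
  rewrite /E /= addrC subrK //.
pose p := fps_trunc m.+1 (fps_tr Q).
have pE : fps_of_poly p = fps_tr Q.
  apply: fpsP => j /=; rewrite coef_poly; case: ltnP => // mj.
  apply: fpsP => k; rewrite fcoef0 /= sE; case: k => [|k] /=; last first.
    by rewrite ltnNge (leq_trans (leqnSn _) mj).
  by rewrite -[fpsX ^+ m]mulr1 fcoefXnM (ltnNge j) (ltnW mj) /= -subnSK.
have Qm : fcoef (fps_tr Q) m = 1.
  apply: fpsP => k; rewrite [LHS]/= sE.
  case: k => [|k] /=; last by rewrite ltnn.
  by rewrite -[fpsX ^+ m]mulr1 fcoefXnM ltnn subnn.
have pm : p`_m = 1 by rewrite coef_poly ltnSn.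
have sp : size p = m.+1 by apply: size_poly_eq; rewrite Qm oner_eq0.
exists (fps_tr U), p; split=> //.
- by apply/fps2_invertible; rewrite /= sE.
- split; first by rewrite monicE /lead_coef sp /= pm.
  rewrite sp /= => j jm; rewrite coef_poly ltnS ltnW //= sE /=.
  by rewrite -[fpsX ^+ m]mulr1 fcoefXnM jm.
- by rewrite pE -fps_trM -FUQ fps_trK.
Qed.

(** * The Newton-Puiseux theorem *)

Section PuiseuxPoly.
Variable K : idomainType.
Local Notation P := (puiseux K).
Local Notation iota := (@puiseux_of_fps K).

Fact pcoef_at0_additive : zmod_morphism (fun f : P => pcoef f 0).
Proof. by []. Qed.
Fact pcoef_at0_multiplicative : monoid_morphism (fun f : P => pcoef f 0).
Proof.
split=> [|f g]; first by rewrite pcoef1.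
by rewrite -[0 in LHS]addr0; apply: pcoefM_min; apply: vanish_below0.
Qed.
Definition puiseux_at0 (f : P) := pcoef f 0.
HB.instance Definition _ := GRing.isZmodMorphism.Build P K
  puiseux_at0 pcoef_at0_additive.
HB.instance Definition _ := GRing.isMonoidMorphism.Build P K
  puiseux_at0 pcoef_at0_multiplicative.

(** Modulo [x], a Weierstrass polynomial is a power of the variable. *)
Lemma weierstrass_root (p : {poly fps K}) eta :
  weierstrass p -> root (map_poly iota p) eta -> pcoef eta 0 = 0.
Proof.
move=> [pm pj] /rootP/(congr1 puiseux_at0); rewrite rmorph0 -horner_map.
have -> : map_poly puiseux_at0 (map_poly iota p) = 'X^((size p).-1).
  apply/polyP => i; rewrite !coef_map coefXn.
  rewrite [LHS](pcoef_fpsn p`_i 0).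
  have p0 : (0 < size p)%N by rewrite size_poly_gt0 monic_neq0.
  have [ip|pi|->] := ltngtP i (size p).-1.
  - exact: pj.
  - by rewrite nth_default // -(prednK p0).
  - by move: pm; rewrite monicE /lead_coef => /eqP ->.
by rewrite hornerXn => /eqP; rewrite expf_eq0 => /andP[_ /eqP].
Qed.

(** Finitely many coefficients have a common denominator. *)
Lemma pdenom_poly (p : {poly P}) : exists n, forall i, pdenom n p`_i.
Proof.
suff [n nP] : exists n, forall i, (i < size p)%N -> pdenom n p`_i.
  have n0 : (0 < n)%N \/ p = 0.
    have [/size_poly_leq0P ->|p0] := leqP (size p) 0; first by right.
    by left; case: (nP _ p0).
  case: n0 => [n0|->]; last first.
    by exists 1%N => i; rewrite coef0; split=> // q; rewrite pcoef0 eqxx.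
  exists n => i; have [/nP//|pi] := ltnP i (size p).
  by rewrite nth_default //; split=> // q; rewrite pcoef0 eqxx.
elim: (size p) => [|k [n nP]]; first by exists 1%N.
have [m [mk _]] := pdenom_common2 p`_k p`_k; have [m0 _] := mk.
have [n0|n0] := posnP n.
  exists m => i; rewrite ltnS leq_eqVlt => /orP[/eqP -> //|/nP[]].
  by rewrite n0.
exists (n * m)%N => i; rewrite ltnS leq_eqVlt => /orP[/eqP ->|/nP ni].
  by rewrite mulnC; apply: pdenomM.
exact: pdenomM.
Qed.

End PuiseuxPoly.

Section Tschirnhaus.
Variable A : idomainType.
Implicit Types (p : {poly A}) (c : A).

Lemma lead_exp_XsubC n c : (('X - c%:P) ^+ n)`_n = 1.
Proof.
have := monic_exp n (monicXsubC c); rewrite monicE /lead_coef.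
by rewrite size_exp_XsubC => /eqP.
Qed.

Lemma coef_exp_XsubC n c : (('X - c%:P) ^+ n.+1)`_n = - c *+ n.+1.
Proof.
elim: n => [|n IH]; first by rewrite expr1 coefB coefX coefC sub0r.
rewrite exprSr mulrBr coefB coefMX coefMC /= IH lead_exp_XsubC mul1r.
by rewrite [RHS]mulrSr.
Qed.

Lemma coef_comp_XsubC p n c : size p = n.+2 ->
  (p \Po ('X - c%:P))`_n = p`_n - p`_n.+1 * (c *+ n.+1).
Proof.
move=> sp; rewrite coef_comp_poly sp big_ord_recr big_ord_recr /=.
rewrite big1 ?add0r => [|i _]; last first.
  by rewrite [X in _ * X]nth_default ?mulr0 // size_exp_XsubC; apply: ltn_ord.
by rewrite coef_exp_XsubC lead_exp_XsubC mulr1 mulNrn mulrN.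
Qed.

Lemma size_comp_XsubC p c : size (p \Po ('X - c%:P)) = size p.
Proof. by rewrite size_comp_poly2 // size_XsubC. Qed.

Lemma comp_XsubC_monic p c : p \is monic -> p \Po ('X - c%:P) \is monic.
Proof.
move=> pm; rewrite monicE lead_coef_comp ?size_XsubC // lead_coefXsubC expr1n.
by rewrite mulr1 -monicE.
Qed.

End Tschirnhaus.

Section NewtonPuiseux.
Variable K : numClosedFieldType.
Local Notation P := (puiseux K).
Local Notation iota := (@puiseux_of_fps K).

(** If [c] were the only root, the sum of the roots, which is zero by the
    assumption on [p`_d], would be a non-zero multiple of [c]. *)
Lemma split_residue (p : {poly K}) d : p \is monic -> size p = d.+2 -> p`_d = 0 ->
  (exists2 i, (i <= d)%N & p`_i != 0) ->
  exists c m s, [/\ (0 < m <= d)%N, p = ('X - c%:P) ^+ m * s & ~~ root s c].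
Proof.
move=> pm sp pd [i id pi].
have [rs pE] := closed_field_poly_normal p.
move: pE; rewrite (monicP pm) scale1r => pE.
have srs : size rs = d.+1 by move: sp; rewrite pE size_prod_XsubC => -[].
have sum0 : \sum_(z <- rs) z = 0.
  have := @coefPn_prod_XsubC _ rs; rewrite srs -pE /= pd => /(_ isT)/esym/eqP.
  by rewrite oppr_eq0 => /eqP.
set c := head 0 rs.
have crs : c \in rs by rewrite /c; case: (rs) srs => // a l _; rewrite mem_head.
exists c; exists (count_mem c rs); exists (\prod_(z <- [seq z <- rs | z != c]) ('X - z%:P)).
split.
- rewrite -has_count has_pred1 crs /= -ltnS -srs ltn_neqAle count_size andbT.
  rewrite -all_count; apply/negP => /all_pred1P rsE.
  have c0 : c = 0.
    move: sum0; rewrite rsE srs big_nseq iter_addr_0 => /eqP.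
    by rewrite mulrn_eq0 => /= /eqP.
  move: pi; rewrite pE rsE srs c0 big_nseq polyC0 subr0 iter_mulr_1 coefXn.
  by rewrite ltn_eqF ?eqxx.
- rewrite [in LHS]pE (bigID (pred1 c)) /= big_filter; congr (_ * _).
  rewrite (eq_bigr (fun=> 'X - c%:P)); last by move=> z /eqP ->.
  by rewrite big_const_seq iter_mulr_1.
- by rewrite root_prod_XsubC mem_filter eqxx.
Qed.


(** The slope [r] of the Newton polygon, in the form in which it is used: the
    dilation [y = x^r z] makes the coefficients divisible by a common power of
    [x], and one of the quotients, other than the leading one, a unit. *)
Lemma newton_slope (p : {poly P}) d : p \is monic -> size p = d.+1 ->
  p != 'X^d ->
  exists r, [/\ 0 <= r, forall i, (i < d)%N -> vanish_below (r *+ (d - i)) p`_i &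
    exists2 i, (i < d)%N & pcoef p`_i (r *+ (d - i)) != 0].
Proof.
move=> pm sp pX.
have [i0 pi0] : exists i : 'I_d, p`_i != 0.
  apply: contrapT => np; case/eqP: pX; apply/polyP => i; rewrite coefXn.
  have [id|di|->] := ltngtP i d.
  - by apply/eqP/negPn/negP => pi; apply: np; exists (Ordinal id).
  - by rewrite nth_default // sp.
  - by move: pm; rewrite monicE /lead_coef sp => /eqP.
have vex (i : 'I_d) : exists v : rat,
    p`_i != 0 -> pcoef p`_i v != 0 /\ vanish_below v p`_i.
  case: (eqVneq p`_i 0) => [_|pi]; first by exists 0.
  by have [q pq /pval_vanish qm] := pval_ex pi; exists q.
have [v vP] := choice vex.
pose w (i : 'I_d) := v i / (d - i)%:R.
have dpos (i : 'I_d) : 0 < (d - i)%:R :> rat by rewrite ltr0n subn_gt0.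
case: (@arg_minP _ _ _ i0 (fun i : 'I_d => p`_i != 0) w pi0) => i pi imin; exists (w i).
have [pvi _] := vP i pi.
have wi j : w j *+ (d - j) = v j by rewrite -mulr_natr divfK // gt_eqF.
split.
- rewrite divr_ge0 // leNgt; apply/negP => /(pcoef_lt0 p`_i) v0.
  by rewrite v0 eqxx in pvi.
- move=> j jd; case: (eqVneq p`_j 0) => [->|pj]; first by move=> q _; exact: pcoef0.
  have [_ vj] := vP (Ordinal jd) pj; refine (vanish_below_le _ vj).
  by rewrite -(wi (Ordinal jd)) lerMn2r imin ?orbT.
- by exists i; rewrite ?ltn_ord // wi.
Qed.

(** Induction on the degree. After a translation, the roots have sum zero; a
    dilation then makes the reduction modulo [x] different from a power of the
    variable, so that it has a root of multiplicity less than the degree.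
    Weierstrass preparation at this root leads to a polynomial whose degree is
    this multiplicity. *)
Theorem newton_puiseux (p : {poly P}) : p \is monic -> (1 < size p)%N ->
  exists eta, root p eta.
Proof.
have [n] := ubnP (size p); elim: n p => // n IH p; rewrite ltnS => pn pm.
case sp: (size p) => [|[|d]] // _.
(* The translation by [c0], the mean of the roots up to sign. *)
pose c0 : P := iota (fpsC (d.+1%:R^-1)) * p`_d.
have c0E : c0 *+ d.+1 = p`_d.
  rewrite /c0 -mulrnAl -!rmorphMn -[_ *+ d.+1]mulr_natr mulVf ?pnatr_eq0 //.
  by rewrite !rmorph1 mul1r.
pose p1 := p \Po ('X - c0%:P).
have p1m : p1 \is monic by exact: comp_XsubC_monic.
have sp1 : size p1 = d.+2 by rewrite size_comp_XsubC.
have p1d : p1`_d = 0.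
  rewrite coef_comp_XsubC // c0E.
  by move: pm; rewrite monicE /lead_coef sp => /eqP /= ->; rewrite mul1r subrr.
suff [eta r1] : exists eta, root p1 eta.
  exists (eta - c0); apply/rootP.
  by move/rootP: r1; rewrite horner_comp hornerXsubC.
have [p1X|p1X] := eqVneq p1 'X^(d.+1).
  by exists 0; rewrite p1X rootE hornerXn expr0n.
have [r [r0 rv [i0 i0d ri0]]] := newton_slope p1m sp1 p1X.
have bex (i : nat) : exists bi, (i < d.+1)%N ->
    p1`_i = puiseux_X K (r *+ (d.+1 - i)) * bi /\
    forall q, pcoef bi q = pcoef p1`_i (q + r *+ (d.+1 - i)).
  case: (ltnP i d.+1) => [id|]; last by exists 0.
  by have [g gE gq] := vanish_belowE (mulrn_wge0 _ r0) (rv i id); exists g.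
have [b bP] := choice bex.
(* [q] is [p1] after the dilation of ratio [x^r], divided by [x^(r (d + 1))]. *)
pose q := 'X^(d.+1) + \poly_(i < d.+1) b i.
have sq' : (size (\poly_(i < d.+1) b i)%R < size ('X^(d.+1) : {poly P})%R)%N.
  by rewrite size_polyXn ltnS size_poly.
have qm : q \is monic by rewrite monicE lead_coefDl // lead_coefXn.
have sq : size q = d.+2 by rewrite size_polyDl // size_polyXn.
have qi i : (i < d.+1)%N -> q`_i = b i.
  by move=> id; rewrite coefD coefXn coef_poly id ltn_eqF // add0r.
have qE z : p1.[puiseux_X K r * z] = puiseux_X K (r *+ d.+1) * q.[z].
  rewrite !horner_coef sp1 sq mulr_sumr; apply: eq_bigr => i _.
  rewrite exprMn puiseux_Xn // mulrA [RHS]mulrA; congr (_ * _).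
  have [id|di] := ltnP i d.+1.
    rewrite qi // (bP i id).1 mulrAC -puiseux_XD ?mulrn_wge0 //.
    by rewrite -mulrnDr subnK // ltnW.
  have -> : (i : nat) = d.+1.
    by apply/eqP; rewrite eqn_leq di andbT -ltnS ltn_ord.
  move: p1m qm; rewrite !monicE /lead_coef sp1 sq => /eqP /= -> /eqP ->.
  by rewrite mul1r mulr1.
suff [eta qeta] : exists eta, root q eta.
  by exists (puiseux_X K r * eta); rewrite rootE qE (rootP qeta) mulr0.
(* The substitution of [x^N] for [x] makes the exponents integral. *)
have [N Nq] := pdenom_poly q.
have N0 : 0 < N%:R :> rat by rewrite ltr0n; case: (Nq 0%N).
pose q' := \poly_(i < d.+2) pser N q`_i.
have q'E : map_poly (pscale N0) q = map_poly iota q'.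
  apply/polyP => i; rewrite !coef_map coef_poly [LHS](pscale_fps N0 (Nq i)).
  case: ltnP => // di; rewrite nth_default ?sq //; congr (iota _).
  by apply: fpsP => k; rewrite fcoef0; exact: pcoef0.
(* The reduction of [q] modulo [x]. *)
pose q0 := map_poly (@fps_at0 K) q'.
have q0i i : q0`_i = pcoef q`_i 0.
  rewrite coef_map coef_poly /= /fps_at0; case: ltnP => [_|di] /=; first by rewrite mul0r.
  by rewrite nth_default ?sq // pcoef0.
have q0t : q0`_d.+1 = 1.
  by rewrite q0i; move: qm; rewrite monicE /lead_coef sq => /eqP /= ->; rewrite pcoef1.
have sq0 : size q0 = d.+2.
  apply/eqP; rewrite eqn_leq (leq_trans (size_poly _ _) (size_poly _ _)) /=.
  rewrite ltnNge; apply/negP => /leq_sizeP/(_ d.+1 (leqnn _))/eqP.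
  by rewrite q0t oner_eq0.
have q0m : q0 \is monic by rewrite monicE /lead_coef sq0 q0t.
have [||c [m [s [/andP[m0 md] q0E sc]]]] := @split_residue q0 d q0m sq0.
- by rewrite q0i qi // (bP d _).2 // add0r p1d pcoef0.
- exists i0 => //; rewrite q0i qi // (bP i0 _).2 // add0r; exact: ri0.
pose t := q' \Po ('X + (fpsC c)%:P).
have t0 : map_poly (@fps_at0 K) t = 'X^m * (s \Po ('X + c%:P)).
  rewrite map_comp_poly rmorphD /= map_polyX map_polyC /= -/q0 q0E.
  rewrite comp_polyM; congr (_ * _).
  by rewrite rmorphXn rmorphB /= comp_polyX comp_polyC addrK.
have ti i : fcoef (fcoef (fps_of_poly t) i) 0 = ('X^m * (s \Po ('X + c%:P)))`_i.
  by rewrite -t0 coef_map.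
have [||u [w [_ wW sw tE]]] := @weierstrass_preparation K (fps_of_poly t) m.
- by move=> j jm; rewrite ti coefXnM jm.
- rewrite ti coefXnM ltnn subnn; move: sc; rewrite rootE -horner_coef0 horner_comp.
  by rewrite hornerD hornerX hornerC add0r.
have smw : size (map_poly iota w) = m.+1.
  by rewrite size_map_poly_id0 // (monicP wW.1) rmorph1 oner_eq0.
have [|||eta weta] := IH (map_poly iota w).
- by rewrite smw (leq_trans _ pn) // sp !ltnS.
- by rewrite monic_map //; case: wW.
- by rewrite smw ltnS.
have eta0 := weierstrass_root wW weta.
have : puiseux_subst (fps_of_poly t) eta = 0.
  by rewrite tE substM // [X in _ * X]subst_poly // (rootP weta) mulr0.
rewrite subst_poly // map_comp_poly rmorphD /= map_polyX map_polyC /= -q'E.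
rewrite horner_comp hornerD hornerX hornerC => qr.
have N1 : 0 < N%:R^-1 :> rat by rewrite invr_gt0.
exists (pscale N1 (eta + iota (fpsC c))); apply/rootP; apply: (pscale_inj (r0 := N0)).
by rewrite rmorph0 -horner_map /= pscaleK.
Qed.

Lemma puiseux_split (p : {poly P}) : p \is monic ->
  exists s, p = \prod_(eta <- s) ('X - eta%:P).
Proof.
have [n] := ubnP (size p); elim: n p => // n IH p; rewrite ltnS => pn pm.
have [p1|p1] := leqP (size p) 1.
  have p0 : size p = 1%N by apply/eqP; rewrite eqn_leq p1 size_poly_gt0 monic_neq0.
  exists [::]; rewrite big_nil [LHS]size1_polyC //.
  by move: pm; rewrite monicE /lead_coef p0 => /eqP ->.
have [eta /factor_theorem[q pE]] := newton_puiseux pm p1.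
have qm : q \is monic by move: pm; rewrite pE monicMr // monicXsubC.
have [|s qE] := IH q _ qm.
  by move: pn; rewrite pE size_Mmonic ?monicXsubC ?monic_neq0 // size_XsubC addn2.
by exists (eta :: s); rewrite big_cons pE qE mulrC.
Qed.

End NewtonPuiseux.

(** * Minimal polynomials and branches *)

(** Induction on the roots: a root of the product other than [z] is a root of
    the cofactor of [X - z], as [A] is a domain. *)
Lemma uniq_roots_factor (A : idomainType) (p : {poly A}) (s : seq A) : uniq s ->
  (forall z, z \in s -> root p z) -> exists q, p = \prod_(z <- s) ('X - z%:P) * q.
Proof.
elim: s p => [|z s IH] p /=; first by exists p; rewrite big_nil mul1r.
move=> /andP[zs us] ps; have /factor_theorem[q pE] := ps z (mem_head _ _).
have [|q' qE] := IH q us; last by exists q'; rewrite big_cons pE qE mulrC mulrA.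
move=> y ys; have := ps y; rewrite pE rootM root_XsubC inE ys orbT => /(_ isT).
by case/orP => // /eqP yz; move: zs; rewrite -yz ys.
Qed.

Section MinimalPolynomial.
Variable R : realType.
Local Notation C := R[i].
Local Notation P := (puiseux C).
Local Notation iota := (@puiseux_of_fps C).
Implicit Types (eta zeta : P) (p q : {poly fps C}).

Definition galois_orbit_spec eta (s : seq P) :=
  [/\ uniq s, eta \in s, forall zeta, zeta \in s -> galois zeta \in s &
      forall zeta, zeta \in s -> exists m, zeta = iter m (@galois R) eta].

Lemma galois_orbit_ex eta : exists s, galois_orbit_spec eta s.
Proof.
have [n [nP _]] := pdenom_common2 eta eta; have [n0 _] := nP.
have memE zeta : (zeta \in undup (traject (@galois R) eta n)) =
    (zeta \in traject (@galois R) eta n) by rewrite mem_undup.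
exists (undup (traject (@galois R) eta n)); split.
- exact: undup_uniq.
- by rewrite memE; apply/trajectP; exists 0%N.
- move=> zeta; rewrite !memE => /trajectP[i i_n ->]; apply/trajectP.
  move: i_n; rewrite leq_eqVlt => /orP[/eqP iE|i_n]; last by exists i.+1.
  by exists 0%N => //; rewrite -iterS iE galois_order.
- by move=> zeta; rewrite memE => /trajectP[i _ ->]; exists i.
Qed.

(** The conjugates of [eta]; the action being through a finite cyclic group, they
    are finitely many. *)
Definition galois_orbit eta : seq P := sval (cid (galois_orbit_ex eta)).
Lemma galois_orbitP eta : galois_orbit_spec eta (galois_orbit eta).
Proof. exact: (svalP (cid (galois_orbit_ex eta))). Qed.

Lemma galois_orbit_id eta : eta \in galois_orbit eta.
Proof. by case: (galois_orbitP eta). Qed.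

Lemma galois_orbit_perm eta : perm_eq [seq galois z | z <- galois_orbit eta] (galois_orbit eta).
Proof.
have [us _ gs _] := galois_orbitP eta.
have ug : uniq [seq galois z | z <- galois_orbit eta].
  by rewrite map_inj_uniq //; apply: galois_inj.
have sub : {subset [seq galois z | z <- galois_orbit eta] <= galois_orbit eta}.
  by move=> _ /mapP[z zs ->]; apply: gs.
apply: uniq_perm => //; apply: (uniq_min_size ug sub _).2.
by rewrite size_map.
Qed.

Lemma map_iota_inj : injective (map_poly iota).
Proof. exact: map_inj_poly (@puiseux_of_fps_inj C) (rmorph0 _). Qed.

(** Descent of the coefficients. *)
Lemma galois_fixed_poly (p : {poly P}) : map_poly (@galois R) p = p ->
  exists q, p = map_poly iota q.
Proof.
move=> pp; have ai i : exists a, p`_i = iota a.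
  by apply: galois_fixed; have := congr1 (fun r : {poly P} => r`_i) pp; rewrite coef_map.
have [a aE] := choice ai; exists (\poly_(i < size p) a i).
apply/polyP => i; rewrite coef_map coef_poly; case: ltnP => [_|pi]; first exact: aE.
by rewrite nth_default //; apply/esym; exact: raddf0.
Qed.

Lemma minp_ex eta : exists p, map_poly iota p = \prod_(z <- galois_orbit eta) ('X - z%:P).
Proof.
have [|p pE] := @galois_fixed_poly (\prod_(z <- galois_orbit eta) ('X - z%:P)).
  rewrite map_prod_XsubC -(big_map (@galois R) predT (fun z => 'X - z%:P)).
  exact: perm_big (galois_orbit_perm eta).
by exists p.
Qed.

Definition minp eta : {poly fps C} := sval (cid (minp_ex eta)).
Lemma minpE eta : map_poly iota (minp eta) = \prod_(z <- galois_orbit eta) ('X - z%:P).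
Proof. exact: (svalP (cid (minp_ex eta))). Qed.

Lemma size_map_iota p : size (map_poly iota p) = size p.
Proof. by rewrite (size_map_inj_poly (@puiseux_of_fps_inj C)) ?rmorph0. Qed.

Lemma monic_map_iota p : (map_poly iota p \is monic) = (p \is monic).
Proof.
rewrite !monicE /lead_coef size_map_iota coef_map -[X in _ == X](rmorph1 iota).
by rewrite (inj_eq (@puiseux_of_fps_inj C)).
Qed.

Lemma minp_monic eta : minp eta \is monic.
Proof. by rewrite -monic_map_iota minpE monic_prod_XsubC. Qed.

Lemma size_minp eta : size (minp eta) = (size (galois_orbit eta)).+1.
Proof. by rewrite -size_map_iota minpE size_prod_XsubC. Qed.

Lemma root_minp eta zeta : root (map_poly iota (minp eta)) zeta = (zeta \in galois_orbit eta).
Proof. by rewrite minpE root_prod_XsubC. Qed.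

Lemma map_galois_iota p : map_poly (@galois R) (map_poly iota p) = map_poly iota p.
Proof. by apply/polyP => i; rewrite !coef_map; apply: galois_fps. Qed.

Lemma root_galois p eta : root (map_poly iota p) eta -> root (map_poly iota p) (galois eta).
Proof.
move=> /rootP pe; apply/rootP; rewrite -map_galois_iota horner_map /= pe.
exact: rmorph0.
Qed.

(** The cofactor of [minp eta] is invariant under the Galois action. *)
Lemma minp_dvd eta p : root (map_poly iota p) eta -> exists q, p = minp eta * q.
Proof.
move=> pe; have [us _ _ os] := galois_orbitP eta.
have [z|q qE] := uniq_roots_factor us (p := map_poly iota p).
  by move=> /os[m ->]; elim: m => //= m; apply: root_galois.
move: qE; rewrite -minpE => qE.
have [|q' q'E] := @galois_fixed_poly q.
  have m0 : map_poly iota (minp eta) != 0.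
    by rewrite monic_neq0 // monic_map_iota minp_monic.
  apply: (mulfI m0); rewrite -{1}(map_galois_iota (minp eta)) -rmorphM /=.
  by rewrite -qE map_galois_iota.
by exists q'; apply: map_iota_inj; rewrite rmorphM /= -q'E.
Qed.

(** Induction on the degree: by the Newton-Puiseux theorem [p] has a root, whose
    minimal polynomial divides it. *)
Lemma minp_split p : p \is monic -> exists s : seq P,
  p = \prod_(eta <- s) minp eta /\ forall eta, eta \in s -> root (map_poly iota p) eta.
Proof.
have [n] := ubnP (size p); elim: n p => // n IH p; rewrite ltnS => pn pm.
have [p1|p1] := leqP (size p) 1.
  have p0 : size p = 1%N by apply/eqP; rewrite eqn_leq p1 size_poly_gt0 monic_neq0.
  exists [::]; split => //; rewrite big_nil [LHS]size1_polyC //.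
  by move: pm; rewrite monicE /lead_coef p0 => /eqP ->.
have [||eta reta] := @newton_puiseux C (map_poly iota p).
- by rewrite monic_map_iota.
- by rewrite size_map_iota.
have [q pE] := minp_dvd reta.
have qm : q \is monic by move: pm; rewrite pE monicMl ?minp_monic.
have [|s [qE sq]] := IH q _ qm.
  have spE : size p = (size (minp eta) + size q).-1.
    by rewrite pE; apply: size_monicM; [exact: minp_monic | exact: monic_neq0].
  apply: leq_trans pn; rewrite spE size_minp addSn /= -[X in (X < _)%N]add0n ltn_add2r -has_predT.
  by apply/hasP; exists eta => //; apply: galois_orbit_id.
exists (eta :: s); split; first by rewrite big_cons -qE.
move=> z; rewrite inE => /orP[/eqP -> //|/sq rz].
by rewrite pE rmorphM rootM rz orbT.
Qed.

Lemma galois_orbit_at0 eta zeta : pcoef eta 0 = 0 -> zeta \in galois_orbit eta -> pcoef zeta 0 = 0.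
Proof.
move=> e0; have [_ _ _ os] := galois_orbitP eta => /os[m ->].
by rewrite iter_galoisE e0 mulr0.
Qed.

Lemma minp_weierstrass eta : pcoef eta 0 = 0 -> weierstrass (minp eta).
Proof.
move=> e0; split; first exact: minp_monic.
move=> j; rewrite size_minp /= => js.
have -> : fcoef (minp eta)`_j 0 =
    (map_poly (@puiseux_at0 C) (map_poly iota (minp eta)))`_j.
  by rewrite !coef_map; rewrite [RHS](pcoef_fpsn _ 0).
rewrite minpE map_prod_XsubC big_seq.
under eq_bigr => z zs do rewrite /= /puiseux_at0 (galois_orbit_at0 e0 zs) polyC0 subr0.
by rewrite -big_seq big_const_seq iter_mulr_1 count_predT coefXn ltn_eqF.
Qed.

(** Factor out the largest power of [x], then apply Weierstrass preparation. *)
Lemma fps2_structure (f : fps (fps C)) : f != 0 ->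
  exists n u p, [/\ invertible u, weierstrass p & f = fpsC fpsX ^+ n * u * fps_of_poly p].
Proof.
move=> /fps2_X_factor[n [g [j0 [fE gj0]]]].
have ex : exists j, fcoef (fcoef g j) 0 != 0 by exists j0.
case: (ex_minnP ex) => m gm mmin.
have [||u [p [uu wp _ gE]]] := @weierstrass_preparation C g m => //.
  by move=> j jm; apply/eqP/negPn/negP => /mmin; rewrite leqNgt jm.
by exists n, u, p; split; rewrite ?fE ?gE ?mulrA.
Qed.

Section SubstAt.
Variable eta : P.
Hypothesis eta0 : pcoef eta 0 = 0.

Lemma subst1 : puiseux_subst 1 eta = 1.
Proof.
have -> : 1 = fps_of_poly 1 :> fps (fps C) by rewrite rmorph1.
by rewrite subst_poly // rmorph1 hornerC.
Qed.
Lemma substX n : puiseux_subst (fpsC fpsX ^+ n) eta = puiseux_X C n%:R.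
Proof.
have -> : fpsC fpsX ^+ n = fps_of_poly (fpsX ^+ n)%:P :> fps (fps C).
  by rewrite rmorphXn rmorphXn /=; congr (_ ^+ _); apply: fpsP => -[|k] /=; rewrite coefC.
by rewrite subst_poly // map_polyC hornerC puiseux_X_nat.
Qed.

Lemma subst_invertible u : invertible u -> ordx R (puiseux_subst u eta) = 0%E.
Proof.
move=> [v uv]; have : (ordx R (puiseux_subst u eta) + ordx R (puiseux_subst v eta) = 0)%E.
  by rewrite -ordxM -substM // uv subst1 ordx1.
move=> /eqP; rewrite padde_eq0 ?ordx_ge0 //.
by case/andP => /eqP.
Qed.

Lemma subst_poly_eq0 p : puiseux_subst (fps_of_poly p) eta = 0 <-> root (map_poly iota p) eta.
Proof. by rewrite subst_poly //; split => /rootP. Qed.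

(** Neither the power of [x] nor the unit vanishes at [eta], so that the
    Weierstrass polynomial does. *)
Lemma subst_minp_dvd (g : fps (fps C)) : puiseux_subst g eta = 0 ->
  exists h, g = fps_of_poly (minp eta) * h.
Proof.
have [->|g0] := eqVneq g 0; first by exists 0; rewrite mulr0.
have [n [u [p [uu wp gE]]]] := fps2_structure g0; rewrite gE !substM // => /eqP.
rewrite !mulf_eq0 => /orP[/orP[]|/eqP /subst_poly_eq0 /minp_dvd[q pE]].
- rewrite substX => /eqP X0; have := @ordxX R C n%:R (ler0n _ _).
  by rewrite X0 ordx0.
- by move=> /eqP u0; have := subst_invertible uu; rewrite u0 ordx0.
- by exists (fpsC fpsX ^+ n * u * fps_of_poly q); rewrite pE rmorphM /= mulrCA.
Qed.

Lemma minp_not_invertible : ~ invertible (fps_of_poly (minp eta)).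
Proof.
move=> /subst_invertible; rewrite (_ : puiseux_subst _ _ = 0) ?ordx0 //.
by apply/subst_poly_eq0; rewrite root_minp galois_orbit_id.
Qed.

(** One of two factors vanishes at [eta]; being divisible by the product, it
    makes the other one invertible. *)
Lemma minp_irreducible_fps : irreducible_elt (fps_of_poly (minp eta)).
Proof.
have m0 : fps_of_poly (minp eta) != 0.
  rewrite -(rmorph0 (@fps_of_poly (fps C))) (inj_eq (@fps_of_poly_inj _)).
  by rewrite monic_neq0 // minp_monic.
split=> //; first exact: minp_not_invertible.
move=> g h ghE; have : puiseux_subst g eta * puiseux_subst h eta = 0.
  by rewrite -substM // -ghE; apply/subst_poly_eq0; rewrite root_minp galois_orbit_id.
move=> /eqP; rewrite mulf_eq0 => /orP[] /eqP /subst_minp_dvd[k kE]; [right|left].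
  by exists k; apply: (mulfI m0); rewrite mulr1 [RHS]ghE kE [h * k]mulrC mulrA.
by exists k; apply: (mulfI m0); rewrite mulr1 [RHS]ghE kE mulrCA.
Qed.

Lemma minp_irreducible : irreducible_elt (minp eta).
Proof.
have m0 : minp eta != 0 by rewrite monic_neq0 // minp_monic.
split=> //.
  move=> [g /(congr1 (@fps_of_poly _))]; rewrite rmorphM rmorph1 => mg.
  by apply: minp_not_invertible; exists (fps_of_poly g).
move=> g h ghE; have : root (map_poly iota (minp eta)) eta by rewrite root_minp galois_orbit_id.
rewrite ghE rmorphM rootM => /orP[] /minp_dvd[k kE]; [right|left].
  by exists k; apply: (mulfI m0); rewrite mulr1 [RHS]ghE kE [h * k]mulrC mulrA.
by exists k; apply: (mulfI m0); rewrite mulr1 [RHS]ghE kE mulrCA.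
Qed.

End SubstAt.
End MinimalPolynomial.

Section Ideals.
Variable A : comNzRingType.
Implicit Types f g : A.

Lemma ZE f g : Z f = Z g <-> (exists h, f = g * h) /\ (exists h, g = f * h).
Proof.
split=> [fg|[[h fE] [k gE]]].
  have Zff (h : A) : Z h h by exists 1; rewrite mulr1.
  by split; [move: (Zff f); rewrite fg | move: (Zff g); rewrite -fg].
apply/seteqP; split=> _ [l ->].
  by exists (h * l); rewrite fE mulrA.
by exists (k * l); rewrite gE mulrA.
Qed.

Lemma Z_unit f u : invertible u -> Z (f * u) = Z f.
Proof.
move=> [v uv]; apply/ZE; split; first by exists u.
by exists v; rewrite -mulrA uv mulr1.
Qed.

End Ideals.

Section Branches.
Variables (R : realType) (O : comAlgType R[i]).
Variable psi : {rmorphism O -> fps (fps R[i])}.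
Variable L : set O.
Hypothesis hpsi : adapted_coordinates L psi.
Local Notation C := R[i].
Local Notation P := (puiseux C).
Local Notation iota := (@puiseux_of_fps C).
Implicit Types (f g : O) (eta zeta : P).

Lemma psi_inj : injective psi.
Proof. by case: hpsi => -[[phi h _] _] _; apply: can_inj h. Qed.

Lemma psi_surj F : exists f, psi f = F.
Proof. by case: hpsi => -[[phi _ h] _] _; exists (phi F). Qed.

Lemma psi_scalar (c : C) : psi c%:A = fpsC (fpsC c).
Proof. by case: hpsi => -[]. Qed.

Lemma LE : L = psi @^-1` Z (fpsC fpsX).
Proof. by case: hpsi. Qed.

Lemma psi_invertible f : invertible (psi f) <-> invertible f.
Proof.
split=> [[G fG]|[g fg]]; last by exists (psi g); rewrite -rmorphM fg rmorph1.
have [g gG] := psi_surj G; exists g; apply: psi_inj.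
by rewrite rmorphM rmorph1 gG.
Qed.

Lemma psi_irreducible f : irreducible_elt (psi f) <-> irreducible_elt f.
Proof.
split=> -[f0 fu fI]; split.
- by apply: contra_neq f0 => ->; rewrite rmorph0.
- by move=> /psi_invertible.
- by move=> g h fE; have := fI (psi g) (psi h); rewrite fE rmorphM !psi_invertible; apply.
- by apply: contra_neq f0 => f0; apply: psi_inj; rewrite rmorph0.
- by move=> /psi_invertible.
- move=> G H; have [g <-] := psi_surj G; have [h <-] := psi_surj H.
  by rewrite -rmorphM => /psi_inj fE; rewrite !psi_invertible; apply: fI.
Qed.

Lemma psi_Z f : psi @^-1` Z (psi f) = Z f.
Proof.
apply/seteqP; split=> g /= [h gE]; last by exists (psi h); rewrite gE rmorphM.
have [k kh] := psi_surj h; exists k; apply: psi_inj.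
by rewrite rmorphM kh.
Qed.

Lemma preimage_psi_inj A B : psi @^-1` A = psi @^-1` B -> A = B.
Proof.
move=> AB; apply/seteqP; split=> F; have [f <-] := psi_surj F; move: AB.
  by move=> /(congr1 (fun S => S f)) /= ->.
by move=> /(congr1 (fun S => S f)) /= <-.
Qed.

(** The equations of [L] are the products of [x] and a unit. *)
Lemma L_Z f : L = Z f <-> exists2 u, invertible u & psi f = fpsC fpsX * u.
Proof.
rewrite LE -psi_Z; split=> [/preimage_psi_inj/ZE[[h xE] [k fE]]|[u uu ->]]; last first.
  by rewrite Z_unit.
exists k => //; exists h.
have x0 : fpsC fpsX != 0 :> fps (fps C).
  apply/eqP => /(congr1 (fun F => fcoef (fcoef F 0) 1)) /= /eqP.
  by rewrite oner_eq0.
by apply: (mulfI x0); rewrite mulr1 [RHS]xE fE mulrA.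
Qed.

Definition branch_of eta : set O := psi @^-1` Z (fps_of_poly (minp eta)).

Lemma branch_of_branch eta : pcoef eta 0 = 0 -> branch (branch_of eta).
Proof.
move=> e0; have [f fE] := psi_surj (fps_of_poly (minp eta)).
exists f; last by rewrite -psi_Z fE.
by apply/psi_irreducible; rewrite fE; apply: minp_irreducible_fps.
Qed.

Lemma branch_of_neqL eta : pcoef eta 0 = 0 -> branch_of eta <> L.
Proof.
move=> e0; rewrite LE => /preimage_psi_inj/ZE[_ [h xE]].
have := @ordxX R C 1 ler01; rewrite -[1%R]/(1%:R) -(substX e0) expr1 xE substM //.
rewrite (_ : puiseux_subst _ eta = 0) ?mul0r ?ordx0 //.
by apply/subst_poly_eq0 => //; rewrite root_minp galois_orbit_id.
Qed.

(** Two Weierstrass polynomials that define the same branch divide each other,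
    and have the same roots. *)
Lemma Zer_branch_of eta zeta : pcoef eta 0 = 0 ->
  Zer psi (branch_of eta) zeta <-> zeta \in galois_orbit eta.
Proof.
move=> e0; split=> [[p [pm pI pj pE] pz]|zs]; last first.
  exists (minp eta); last by rewrite root_minp.
  split=> //; [exact: minp_monic | exact: minp_irreducible |].
  exact: (minp_weierstrass e0).2.
have z0 : pcoef zeta 0 = 0 := weierstrass_root (conj pm pj) pz.
move/preimage_psi_inj/ZE: pE => [[h pE] _].
rewrite -root_minp; apply/subst_poly_eq0 => //.
by rewrite pE substM // (subst_poly_eq0 z0 p).2 // mul0r.
Qed.

(** A generator of a branch other than [L] is not divisible by [x], so that it
    is, up to a unit, a Weierstrass polynomial; the minimal polynomial of any of
    its roots divides it. *)
Lemma branchP A : branch A -> A <> L -> exists2 eta, pcoef eta 0 = 0 & A = branch_of eta.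
Proof.
move=> [f /psi_irreducible fI <-] fL; have [f0 fu fII] := fI.
have [n [u [p [uu wp fE]]]] := fps2_structure f0.
case: n fE => [|n] fE; last first.
  rewrite exprS -!mulrA in fE; case: fL; apply/esym/L_Z.
  exists (fpsC fpsX ^+ n * (u * fps_of_poly p)) => //.
  case: (fII _ _ fE) => // -[g /(congr1 (fun F => fcoef (fcoef F 0) 0))].
  by rewrite !fcoef0M /= mul0r => /eqP; rewrite eq_sym oner_eq0.
rewrite mul1r in fE.
have p1 : (1 < size p)%N.
  rewrite ltnNge; apply/negP => p1; apply: fu; rewrite fE.
  have -> : p = 1.
    have p0 : size p = 1%N by apply/eqP; rewrite eqn_leq p1 size_poly_gt0 monic_neq0 // wp.1.
    by rewrite [LHS]size1_polyC //; move: wp.1; rewrite monicE /lead_coef p0 => /eqP ->.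
  by rewrite rmorph1 mulr1.
have [||eta reta] := @newton_puiseux C (map_poly iota p).
- by rewrite monic_map_iota wp.1.
- by rewrite size_map_iota.
have e0 := weierstrass_root wp reta; exists eta => //.
have [q pE] := minp_dvd reta.
have fE' : psi f = fps_of_poly (minp eta) * (fps_of_poly q * u).
  by rewrite fE pE rmorphM /= mulrC mulrA.
case: (fII _ _ fE') => [/(minp_not_invertible e0)//|qu].
by rewrite -psi_Z fE' Z_unit.
Qed.

End Branches.

(** * The semivaluations of the Eggers-Wall tree *)

Section GaussSum.
Variable R : realType.
Local Notation P := (puiseux R[i]).
Implicit Types (xi : P) (s : seq P).
Local Open Scope ereal_scope.

(** The value at [\prod_(z <- s) (y - z)] of the semivaluation with center [xi]
    and exponent [alpha]. *)
Definition gauss_sum xi (alpha : \bar R) s : \bar R :=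
  \sum_(z <- s) mine alpha (ordx R (xi - z)%R).

Lemma min_le_le (x y a b c : \bar R) : x <= a -> y <= b -> mine a b <= c -> mine x y <= c.
Proof. by move=> xa yb; apply: le_trans; rewrite le_min !ge_min xa yb orbT. Qed.

Lemma gauss_sum_ge0 xi alpha s : 0 <= alpha -> 0 <= gauss_sum xi alpha s.
Proof. by move=> a0; apply: sume_ge0 => z _; rewrite le_min a0 ordx_ge0. Qed.

Lemma gauss_sum0 xi s : gauss_sum xi 0 s = 0.
Proof. by apply: big1 => z _; apply/min_idPl/ordx_ge0. Qed.

Lemma gauss_sum_cat xi alpha s t :
  gauss_sum xi alpha (s ++ t) = gauss_sum xi alpha s + gauss_sum xi alpha t.
Proof. by rewrite /gauss_sum big_cat. Qed.

Lemma gauss_sum_le xi alpha beta s : alpha <= beta ->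
  gauss_sum xi alpha s <= gauss_sum xi beta s.
Proof.
move=> ab; apply: lee_sum => z _; rewrite le_min ge_min ab /=.
by rewrite ge_min lexx orbT.
Qed.

(** Each of the terms is a function of slope at most 1 of the exponent. *)
Lemma gauss_sum_lip xi (a b : R) s : (a <= b)%R ->
  gauss_sum xi b%:E s <= gauss_sum xi a%:E s + ((b - a) *+ size s)%:E.
Proof.
move=> ab; have ba0 : (0 <= b - a)%R by rewrite subr_ge0.
elim: s => [|z s IH]; first by rewrite /gauss_sum !big_nil mulr0n add0e.
rewrite /gauss_sum !big_cons /= mulrS EFinD addeACA; apply: leeD; last exact: IH.
case: ordxP => [_|q _ _ _]; first by rewrite !minEle !leey -EFinD lee_fin addrC subrK.
rewrite -!EFin_min -EFinD lee_fin; case: (leP b (ratr q)) => h; case: (leP a (ratr q)) => h'; lra.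
Qed.

(** Beyond the largest finite distance to [s], only a term [z = xi] still grows;
    it grows to infinity. *)
Lemma gauss_sum_oo xi s (c : R) : c%:E < gauss_sum xi +oo s ->
  exists2 a : R, (0 <= a)%R & c%:E < gauss_sum xi a%:E s.
Proof.
move=> cs; case: (pselect (xi \in s)) => [xs|/negP xs].
  exists (`|c| + 1)%R; first by rewrite addr_ge0.
  rewrite /gauss_sum (perm_big _ (perm_to_rem xs)) big_cons subrr ordx0 minEle leey.
  rewrite -[c%:E]addr0 lte_leD // ?lte_fin ?gauss_sum_ge0 ?lee_fin ?addr_ge0 //.
  by rewrite (le_lt_trans (ler_norm c)) // ltrDl.
pose b := fine (gauss_sum xi +oo s).
have fs z : z \in s -> ordx R (xi - z)%R \is a fin_num.
  move=> zs; case: ordxP => // /eqP; rewrite subr_eq0 => /eqP xz.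
  by rewrite xz zs in xs.
exists b; first by rewrite fine_ge0 // gauss_sum_ge0.
suff -> : gauss_sum xi b%:E s = gauss_sum xi +oo s by [].
rewrite /gauss_sum big_seq [RHS]big_seq; apply: eq_bigr => z zs.
have zle : ordx R (xi - z)%R <= b%:E.
  rewrite fineK; last first.
    by apply/sum_fin_numP => y ys _; rewrite (min_idPr (leey _)); apply: fs.
  rewrite /gauss_sum (perm_big _ (perm_to_rem zs)) big_cons.
  rewrite (min_idPr (leey _)).
  by rewrite leeDl // gauss_sum_ge0.
by rewrite (min_idPr zle) (min_idPr _) // leey.
Qed.

Lemma gauss_sum_fin xi (r : R) s : (0 <= r)%R -> gauss_sum xi r%:E s \is a fin_num.
Proof.
move=> r0; rewrite ge0_fin_numE ?gauss_sum_ge0 // /gauss_sum.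
elim: s => [|z t IH]; first by rewrite big_nil ltey.
by rewrite big_cons lte_add_pinfty // gt_min ltey.
Qed.

End GaussSum.

Lemma not_in_seq (K : numDomainType) (l : seq K) : exists c, c \notin l.
Proof.
exists (1 + \sum_(x <- l) `|x|); apply/negP; set c := _ + _ => cl.
have s0 (r : seq K) : 0 <= \sum_(x <- r) `|x| by apply: sumr_ge0.
have c0 : 0 <= c by rewrite addr_ge0.
have : c <= \sum_(x <- l) `|x|.
  by rewrite (perm_big _ (perm_to_rem cl)) big_cons /= ger0_norm // lerDl.
by rewrite /c gerDr ler10.
Qed.

Section Semivaluation.
Variables (R : realType) (O : comAlgType R[i]).
Variable psi : {rmorphism O -> fps (fps R[i])}.
Variable L : set O.
Hypothesis hpsi : adapted_coordinates L psi.
Local Notation C := R[i].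
Local Notation P := (puiseux C).
Local Notation iota := (@puiseux_of_fps C).
Implicit Types (f g : O) (xi eta zeta : P) (s t : seq P).

(** [f] vanishes to the order [n] along [L], and [s] lists its Newton-Puiseux
    roots. *)
Definition has_roots f n s := exists u p,
  [/\ invertible u, weierstrass p, map_poly iota p = \prod_(z <- s) ('X - z%:P) &
      psi f = fpsC fpsX ^+ n * u * fps_of_poly p].

Lemma has_roots_ex f : f != 0 -> exists n s, has_roots f n s.
Proof.
move=> f0; have pf0 : psi f != 0.
  by apply: contra_neq f0 => f0; apply: (psi_inj hpsi); rewrite rmorph0.
have [n [u [p [uu wp fE]]]] := fps2_structure pf0.
have [|s sE] := @puiseux_split C (map_poly iota p); first by rewrite monic_map_iota wp.1.
by exists n, s, u, p.
Qed.

(** The reduction modulo [x] is multiplicative. *)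
Lemma weierstrassM (p q : {poly fps C}) : weierstrass p -> weierstrass q -> weierstrass (p * q).
Proof.
move=> [pm pj] [qm qj]; split; first by rewrite monicMl.
have red (r : {poly fps C}) : r \is monic ->
    (forall j, (j < (size r).-1)%N -> fcoef r`_j 0 = 0) <->
    map_poly (@fps_at0 C) r = 'X^((size r).-1).
  move=> rm; have r0 : (0 < size r)%N by rewrite size_poly_gt0 monic_neq0.
  split=> [rj|rX j jr]; last first.
    by have := congr1 (fun h : {poly C} => h`_j) rX; rewrite coef_map coefXn ltn_eqF.
  apply/polyP => i; rewrite coef_map coefXn.
  have [ir|ri|->] := ltngtP i (size r).-1; first exact: rj.
    by rewrite nth_default ?rmorph0 // -(prednK r0).
  by move: rm; rewrite monicE /lead_coef => /eqP ->; rewrite rmorph1.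
apply/red; first by rewrite monicMl.
rewrite rmorphM /= (red p pm).1 // (red q qm).1 // -exprD; congr 'X^_.
rewrite size_Mmonic ?monic_neq0 //; have := size_poly_gt0 p; have := size_poly_gt0 q.
by rewrite !monic_neq0 //; case: (size p) (size q) => [|a] [|b] //=; rewrite addnS.
Qed.

Lemma has_rootsM f g n m s t : has_roots f n s -> has_roots g m t ->
  has_roots (f * g) (n + m) (s ++ t).
Proof.
move=> [u [p [uu wp pE fE]]] [v [q [vu wq qE gE]]]; exists (u * v), (p * q); split.
- exact: invertibleM.
- exact: weierstrassM.
- by rewrite rmorphM /= pE qE big_cat.
- by rewrite rmorphM fE gE rmorphM exprD /=; ring.
Qed.

Lemma has_roots_unit f u n : invertible u -> psi f = fpsC fpsX ^+ n * u -> has_roots f n [::].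
Proof.
move=> uu fE; exists u, 1; split=> //.
- by split=> [|j]; rewrite ?monic1 // size_poly1.
- by rewrite rmorph1 big_nil.
- by rewrite rmorph1 mulr1.
Qed.

Lemma has_roots_minp f eta : pcoef eta 0 = 0 -> psi f = fps_of_poly (minp eta) ->
  has_roots f 0 (galois_orbit eta).
Proof.
move=> e0 fE; exists 1, (minp eta); split.
- by exists 1; rewrite mulr1.
- exact: minp_weierstrass.
- exact: minpE.
- by rewrite fE !mul1r.
Qed.

Lemma has_roots_at0 f n s z : has_roots f n s -> z \in s -> pcoef z 0 = 0.
Proof.
move=> [u [p [_ wp pE _]]] zs; apply: (weierstrass_root wp).
by rewrite pE root_prod_XsubC.
Qed.

Lemma ordx_subst f n s eta : has_roots f n s -> pcoef eta 0 = 0 ->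
  ordx R (puiseux_subst (psi f) eta) =
  (n%:R%:E + \sum_(z <- s) ordx R (eta - z)%R)%E.
Proof.
move=> [u [p [uu _ pE fE]]] e0; rewrite fE !substM // !ordxM.
rewrite substX // ordxX // (subst_invertible e0 uu) adde0 ratr_nat; congr (_ + _)%E.
by rewrite subst_poly // pE horner_prod ordx_prod; under eq_bigr do rewrite hornerXsubC.
Qed.

Lemma Lx_ex : exists2 x0, psi x0 = fpsC fpsX & L = Z x0.
Proof.
have [x0 xE] := psi_surj hpsi (fpsC fpsX); exists x0 => //.
by rewrite (LE hpsi) -(psi_Z hpsi) xE.
Qed.

(** The order along [L] is the order of divisibility by [x], as the cofactor
    does not vanish modulo [x]. *)
Lemma ord_along_roots f n s : has_roots f n s -> ord_along L f = n%:R%:E.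
Proof.
move=> [u [p [uu wp _ fE]]]; apply/eqP; rewrite eq_le; apply/andP; split; last first.
  apply: ereal_sup_ubound; exists n => //=.
  have [x0 xE LZ] := Lx_ex; exists x0 => //.
  by rewrite -(psi_Z hpsi) /= rmorphXn xE fE -mulrA; exists (u * fps_of_poly p).
apply/ereal_supP => _ [k /= [g /(L_Z hpsi)[v vu gE]] kf <-].
rewrite lee_fin ler_nat leqNgt; apply/negP => nk.
have [h hE] : exists h, psi f = fpsC fpsX ^+ k * h.
  move: kf; rewrite -(psi_Z hpsi) => -[h /= ->]; exists (v ^+ k * h).
  by rewrite rmorphXn gE exprMn mulrA.
have x0 : fpsC fpsX ^+ n != 0 :> fps (fps C).
  apply/expf_neq0/eqP => /(congr1 (fun F => fcoef (fcoef F 0) 1)) /= /eqP.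
  by rewrite oner_eq0.
have uph : u * fps_of_poly p = fpsC fpsX ^+ (k - n) * h.
  by apply: (mulfI x0); rewrite mulrA -fE hE mulrA -exprD subnKC // ltnW.
have := congr1 (@fps_at0 (fps C)) (congr1 (@fps_tr C) uph).
rewrite !fps_trM !rmorphM -fps_trX fps_trK.
have X0 : fps_at0 (fpsX ^+ (k - n)) = 0 :> fps C.
  by rewrite -[fpsX ^+ _]mulr1 /fps_at0 fcoefXnM subn_gt0 nk.
rewrite [X in _ = X * _]X0 mul0r => /eqP; rewrite mulf_eq0 => /orP[] /eqP.
  move=> /(congr1 (fun F => fcoef F 0)); rewrite fcoef0 /= => /eqP.
  by apply/negP; apply/fps2_invertible.
move=> /(congr1 (fun F => fcoef F (size p).-1)); rewrite fcoef0 /=.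
by move: wp.1; rewrite monicE /lead_coef => /eqP -> /eqP; rewrite oner_eq0.
Qed.

Local Open Scope ereal_scope.

Lemma NP_at0 xi alpha eta : pcoef xi 0 = 0%R -> 0 < alpha -> NP xi alpha eta -> pcoef eta 0 = 0%R.
Proof.
move=> x0 a0; rewrite /NP /mkset => h; have /ordx_gt0 := lt_le_trans a0 h.
by rewrite pcoefB x0 subr0.
Qed.

(** The infimum over the series having contact at least [alpha] with [xi] is
    approached by those of the form [xi + c x^q], where [q] decreases to [alpha]
    and [c] avoids finitely many values, so that no cancellation with a root
    occurs. *)
Lemma nu_xi_roots xi alpha f n s : pcoef xi 0 = 0%R -> 0 <= alpha -> has_roots f n s ->
  nu_xi L psi xi alpha f = n%:R%:E + gauss_sum xi alpha s.
Proof.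
move=> x0 a0 fs; rewrite /nu_xi; case: eqVneq => [->|an0].
  by rewrite (ord_along_roots fs) gauss_sum0 adde0.
have {an0}a0 : 0 < alpha by rewrite lt_neqAle eq_sym an0.
apply/eqP; rewrite eq_le; apply/andP; split; last first.
  apply/ereal_infP => _ [eta /[dup] etaN /(NP_at0 x0 a0) e0 <-].
  rewrite (ordx_subst fs e0) leeD2l //; apply: lee_sum => z _.
  apply: le_trans (ordx_tri R eta xi z); rewrite le_min ge_min.
  by rewrite (le_trans _ etaN) ?ge_min ?lexx ?orbT.
case: alpha a0 => [a|_|//]; last first.
  apply: ereal_inf_lbound; exists xi; first by rewrite /NP /mkset subrr ordx0.
  rewrite (ordx_subst fs x0) /gauss_sum; congr (_ + _); apply: eq_bigr => z _.
  by rewrite (min_idPr _) // leey.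
rewrite lte_fin => a0; apply/lee_addgt0Pr => e e0.
have d0 : (0 < e / (size s).+1%:R)%R by rewrite divr_gt0.
(* [q] is close enough to [alpha], in terms of the number of roots. *)
have [|q] := @rat_in_itvoo R a (a + e / (size s).+1%:R)%R; first by rewrite ltrDl.
rewrite in_itv /= => /andP[aq qe].
have q0 : (0 <= q)%R by rewrite -(ler0q R) ltW // (lt_trans a0).
(* [c] differs from the coefficient of [x^q] in each [z - xi]. *)
have [c cP] := not_in_seq [seq pcoef (z - xi)%R q | z <- s].
pose h : P := (puiseux_X C q * puiseux_const c)%R.
have hE q' : pcoef h q' = if q' == q then c else 0%R.
  by rewrite pcoefXM //= /pc_const subr_eq0.
have hq : (ratr q)%:E <= ordx R h.
  by apply: ordx_ge => q'; rewrite hE => /lt_eqF ->.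
pose eta := (xi + h)%R.
have etaN : NP xi a%:E eta.
  by rewrite /NP /mkset /eta addrAC subrr add0r (le_trans _ hq) // lee_fin ltW.
have e0' : pcoef eta 0 = 0%R by apply: NP_at0 etaN.
apply: (@le_trans _ _ (n%:R%:E + gauss_sum xi (ratr q)%:E s)).
  apply: (@le_trans _ _ (ordx R (puiseux_subst (psi f) eta))).
    by apply: ereal_inf_lbound; exists eta.
  have ez z q' : pcoef (eta - z)%R q' = (pcoef (xi - z)%R q' + pcoef h q')%R.
    by rewrite -pcoefD addrAC.
  have hz z : z \in s -> ordx R (eta - z)%R <= (ratr q)%:E.
    move=> zs; apply: ordx_le.
    rewrite ez hE eqxx -[(xi - z)%R]opprB pcoefN addrC subr_eq0.
    by apply: contra cP => /eqP ->; apply/mapP; exists z.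
  rewrite (ordx_subst fs e0') leeD2l // /gauss_sum big_seq [X in _ <= X]big_seq.
  apply: lee_sum => z zs; rewrite le_min hz //=.
  case: (ordxP R (xi - z)%R) => [_|k km k0 _]; first exact: leey.
  have [qk|kq] := leP q k.
    by apply: (le_trans (hz _ zs)); rewrite lee_fin ler_rat.
  by apply: ordx_le; rewrite ez hE ifF ?addr0 // lt_eqF.
rewrite -addeA leeD2l //; apply: le_trans (gauss_sum_lip _ _ (ltW aq)) _.
rewrite leeD2l // lee_fin; apply: (@le_trans _ _ ((e / (size s).+1%:R) *+ size s)%R).
  by rewrite ler_wMn2r // lerBlDl ltW.
rewrite -[(_ *+ size s)%R]mulr_natr -mulrA ger_pMr //.
by rewrite mulrC ler_pdivrMr ?ltr0n // mul1r ler_nat.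
Qed.

Lemma subst_0 eta : pcoef eta 0 = 0%R -> puiseux_subst 0%R eta = 0%R :> P.
Proof. by move=> e0; apply: (@addrI _ (puiseux_subst 0%R eta)); rewrite -substD // !addr0. Qed.

Lemma ord_along_ge x0 (k : nat) f : psi x0 = fpsC fpsX -> Z (x0 ^+ k)%R f ->
  k%:R%:E <= ord_along L f.
Proof.
move=> xE kf; apply: ereal_sup_ubound; exists k => //=; exists x0 => //.
by rewrite (LE hpsi) -(psi_Z hpsi) xE.
Qed.

Lemma ord_along_Z x0 f n s : psi x0 = fpsC fpsX -> has_roots f n s -> Z (x0 ^+ n)%R f.
Proof.
move=> xE [u [p [_ _ _ fE]]]; rewrite -(psi_Z hpsi) /= rmorphXn xE fE -mulrA.
by exists (u * fps_of_poly p)%R.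
Qed.

Lemma nu_xi_0 xi alpha : pcoef xi 0 = 0%R -> 0 <= alpha -> nu_xi L psi xi alpha 0%R = +oo.
Proof.
move=> x0 a0; rewrite /nu_xi; case: eqVneq => [_|an0].
  have [x1 xE _] := Lx_ex; apply/eqyP => A A0; apply: (@le_trans _ _ (Num.truncn A).+1%:R%:E).
    by rewrite lee_fin ltW // truncnS_gt.
  by apply: (ord_along_ge xE); exists 0%R; rewrite mulr0.
apply/eqP; rewrite -leye_eq; apply/ereal_infP => _ [eta etaN <-].
by rewrite rmorph0 subst_0 ?ordx0 // (NP_at0 x0 _ etaN) // lt_neqAle eq_sym an0.
Qed.

Lemma ord_along_ultrametric f g : mine (ord_along L f) (ord_along L g) <= ord_along L (f + g)%R.
Proof.
have [x0 xE _] := Lx_ex.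
have [->|f0] := eqVneq f 0%R; first by rewrite add0r ge_min lexx orbT.
have [->|g0] := eqVneq g 0%R; first by rewrite addr0 ge_min lexx.
have [n [s fs]] := has_roots_ex f0; have [m [t gt]] := has_roots_ex g0.
rewrite (ord_along_roots fs) (ord_along_roots gt).
wlog nm : f g f0 g0 n m s t fs gt / (n <= m)%N.
  move=> H; case: (leqP n m) => [nm|/ltnW mn]; first exact: (H f g f0 g0 n m s t).
  by rewrite minC addrC; apply: (H g f g0 f0 m n t s).
rewrite (min_idPl _) ?lee_fin ?ler_nat //.
have [h fE] := ord_along_Z xE fs; have [k gE] := ord_along_Z xE gt.
apply: (ord_along_ge xE); exists (h + x0 ^+ (m - n) * k)%R.
by rewrite fE gE mulrDr mulrA -exprD subnKC.
Qed.

Lemma nu_xi_semivaluation xi alpha : pcoef xi 0 = 0%R -> 0 <= alpha ->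
  semivals_L L (nu_xi L psi xi alpha).
Proof.
move=> x0 a0.
have pos f : 0 <= nu_xi L psi xi alpha f.
  have [->|/has_roots_ex[n [s fs]]] := eqVneq f 0%R; first by rewrite nu_xi_0.
  by rewrite (nu_xi_roots x0 a0 fs) adde_ge0 ?gauss_sum_ge0 // lee_fin.
split; last first.
  move=> f /(L_Z hpsi)[u uu fE]; rewrite (@nu_xi_roots _ _ f 1 [::]) //.
    by rewrite /gauss_sum big_nil adde0.
  by apply: (has_roots_unit uu); rewrite expr1.
split.
- exact: pos.
- move=> f g; have [->|f0] := eqVneq f 0%R.
    by rewrite mul0r nu_xi_0 // addye // gt_eqF // (lt_le_trans _ (pos g)) ?ltNyr.
  have [->|g0] := eqVneq g 0%R.
    by rewrite mulr0 nu_xi_0 // addey // gt_eqF // (lt_le_trans _ (pos f)) ?ltNyr.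
  have [n [s fs]] := has_roots_ex f0; have [m [t gt]] := has_roots_ex g0.
  rewrite (nu_xi_roots x0 a0 (has_rootsM fs gt)) (nu_xi_roots x0 a0 fs) (nu_xi_roots x0 a0 gt).
  by rewrite gauss_sum_cat natrD EFinD addeACA.
- move=> f g; rewrite /nu_xi; case: eqVneq => [_|an0]; first exact: ord_along_ultrametric.
  apply/ereal_infP => _ [eta etaN <-].
  have e0 : pcoef eta 0 = 0%R by apply: (NP_at0 x0 _ etaN); rewrite lt_neqAle eq_sym an0.
  have lef (h : O) : ereal_inf [set ordx R (puiseux_subst (psi h) z) | z in NP xi alpha] <=
      ordx R (puiseux_subst (psi h) eta) by apply: ereal_inf_lbound; exists eta.
  have -> : puiseux_subst (psi (f + g)%R) eta =
      (puiseux_subst (psi f) eta + puiseux_subst (psi g) eta)%R by rewrite rmorphD substD.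
  exact: (min_le_le (lef f) (lef g) (ordxD R _ _)).
- move=> c c0; rewrite (@nu_xi_roots _ _ _ 0 [::]) ?/gauss_sum ?big_nil ?adde0 //.
  apply: (@has_roots_unit _ (fpsC (fpsC c))); last by rewrite mul1r (psi_scalar hpsi).
  exact/fps2_invertible.
- exact: nu_xi_0.
Qed.

Lemma ord_along_nu xi : ord_along L = nu_xi L psi xi 0.
Proof. by apply/funext => f; rewrite /nu_xi eqxx. Qed.

Lemma ord_along_semivaluation : semivals_L L (ord_along L).
Proof. by rewrite (ord_along_nu 0%R); apply: nu_xi_semivaluation => //; apply: pcoef0. Qed.

End Semivaluation.

(** * Extending a semivaluation to the ring of Puiseux polynomials *)

Section Filtrations.
Variables (R : realType) (A B : comNzRingType) (iota : {rmorphism A -> B}).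
Variable N : A -> \bar R.
Hypothesis N1 : N 1 = 0%E.
Hypothesis NM : forall a b, N (a * b) = (N a + N b)%E.
Implicit Types (F : B -> R -> Prop) (p q u h : B) (c d e : R).

(** A function [w] with values in [[0, +oo]] is encoded by the relation
    [F p c <-> c <= w p]. The following says that [w] is submultiplicative and
    ultrametric, and homogeneous with respect to the valuation [N] of [A]. *)
Record filtration F : Prop := Filtration {
  filt_le : forall p c d, d <= c -> F p c -> F p d;
  filt_ge0 : forall p, F p 0;
  filtD : forall p q c, F p c -> F q c -> F (p + q) c;
  filtM : forall p q c d, F p c -> F q d -> F (p * q) (c + d);
  filt_hom : forall a v p c, N a = v%:E -> F (iota a * p) c -> F p (c - v);
  filt1 : forall c, F 1 c -> c <= 0 }.

Record power_filtration F : Prop := PowerFiltration {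
  pfilt : filtration F;
  filt_pow : forall p m c, (0 < m)%N -> F (p ^+ m) (m%:R * c) -> F p c;
  filt_closed : forall p c, (forall e, 0 < e -> F p (c - e)) -> F p c }.

Lemma filtX F p c m : filtration F -> F p c -> F (p ^+ m) (m%:R * c).
Proof.
move=> Ff pc; elim: m => [|m IH]; first by rewrite mul0r; apply: filt_ge0.
by rewrite exprS -add1n natrD mulrDl mul1r; apply: filtM.
Qed.

Lemma filt_sum F (I : Type) (s : seq I) (G : I -> B) c : filtration F -> F 0 c ->
  (forall i, F (G i) c) -> F (\sum_(i <- s) G i) c.
Proof. by move=> Ff F0 FG; elim/big_rec: _ => // i x _; apply: filtD. Qed.

Lemma filt_muln F p c m : filtration F -> F 0 c -> F p c -> F (p *+ m) c.
Proof.
by move=> Ff F0 pc; elim: m => [|m IH]; rewrite ?mulr0n // mulrS; apply: filtD.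
Qed.

(** The smoothing [lim w (p ^ T) / T] of [w]; it is again ultrametric by the
    binomial formula. *)
Definition smooth F p c := forall e, 0 < e ->
  exists D, forall T : nat, F (p ^+ T) (T%:R * (c - e) - D).

Lemma smooth_sub F p c : filtration F -> F p c -> smooth F p c.
Proof.
move=> Ff pc e e0; exists 0 => T; rewrite subr0.
apply: (filt_le Ff _ (filtX T Ff pc)).
by rewrite ler_wpM2l // gerBl ltW.
Qed.

Lemma smooth_filtration F : filtration F -> (forall c, F 0 c) ->
  power_filtration (smooth F).
Proof.
move=> Ff F0; split; first split.
- move=> p c d dc pc e e0; have [D pD] := pc e e0; exists D => T.
  by apply: (filt_le Ff _ (pD T)); rewrite lerD2r ler_wpM2l // lerD2r.
- by move=> p; apply: smooth_sub => //; apply: filt_ge0.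
- move=> p q c pc qc e e0; have [D pD] := pc e e0; have [D' qD] := qc e e0.
  exists (D + D') => T; rewrite exprDn; apply: filt_sum => // i.
  apply: filt_muln => //; apply: (filt_le Ff _ (filtM Ff (pD _) (qD _))).
  have iT : (i <= T)%N by rewrite -ltnS.
  by rewrite natrB //; lra.
- move=> p q c d pc qd e e0; have e2 : 0 < e / 2 by rewrite divr_gt0.
  have [D pD] := pc _ e2; have [D' qD] := qd _ e2.
  exists (D + D') => T; rewrite exprMn.
  apply: (filt_le Ff _ (filtM Ff (pD _) (qD _))).
  by lra.
- move=> a v p c av pc e e0; have [D pD] := pc e e0; exists D => T.
  have avT : N (a ^+ T) = (T%:R * v)%:E.
    elim: T => [|T IH]; first by rewrite mul0r.
    by rewrite exprS NM IH av -EFinD -[in RHS]add1n natrD mulrDl mul1r.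
  have := pD T; rewrite exprMn -rmorphXn => /(filt_hom Ff avT).
  by apply: filt_le => //; lra.
- move=> c c1; apply/ler_addgt0Pl => e e0; rewrite addr0 -subr_le0.
  have [D D1] := c1 e e0; rewrite leNgt; apply/negP => ce.
  have := filt1 Ff (eq_ind _ (fun x => F x _) (D1 (Num.truncn (`|D| / (c - e))).+1) _ (expr1n _ _)).
  rewrite subr_le0 leNgt => /negP; apply; apply: le_lt_trans (ler_norm D) _.
  by rewrite -ltr_pdivrMr // truncnS_gt.
- move=> p m c m0 pc e e0.
  have em : 0 < m%:R * e by rewrite mulr_gt0 // ltr0n.
  have [D pD] := pc _ em; exists (D + m%:R * `|c - e|) => t.
  rewrite {1}(divn_eq t m) exprD mulnC exprM.
  apply: (filt_le Ff _ (filtM Ff (pD _) (filt_ge0 Ff _))).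
  rewrite [X in X%:R * _ - _](divn_eq t m) natrD natrM.
  have h1 : (t %% m)%:R * (c - e) <= m%:R * `|c - e|.
    apply: (@le_trans _ _ ((t %% m)%:R * `|c - e|)).
      by rewrite ler_wpM2l // ler_norm.
    by rewrite ler_wpM2r // ler_nat ltnW // ltn_pmod.
  by lra.
- move=> p c pc e e0; have e2 : 0 < e / 2 by rewrite divr_gt0.
  have [D pD] := pc _ e2 _ e2; exists D => T.
  by apply: (filt_le Ff _ (pD T)); rewrite lerD2r ler_wpM2l //; lra.
Qed.

(** [w (h u) = w h + w u] for all [h], or [w u] is infinite. *)
Definition multiplicative_at F u := (forall c, F u c) \/
  exists lam, F u lam /\ forall h c, F (h * u) c -> F h (c - lam).

(** The function [lim_k (w (h u^k) - k w(u))] is a larger solution which is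
    multiplicative at [u]. *)
Lemma make_multiplicative F u : power_filtration F -> exists F',
  [/\ power_filtration F', forall p c, F p c -> F' p c, multiplicative_at F' u &
      forall v, multiplicative_at F v -> multiplicative_at F' v].
Proof.
move=> Fp; have Ff := pfilt Fp.
case: (pselect (forall c, F u c)) => [uoo|]; first by exists F; split=> //; left.
move=> /existsNP[c0 uc0].
have ub : ubound [set c | F u c] c0.
  by move=> c uc; rewrite leNgt; apply/negP => cc0; apply: uc0; apply: (filt_le Ff (ltW cc0)).
have hs : has_sup [set c | F u c] by split; [exists 0; apply: filt_ge0 | exists c0].
(* The value [w(u)], which is attained as the filtration is closed. *)
pose lam := sup [set c | F u c].
have ulam : F u lam.
  apply: (filt_closed Fp) => e e0; have [d ud dl] := sup_adherent e0 hs.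
  exact: (filt_le Ff (ltW dl)).
have lamP d : F u d -> d <= lam by apply: (sup_upper_bound hs).
have up k j p c : F (p * u ^+ k) c -> F (p * u ^+ (k + j)) (c + j%:R * lam).
  by move=> pk; rewrite exprD mulrA; apply: filtM => //; apply: filtX.
pose F' p c := forall e, 0 < e -> exists k : nat, F (p * u ^+ k) (c + k%:R * lam - e).
have sub p c : F p c -> F' p c.
  move=> pc e e0; exists 0%N; rewrite mulr1 mul0r addr0.
  by apply: (filt_le Ff _ pc); rewrite gerBl ltW.
exists F'; split=> //.
- split; first split.
  + move=> p c d dc pc e e0; have [k pk] := pc e e0; exists k.
    by apply: (filt_le Ff _ pk); rewrite !lerD2r.
  + by move=> p; apply: sub; apply: (filt_ge0 Ff).
  + move=> p q c pc qc e e0; have [k pk] := pc e e0; have [l ql] := qc e e0.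
    exists (k + l)%N; rewrite mulrDl; apply: filtD => //.
      by apply: (filt_le Ff _ (up _ l _ _ pk)); rewrite natrD; lra.
    by rewrite addnC; apply: (filt_le Ff _ (up _ k _ _ ql)); rewrite natrD; lra.
  + move=> p q c d pc qd e e0; have e2 : 0 < e / 2 by rewrite divr_gt0.
    have [k pk] := pc _ e2; have [l ql] := qd _ e2; exists (k + l)%N.
    rewrite exprD mulrACA; apply: (filt_le Ff _ (filtM Ff pk ql)).
    by rewrite natrD; lra.
  + move=> a v p c av pc e e0; have [k pk] := pc e e0; exists k.
    move: pk; rewrite -mulrA => /(filt_hom Ff av); apply: filt_le => //; lra.
  + move=> c c1; apply/ler_addgt0Pl => e e0; rewrite addr0.
    have [k] := c1 e e0; rewrite mul1r.
    case: k => [|k]; first by rewrite expr0 => /(filt1 Ff); lra.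
    have k0 : k.+1%:R != 0 :> R by rewrite pnatr_eq0.
    rewrite (_ : _ - e = k.+1%:R * (lam + (c - e) / k.+1%:R)); last by field.
    move=> /(filt_pow Fp (ltn0Sn k))/lamP; rewrite gerDl pmulr_lle0 ?invr_gt0 ?ltr0n //.
    by rewrite subr_le0.
- move=> p m c m0 pc e e0.
    have [k] := pc e e0; move=> pk.
    exists k; have m1 : (1 <= m%:R :> R) by rewrite ler1n.
    apply: (filt_pow Fp m0); rewrite exprMn -exprM.
    have -> : (k * m = k + k * (m - 1))%N.
      by rewrite -mulnS subn1 prednK.
    apply: (filt_le Ff _ (up _ _ _ _ pk)); rewrite natrM natrB //.
    have : e <= m%:R * e by rewrite ler_peMl // ltW.
    by lra.
- move=> p c pc e e0; have e2 : 0 < e / 2 by rewrite divr_gt0.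
    have [k pk] := pc _ e2 _ e2; exists k; apply: (filt_le Ff _ pk); lra.
- right; exists lam; split=> [|h c hc e e0]; first exact: sub.
  have [k hk] := hc e e0; exists k.+1; rewrite exprS mulrA.
  by apply: (filt_le Ff _ hk); rewrite -[k.+1]addn1 natrD; lra.
- move=> v [voo|[mu [vmu hmu]]]; first by left=> c; apply: sub.
  right; exists mu; split=> [|h c hc e e0]; first exact: sub.
  have [k hk] := hc e e0; exists k; move: hk; rewrite mulrAC => /hmu.
  by apply: filt_le => //; lra.
Qed.

Lemma make_multiplicative_seq F (s : seq B) : power_filtration F -> exists F',
  [/\ power_filtration F', forall p c, F p c -> F' p c &
      forall u, u \in s -> multiplicative_at F' u].
Proof.
move=> Fp; elim: s => [|u s [F' [Fp' sub Fs]]]; first by exists F; split.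
have [F'' [Fp'' sub' Fu Fv]] := make_multiplicative u Fp'.
by exists F''; split=> // [p c /sub/sub'//|v]; rewrite inE => /orP[/eqP ->//|/Fs/Fv].
Qed.

End Filtrations.

Section Components.
Variable K : fieldType.
Local Notation P := (puiseux K).
Local Notation iota := (@puiseux_of_fps K).
Implicit Types (r s : rat) (a : fps K) (f : P) (p q : {poly P}).

(** The component of [f] of exponents in [r + Z], divided by [x^r]. *)
Definition component r f : fps K := Fps (fun k => pcoef f (r + k%:R)).

Fact component_additive r : zmod_morphism (component r).
Proof. by move=> f g; apply: fpsP. Qed.
HB.instance Definition _ r := GRing.isZmodMorphism.Build P (fps K)
  (component r) (component_additive r).

Lemma component_linear r a f : 0 <= r < 1 -> component r (iota a * f) = a * component r f.
Proof.
move=> /andP[r0 r1]; apply: fpsP => k; rewrite fcoefM /=.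
rewrite -[LHS]/(pcoef (iota a * f) (r + k%:R)) (pcoef_fpsM a f (k := k.+1)); last first.
  by rewrite -natr1 addrC lerD2l ltW.
rewrite big_ord_recr /= [pcoef f _]pcoef_lt0 ?mulr0 ?addr0; last by rewrite -natr1; lra.
apply: eq_bigr => i _; congr (_ * pcoef f _).
have ik : (i <= k)%N by rewrite -ltnS.
by rewrite (natrB _ ik) addrA.
Qed.

Lemma fps_pcoef_nat a s : pcoef (iota a) s != 0 -> s \is a Num.nat.
Proof. by rewrite pcoef_fps; case: ifP => //; rewrite eqxx. Qed.

Lemma nat_between_eq (m n : nat) r s : 0 <= r < 1 -> 0 <= s < 1 ->
  r + m%:R = s + n%:R -> r = s /\ m = n.
Proof.
move=> /andP[r0 r1] /andP[s0 s1] e; suff mn : m = n by move: e; rewrite mn => /addIr.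
have [mn|nm|//] := ltngtP m n.
  have : m.+1%:R <= n%:R :> rat by rewrite ler_nat.
  by rewrite -natr1 => h; exfalso; lra.
have : n.+1%:R <= m%:R :> rat by rewrite ler_nat.
by rewrite -natr1 => h; exfalso; lra.
Qed.

Lemma component_mono r s (e : nat) a : 0 <= r < 1 -> 0 <= s < 1 ->
  component r (puiseux_X K (s + e%:R) * iota a) = (if r == s then fpsX ^+ e * a else 0).
Proof.
move=> r01 s01; have se0 : 0 <= s + e%:R by rewrite addr_ge0 //; case/andP: s01.
apply: fpsP => k; rewrite -[LHS]/(pcoef _ (r + k%:R)) pcoefXM //.
case: eqVneq => [->|rs]; last first.
  rewrite fcoef0; apply/eqP/negPn/negP => /fps_pcoef_nat/natrP[m mE].
  case/eqP: rs; suff [] : r = s /\ k = (m + e)%N by [].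
  by apply: nat_between_eq => //; rewrite natrD -mE; ring.
rewrite fcoefXnM; case: ltnP => [ke|ek].
  by rewrite pcoef_lt0 // opprD addrACA subrr add0r subr_lt0 ltr_nat.
by rewrite opprD addrACA subrr add0r -natrB // pcoef_fpsn.
Qed.

Definition poly_component r p : {poly fps K} := map_poly (component r) p.

Lemma poly_component_linear r (b : {poly fps K}) p : 0 <= r < 1 ->
  poly_component r (map_poly iota b * p) = b * poly_component r p.
Proof.
move=> r01; apply/polyP => i; rewrite coef_map !coefM raddf_sum.
by apply: eq_bigr => j _; rewrite !coef_map /= component_linear.
Qed.

Lemma poly_component_mono r s (e : nat) (b : {poly fps K}) : 0 <= r < 1 -> 0 <= s < 1 ->
  poly_component r ((puiseux_X K (s + e%:R))%:P * map_poly iota b) =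
  (if r == s then (fpsX ^+ e)%:P * b else 0).
Proof.
move=> r01 s01; apply/polyP => i; rewrite coef_map coefCM coef_map /= component_mono //.
by case: eqP; rewrite ?coefCM // coef0.
Qed.

(** The classes of the exponents modulo [Z] are those of the [k / n]. *)
Lemma component_decomposition n f : pdenom n f ->
  f = \sum_(k < n) puiseux_X K (k%:R / n%:R) * iota (component (k%:R / n%:R) f).
Proof.
move=> nf; have [n0 hf] := nf.
have nR : n%:R != 0 :> rat by rewrite pnatr_eq0 -lt0n.
have k01 (k : 'I_n) : 0 <= (k%:R / n%:R : rat) < 1.
  by rewrite divr_ge0 //= ltr_pdivrMr ?ltr0n // mul1r ltr_nat.
apply: puiseuxP => q; rewrite pcoef_sum.
under eq_bigr => k _ do rewrite pcoefXM ?divr_ge0 //.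
have cE (k : 'I_n) : pcoef (iota (component (k%:R / n%:R) f)) (q - k%:R / n%:R) != 0 ->
    exists m : nat, q = k%:R / n%:R + m%:R.
  by move=> /fps_pcoef_nat/natrP[m mE]; exists m; rewrite -mE addrC subrK.
case: (pselect (exists l : nat, q = l%:R / n%:R)) => [[l qE]|nl]; last first.
  rewrite big1 => [|k _]; first by apply/eqP/negPn/negP => /hf.
  apply/eqP/negPn/negP => /cE[m qE]; apply: nl; exists (k + m * n)%N.
  by rewrite qE natrD mulrDl natrM mulfK.
have ln : (l %% n < n)%N by rewrite ltn_mod.
have qE' : q = (l %% n)%:R / n%:R + (l %/ n)%:R.
  by rewrite qE {1}(divn_eq l n) natrD mulrDl natrM mulfK // addrC.
rewrite (bigD1 (Ordinal ln)) // big1 ?Monoid.mulm1 => [|k kn].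
  have -> : q - (l %% n)%:R / n%:R = (l %/ n)%:R by rewrite {1}qE' addrAC subrr add0r.
  by rewrite pcoef_fpsn {1}qE'.
apply/eqP/negPn/negP => /cE[m]; rewrite qE' => e; case/eqP: kn; apply: val_inj => /=.
have [/(mulIf (invr_neq0 nR))/eqP] := nat_between_eq (k01 (Ordinal ln)) (k01 k) e.
by rewrite eqr_nat /= => /eqP ->.
Qed.

Lemma poly_component_decomposition n p : (forall i, pdenom n p`_i) ->
  p = \sum_(k < n) (puiseux_X K (k%:R / n%:R))%:P *
      map_poly iota (poly_component (k%:R / n%:R) p).
Proof.
move=> np; apply/polyP => i; rewrite coef_sum [LHS](component_decomposition (np i)).
by apply: eq_bigr => k _; rewrite coefCM !coef_map.
Qed.

End Components.

Section BaseFiltration.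
Variables (R : realType) (K : fieldType).
Local Notation P := (puiseux K).
Local Notation iota := (@puiseux_of_fps K).
Implicit Types (p q : {poly P}) (a b : {poly fps K}) (c d : R).
Local Open Scope ereal_scope.

(** A semivaluation of the ring of polynomials over the power series, with
    value 1 at [x]. *)
Record x_semivaluation (N : {poly fps K} -> \bar R) : Prop := XSemivaluation {
  xval_ge0 : forall a, 0 <= N a;
  xvalM : forall a b, N (a * b)%R = N a + N b;
  xvalD : forall a b, mine (N a) (N b) <= N (a + b)%R;
  xval1 : N 1%R = 0;
  xval0 : N 0%R = +oo;
  xvalX : N fpsX%:P = 1 }.

Variable N : {poly fps K} -> \bar R.
Hypothesis hN : x_semivaluation N.

Lemma xvalXn n : N (fpsX ^+ n)%:P = n%:R%:E.
Proof.
elim: n => [|n IH]; first exact: xval1.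
by rewrite exprS polyCM xvalM // IH xvalX // -EFinD -[in RHS]add1n natrD.
Qed.

(** The ring of Puiseux polynomials is graded by [Q / Z] over the polynomials
    with power series coefficients; this is the filtration of the smallest
    extension of [N], whose value at [p] is the minimum of those at the
    homogeneous components of [p]. *)
Definition base_filt p c := forall r, (0 <= r < 1)%R ->
  c%:E <= N (poly_component r p) + (ratr r)%:E.

Lemma base_filt0 c : base_filt 0 c.
Proof. by move=> r _; rewrite /poly_component map_poly0 xval0 // addye ?leey. Qed.

Lemma base_filt_le p c d : (d <= c)%R -> base_filt p c -> base_filt p d.
Proof. by move=> dc pc r /pc; apply: le_trans; rewrite lee_fin. Qed.

Lemma base_filtD p q c : base_filt p c -> base_filt q c -> base_filt (p + q) c.
Proof.
move=> pc qc r r01; rewrite /poly_component raddfD /=.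
apply: le_trans (leeD2r _ (xvalD hN _ _)).
by rewrite minEle; case: ifP => _; [apply: pc | apply: qc].
Qed.

Lemma base_filt_mono (s : rat) b c : (0 <= s)%R -> c%:E <= N b + (ratr s)%:E ->
  base_filt ((puiseux_X K s)%:P * map_poly iota b) c.
Proof.
move=> s0 cb r r01; set e := Num.truncn s; pose s' := (s - e%:R)%R.
have s01 : (0 <= s' < 1)%R.
  by rewrite subr_ge0 truncn_le s0 /= ltrBlDl natr1 truncnS_gt.
have sE : s = (s' + e%:R)%R by rewrite subrK.
rewrite sE poly_component_mono //; case: eqVneq => [->|_]; last first.
  by rewrite xval0 // addye ?leey.
rewrite xvalM // xvalXn [_ + N b]addeC -addeA -EFinD.
by move: cb; rewrite {1}sE rmorphD /= ratr_nat [(_ + e%:R)%R]addrC.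
Qed.

Lemma base_filt_iota b c : c%:E <= N b -> base_filt (map_poly iota b) c.
Proof.
move=> cb; rewrite -[map_poly iota b]mul1r -[1%R]/(1%R%:P) -puiseux_X0.
by apply: base_filt_mono => //; rewrite rmorph0 adde0.
Qed.

Lemma base_filtration : filtration (map_poly iota) N base_filt.
Proof.
split.
- exact: base_filt_le.
- by move=> p r /andP[r0 _]; rewrite adde_ge0 ?xval_ge0 // lee_fin ler0q.
- exact: base_filtD.
- move=> p q c d pc qd.
  have [n np] := pdenom_poly p; have [m mq] := pdenom_poly q.
  have n0 : (0 < n)%N by case: (np 0%N). have m0 : (0 < m)%N by case: (mq 0%N).
  have np' i : pdenom (n * m) p`_i by apply: pdenomM.
  have mq' i : pdenom (n * m) q`_i by rewrite mulnC; apply: pdenomM.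
  rewrite (poly_component_decomposition np') (poly_component_decomposition mq').
  rewrite mulr_suml; elim/big_ind: _ => [||k _]; [exact: base_filt0 | |].
    by move=> x y; apply: base_filtD.
  rewrite mulr_sumr; elim/big_ind: _ => [||l _]; [exact: base_filt0 | |].
    by move=> x y; apply: base_filtD.
  set r := (k%:R / _)%R; set s := (l%:R / _)%R.
  have k01 (i : 'I_(n * m)) : (0 <= (i%:R / (n * m)%:R : rat) < 1)%R.
    by rewrite divr_ge0 //= ltr_pdivrMr ?ltr0n ?muln_gt0 ?n0 // mul1r ltr_nat.
  have [r0 r1] := andP (k01 k); have [s0 s1] := andP (k01 l).
  rewrite mulrACA -polyCM -puiseux_XD // -rmorphM.
  apply: base_filt_mono; first exact: addr_ge0.
  rewrite xvalM // rmorphD EFinD EFinD addeACA.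
  by apply: leeD; [exact: pc (k01 k) | exact: qd (k01 l)].
- move=> a v p c av pc r r01; have := pc r r01.
  rewrite poly_component_linear // xvalM // av -addeA.
  by case: (_ + (ratr r)%:E) => [x| |]; [rewrite -EFinD !lee_fin lerBlDl | rewrite !leey |].
- move=> c /(_ 0%R); rewrite lexx ltr01 => /(_ isT).
  rewrite rmorph0 adde0 (_ : poly_component 0%R 1%R = 1%R) ?xval1 ?lee_fin //.
  rewrite /poly_component -[1%R]/(1%R%:P) map_polyC /=; congr (_%:P).
  apply: fpsP => k; rewrite -[LHS]/(pcoef (1%R : P) (0 + k%:R)%R).
  by rewrite pcoef1 add0r pnatr_eq0; case: k.
Qed.

End BaseFiltration.

Section Extension.
Variables (R : realType) (K : fieldType).
Local Notation P := (puiseux K).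
Local Notation iota := (@puiseux_of_fps K).
Local Open Scope ereal_scope.

Lemma lee_real (x y : \bar R) : 0 <= x -> 0 <= y ->
  (forall c : R, c%:E <= x -> c%:E <= y) -> x <= y.
Proof.
case: x => [x| |] // x0 y0 h; first exact: h.
by rewrite leye_eq; apply/eqP/eqyP => A _; apply: h; rewrite leey.
Qed.

Lemma leeD_real (x y z : \bar R) : 0 <= x -> 0 <= y -> 0 <= z ->
  (forall c d : R, c%:E <= x -> d%:E <= y -> (c + d)%:E <= z) -> x + y <= z.
Proof.
move=> x0 y0 z0 h; apply: lee_real => // [|c]; first exact: adde_ge0.
case: x x0 h => [x| |] //.
  case: y y0 => [y| |] // _ _ h cxy; first by apply: le_trans cxy (h _ _ _ _).
  have := h x (c - x)%R; rewrite [(x + _)%R]addrC subrK; apply=> //; exact: leey.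
move=> _ h _; have := h c 0%R; rewrite addr0; apply=> //; exact: leey.
Qed.

Lemma puiseux_unit_at0 (g : P) : pcoef g 0 != 0%R -> invertible g.
Proof.
have [n [ng _]] := pdenom_common2 g g; have [n0 _] := ng.
have nR : (0 < n%:R :> rat)%R by rewrite ltr0n.
have nR' : (0 < (n%:R : rat)^-1)%R by rewrite invr_gt0.
move=> g0; have [h gh] : invertible (pser n g).
  by apply/fps_invertible/field_invertible; rewrite /= mul0r.
exists (pscale nR' (iota h)); apply: (pscale_inj (r0 := nR)).
by rewrite rmorphM rmorph1 /= pscaleK (pscale_fps nR ng) -rmorphM gh rmorph1.
Qed.

Variable N : {poly fps K} -> \bar R.
Hypothesis hN : x_semivaluation N.

(** The part of the properties of a semivaluation extending [N] that is used; the
    multiplicativity is only required for the products of elements of [s]. *)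
Record extends (s : seq {poly P}) (w : {poly P} -> \bar R) : Prop := Extends {
  ext_ge0 : forall p, 0 <= w p;
  extD : forall p q, mine (w p) (w q) <= w (p + q)%R;
  extM : forall p q, w p + w q <= w (p * q)%R;
  ext_iota : forall a, w (map_poly iota a) = N a;
  ext_const : forall c, w c%:P = ordx R c;
  ext_prod : forall t, {subset t <= s} -> w (\prod_(u <- t) u)%R = \sum_(u <- t) w u }.

Lemma extN s w p : extends s w -> w p <= w (- p)%R.
Proof.
move=> we; apply: (@le_trans _ _ (w (-1)%:P + w p)%R).
  by rewrite (ext_const we) ordxN ordx1 add0e.
by apply: le_trans (extM we _ _) _; rewrite polyCN polyC1 mulN1r.
Qed.

(** Smooth the filtration of the homogeneous components, then make it
    multiplicative at the elements of [s] one after the other. The homogeneity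
    with respect to [N], which is preserved, ensures that no step changes the
    values on the subring. *)
Theorem extension (s : seq {poly P}) : exists w, extends s w.
Proof.
have NM := xvalM hN; have N1 := xval1 hN.
have bf := base_filtration hN.
have sf := smooth_filtration N1 NM bf (base_filt0 hN).
have [F [Fp sub Fs]] := make_multiplicative_seq s sf.
have Ff := pfilt Fp.
have {}sub p c : base_filt N p c -> F p c by move=> /(smooth_sub bf)/sub.
pose w p := ereal_sup [set c%:E | c in [set c | F p c]].
have wP p c : c%:E <= w p <-> F p c.
  split=> [cw|pc]; last by apply: ereal_sup_ubound; exists c.
  apply: (filt_closed Fp) => e e0.
  have /ereal_sup_gt[_ [d pd <-]] : (c - e)%:E < w p.
    by apply: lt_le_trans cw; rewrite lte_fin gtrBl.
  by rewrite lte_fin => /ltW cd; apply: (filt_le Ff cd).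
have w0 p : 0 <= w p by apply/wP/(filt_ge0 Ff).
have wM p q : w p + w q <= w (p * q)%R.
  by apply: leeD_real => // c d /wP pc /wP qd; apply/wP/(filtM Ff).
have w1 : w 1%R = 0.
  apply/eqP; rewrite eq_le w0 andbT; apply: lee_real => // c /wP/(filt1 Ff).
  by rewrite lee_fin.
have wi a : w (map_poly iota a) = N a.
  apply/eqP; rewrite eq_le; apply/andP; split; apply: lee_real => //; rewrite ?xval_ge0 // => c.
    move=> /wP; case Na : (N a) => [v| |]; rewrite ?leey //; last first.
      by move: (xval_ge0 hN a); rewrite Na.
    rewrite -[map_poly iota a]mulr1 => /(filt_hom Ff Na)/(filt1 Ff).
    by rewrite subr_le0 lee_fin.
  by move=> cN; apply/wP/sub/(base_filt_iota hN).
exists w; split=> //.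
- move=> p q; apply: lee_real; rewrite ?le_min ?w0 // => c.
  by rewrite le_min => /andP[/wP pc /wP qc]; apply/wP/(filtD Ff).
- move=> c; case: (ordxP R c) => [->|q cq c0 q0].
    by rewrite polyC0 -(rmorph0 (map_poly iota)) wi xval0.
  (* [c] is the product of [x^q] and of an element [g] with inverse [h]. *)
  have wX r : (0 <= r)%R -> F (puiseux_X K r)%:P (ratr r).
    move=> r0; apply: sub; rewrite -[_%:P]mulr1 -(rmorph1 (map_poly iota)).
    by apply: (base_filt_mono hN) => //; rewrite xval1 // add0e.
  have [g cE gq] := vanish_belowE q0 cq.
  have [|h gh] := @puiseux_unit_at0 g; first by rewrite gq add0r.
  apply/eqP; rewrite eq_le; apply/andP; split; last first.
    by apply/wP; rewrite cE polyCM -[ratr q]addr0; apply: (filtM Ff) (wX _ q0) (filt_ge0 Ff _).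
  apply: lee_real => //; first by rewrite lee_fin ler0q.
  move=> d /wP cd; pose m := (Num.truncn q).+1.
  have qm : (q <= m%:R)%R by rewrite ltW // truncnS_gt.
  have mq : (0 <= m%:R - q)%R by rewrite subr_ge0.
  have := filtM Ff (filtM Ff cd (filt_ge0 Ff h%:P)) (wX _ mq).
  have e : (puiseux_X K q * g * h * puiseux_X K (m%:R - q) = iota (fpsX ^+ m))%R.
    by rewrite -(mulrA _ g h) gh mulr1 -puiseux_XD // addrC subrK puiseux_X_nat.
  rewrite -!polyCM cE e -map_polyC => /wP; rewrite wi xvalXn // !lee_fin addr0.
  by rewrite rmorphB /= ratr_nat; lra.
- move=> t ts.
  have wprod h c : F (h * \prod_(u <- t) u)%R c -> c%:E <= w h + \sum_(u <- t) w u.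
    elim: t ts h c => [|u t IH] ts h c; first by rewrite !big_nil mulr1 adde0 => /wP.
    have uts : {subset t <= s} by move=> v vt; apply: ts; rewrite inE vt orbT.
    have sum0 : 0 <= \sum_(v <- t) w v by apply: sume_ge0.
    have woo (x : \bar R) : 0 <= x -> x != -oo.
      by move=> x0; rewrite gt_eqF // (lt_le_trans _ x0) ?ltNyr.
    rewrite !big_cons; case: (Fs u (ts u (mem_head _ _))) => [uoo _|[lam [ul hu]]].
      have -> : w u = +oo by apply/eqyP => A _; apply/wP.
      by rewrite addye ?woo // addey ?leey // woo.
    rewrite mulrCA mulrC => /hu/(IH uts) cl; rewrite addeCA.
    apply: (@le_trans _ _ (lam%:E + (c - lam)%:E)).
      by rewrite -EFinD addrC subrK.
    by apply: leeD => //; apply/wP.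
  apply/eqP; rewrite eq_le; apply/andP; split.
    apply: lee_real => // [|c]; first exact: sume_ge0.
    by rewrite -[X in w X]mul1r => /wP/wprod; rewrite w1 add0e.
  elim: t {ts wprod} => [|u t IH]; first by rewrite !big_nil w1.
  by rewrite !big_cons; apply: le_trans (wM _ _); rewrite leeD2l.
Qed.

End Extension.

(** * The order on semivaluations *)

Section Order.
Variables (R : realType) (O : comAlgType R[i]).
Variable psi : {rmorphism O -> fps (fps R[i])}.
Variable L : set O.
Hypothesis hpsi : adapted_coordinates L psi.
Local Notation C := R[i].
Local Notation P := (puiseux C).
Local Notation iota := (@puiseux_of_fps C).
Local Notation nx := (nu_xi L psi).
Local Notation VL := (semivals_L L).
Local Notation pos := (fun xi : P => pcoef xi 0 = 0).
Implicit Types (f g : O) (xi eta zeta : P) (nu mu : {ptws O -> \bar R}) (a b : \bar R).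

Definition psi_inv F : O := sval (cid (psi_surj hpsi F)).
Lemma psi_invK F : psi (psi_inv F) = F.
Proof. exact: (svalP (cid (psi_surj hpsi F))). Qed.

(** The restriction of [nu] to the polynomials in [y]. *)
Definition on_poly nu (p : {poly fps C}) : \bar R := nu (psi_inv (fps_of_poly p)).
(** An equation of the branch of [eta]. *)
Definition minf eta : O := psi_inv (fps_of_poly (minp eta)).

Local Open Scope ereal_scope.

Lemma sval_le_trans nu1 nu2 nu3 : sval_le nu1 nu2 -> sval_le nu2 nu3 -> sval_le nu1 nu3.
Proof. by move=> h h' f; apply: le_trans (h f) (h' f). Qed.

Lemma sval_le_anti nu mu : sval_le nu mu -> sval_le mu nu -> nu = mu.
Proof. by move=> h h'; apply/funext => f; apply/eqP; rewrite eq_le h h'. Qed.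

Lemma VL_ge0 nu f : VL nu -> 0 <= nu f. Proof. by case=> -[]. Qed.
Lemma VLM nu f g : VL nu -> nu (f * g)%R = nu f + nu g. Proof. by case=> -[]. Qed.
Lemma VLD nu f g : VL nu -> mine (nu f) (nu g) <= nu (f + g)%R. Proof. by case=> -[]. Qed.
Lemma VL0 nu : VL nu -> nu 0%R = +oo. Proof. by case=> -[]. Qed.
Lemma VL1 nu : VL nu -> nu 1%R = 0.
Proof. by move=> [[_ _ _ h _] _]; have := h 1%R (oner_neq0 _); rewrite scale1r. Qed.

Lemma VL_invertible nu f : VL nu -> invertible f -> nu f = 0.
Proof.
move=> hnu [g fg]; have : nu f + nu g = 0 by rewrite -VLM // fg VL1.
by move/eqP; rewrite padde_eq0 ?VL_ge0 // => /andP[/eqP].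
Qed.

Lemma on_poly_x_semivaluation nu : VL nu -> x_semivaluation (on_poly nu).
Proof.
move=> hnu; have pI := psi_inj hpsi; split; rewrite /on_poly.
- by move=> p; apply: VL_ge0.
- by move=> p q; rewrite -VLM //; congr (nu _); apply: pI; rewrite rmorphM !psi_invK rmorphM.
- move=> p q; have -> : psi_inv (fps_of_poly (p + q)%R) =
      (psi_inv (fps_of_poly p) + psi_inv (fps_of_poly q))%R.
    by apply: pI; rewrite [LHS]psi_invK !rmorphD /= !psi_invK.
  exact: VLD.
- by rewrite rmorph1 (_ : psi_inv 1 = 1%R) ?VL1 //; apply: pI; rewrite psi_invK rmorph1.
- by rewrite rmorph0 (_ : psi_inv 0 = 0%R) ?VL0 //; apply: pI; rewrite psi_invK rmorph0.
- case: hnu => _; apply; apply/(L_Z hpsi); exists 1%R; first by exists 1%R; rewrite mulr1.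
  by rewrite psi_invK mulr1; apply: fpsP => -[|k] /=; rewrite coefC.
Qed.

Lemma VL_structure nu f n u p : VL nu -> invertible u ->
  psi f = (fpsC fpsX ^+ n * u * fps_of_poly p)%R -> nu f = n%:R%:E + on_poly nu p.
Proof.
move=> hnu uu fE; have pI := psi_inj hpsi.
have uu' : invertible (psi_inv u) by apply/(psi_invertible hpsi); rewrite psi_invK.
have xE : psi_inv (fps_of_poly (fpsX ^+ n)%:P) = psi_inv (fpsC fpsX ^+ n).
  apply: pI; rewrite !psi_invK rmorphXn rmorphXn; congr (_ ^+ _)%R.
  by apply: fpsP => -[|k] /=; rewrite coefC.
have -> : f = (psi_inv (fpsC fpsX ^+ n) * psi_inv u * psi_inv (fps_of_poly p))%R.
  by apply: pI; rewrite !rmorphM !psi_invK.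
rewrite !VLM // (VL_invertible hnu uu') adde0 -xE; congr (_ + _).
exact: xvalXn (on_poly_x_semivaluation hnu) n.
Qed.

(** The minimal polynomials of the Newton-Puiseux roots generate, together with
    [x] and the units, so that they detect the order. *)
Lemma sval_le_minf nu mu : VL nu -> VL mu ->
  (forall eta, pos eta -> nu (minf eta) <= mu (minf eta)) -> sval_le nu mu.
Proof.
move=> hnu hmu h f; have [->|f0] := eqVneq f 0%R; first by rewrite !VL0.
have pf0 : psi f != 0%R.
  by apply: contra_neq f0 => f0; apply: (psi_inj hpsi); rewrite rmorph0.
have [n [u [p [uu wp fE]]]] := fps2_structure pf0.
rewrite (VL_structure hnu uu fE) (VL_structure hmu uu fE) leeD2l //.
have [s [pE sp]] := minp_split wp.1.
have {}sp eta : eta \in s -> pos eta by move=> /sp /(weierstrass_root wp).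
rewrite pE; elim: s sp {pE} => [|eta s IH] sp.
  by rewrite big_nil !(xval1 (on_poly_x_semivaluation _)).
rewrite big_cons !(xvalM (on_poly_x_semivaluation _)) //; apply: leeD.
  by apply: h; apply: sp; rewrite mem_head.
by apply: IH => z zs; apply: sp; rewrite inE zs orbT.
Qed.

Lemma nx_minf xi a eta : pos xi -> 0 <= a -> pos eta ->
  nx xi a (minf eta) = gauss_sum xi a (galois_orbit eta).
Proof.
move=> x0 a0 e0; rewrite (nu_xi_roots hpsi x0 a0 (has_roots_minp e0 (psi_invK _))).
by rewrite add0e.
Qed.

Lemma nx_VL xi a : pos xi -> 0 <= a -> VL (nx xi a).
Proof. exact: nu_xi_semivaluation. Qed.

Lemma nx_le xi a b : pos xi -> 0 <= a -> a <= b -> sval_le (nx xi a) (nx xi b).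
Proof.
move=> x0 a0 ab; have b0 := le_trans a0 ab.
apply: sval_le_minf; [exact: nx_VL | exact: nx_VL |] => eta e0.
by rewrite !nx_minf // gauss_sum_le.
Qed.

(** In an ultrametric space, each point of a ball is its center. *)
Lemma nx_close xi eta a : a <= ordx R (xi - eta)%R -> nx xi a = nx eta a.
Proof.
move=> h; apply/funext => f; rewrite /nu_xi; case: eqP => [_|_]; first by [].
have sub xi' eta' : a <= ordx R (xi' - eta')%R -> NP xi' a `<=` NP eta' a.
  move=> h' z zN; apply: le_trans (ordx_tri R z xi' eta').
  by rewrite le_min h' andbT.
suff -> : NP xi a = NP eta a by [].
have h' : a <= ordx R (eta - xi)%R by rewrite ordxB.
by apply/seteqP; split; [exact: (sub _ _ h) | exact: (sub _ _ h')].
Qed.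

(** The Galois action permutes the roots of each minimal polynomial. *)
Lemma nx_galois xi a : pos xi -> 0 <= a -> nx (galois xi) a = nx xi a.
Proof.
move=> x0 a0; have x0' : pos (galois xi) by rewrite /= x0 mulr0.
have e eta : pos eta -> nx (galois xi) a (minf eta) = nx xi a (minf eta).
  move=> e0; rewrite !nx_minf // /gauss_sum -(perm_big _ (galois_orbit_perm eta)) big_map.
  by apply: eq_bigr => z _; rewrite -rmorphB /= ordx_galois.
by apply: sval_le_anti; apply: sval_le_minf; try exact: nx_VL; move=> eta e0; rewrite e.
Qed.

Lemma nx_orbit xi zeta a : pos xi -> 0 <= a -> zeta \in galois_orbit xi -> nx zeta a = nx xi a.
Proof.
move=> x0 a0; have [_ _ _ os] := galois_orbitP xi => /os[m ->].
elim: m => [|m IH]; first by [].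
by rewrite iterS nx_galois // iter_galoisE x0 mulr0.
Qed.

(** The term of [xi] in [s], equal to the exponent, makes the sum strictly
    increasing. *)
Lemma gauss_sum_self xi a b s : 0 <= b -> xi \in s ->
  gauss_sum xi a s <= gauss_sum xi b s -> a <= b.
Proof.
move=> b0 xs; rewrite /gauss_sum !(perm_big _ (perm_to_rem xs)) !big_cons subrr ordx0.
rewrite !(min_idPl (leey _)) => h; rewrite leNgt; apply/negP => ba; move: h; apply/negP.
rewrite -ltNge; case: b b0 ba => [b b0 ba|_|//]; last by rewrite ltNge leey.
apply: lt_le_trans (leeD2l _ (gauss_sum_le _ _ (ltW ba))).
by rewrite lteD2rE //; apply: gauss_sum_fin; rewrite -lee_fin.
Qed.

Lemma nx_minf_le xi a b : pos xi -> 0 <= a -> 0 <= b ->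
  nx xi a (minf xi) <= nx xi b (minf xi) -> a <= b.
Proof.
by move=> x0 a0 b0; rewrite !nx_minf //; apply: gauss_sum_self; rewrite ?galois_orbit_id.
Qed.

Lemma seq_argmax (T : eqType) (g : T -> \bar R) (s : seq T) x0 : x0 \in s ->
  exists2 z, z \in s & forall y, y \in s -> g y <= g z.
Proof.
case: s => // x s _; elim: s x => [|y s IH] x.
  by exists x; rewrite ?mem_head // => z; rewrite inE => /eqP ->.
have [z zs zmax] := IH y; case: (leP (g z) (g x)) => zx.
  exists x; rewrite ?mem_head // => t; rewrite inE => /orP[/eqP ->//|/zmax h].
  exact: le_trans h zx.
exists z; first by rewrite inE zs orbT.
by move=> t; rewrite inE => /orP[/eqP ->|/zmax//]; apply: ltW.
Qed.

(** If [zeta] is a point of [s] closest to [xi], its distances to the others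
    determine those of [xi]. *)
Lemma ordx_closest xi zeta z : ordx R (xi - z)%R <= ordx R (xi - zeta)%R ->
  ordx R (xi - z)%R = mine (ordx R (xi - zeta)%R) (ordx R (zeta - z)%R).
Proof.
move=> zmax; apply/eqP; rewrite eq_le ordx_tri andbT le_min zmax /=.
by apply: le_trans (ordx_tri R zeta xi z); rewrite le_min lexx andbT ordxB.
Qed.

(** Evaluate at the minimal polynomial of [eta], after replacing [eta] by the
    conjugate closest to [xi]: the exponent [a] is at most [b] and at most the
    contact of [xi] with this conjugate. *)
Lemma nx_le_nx xi eta a b : pos xi -> pos eta -> 0 <= a -> 0 <= b ->
  sval_le (nx eta a) (nx xi b) -> a <= b /\ nx eta a = nx xi a.
Proof.
move=> x0 e0 a0 b0 h.
have [zeta zs zmax] := @seq_argmax _ (fun z => ordx R (xi - z)%R) _ _ (galois_orbit_id eta).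
have z0 := galois_orbit_at0 e0 zs.
pose k := ordx R (xi - zeta)%R.
have k0 : 0 <= mine b k by rewrite le_min b0 ordx_ge0.
have : a <= mine b k.
  apply: (@nx_minf_le eta) => //; apply: le_trans (h _) _.
  rewrite -(nx_orbit e0 k0 zs) !nx_minf // /gauss_sum big_seq [X in _ <= X]big_seq.
  by apply: lee_sum => z zs'; rewrite [X in mine b X](ordx_closest (zmax z zs')) minA.
rewrite le_min => /andP[ab ak]; split; first exact: ab.
by rewrite -(nx_orbit e0 a0 zs); apply/esym/nx_close.
Qed.

(** Among the linear factors [y - z] of [minp xi], one has the largest value
    [beta] for an extension [w] of [nu], and it determines the values of the
    others: this is a point of the tree that is below [nu] and has the same
    value at [minp xi]. *)
Lemma contact_extension nu (s : seq {poly P}) (w : {poly P} -> \bar R) xi :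
  VL nu -> pos xi ->
  extends (on_poly nu) s w ->
  {subset [seq ('X - z%:P)%R | z <- galois_orbit xi] <= s} ->
  exists2 zeta, zeta \in galois_orbit xi &
    nu (minf xi) = nx xi (w ('X - zeta%:P)%R) (minf xi) /\
    sval_le (nx xi (w ('X - zeta%:P)%R)) nu.
Proof.
move=> hnu x0 we ss; have [w0 wD wM wi wc wprod] := we.
have [zeta zs zmax] := @seq_argmax _ (fun z => w ('X - z%:P)%R) _ _ (galois_orbit_id xi).
have z0 := galois_orbit_at0 x0 zs.
exists zeta => //; set b := w ('X - zeta%:P)%R.
rewrite -!(nx_orbit x0 (w0 _) zs).
have wge z : mine b (ordx R (zeta - z)%R) <= w ('X - z%:P)%R.
  rewrite -wc (_ : 'X - z%:P = ('X - zeta%:P) + (zeta - z)%:P)%R; first exact: wD.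
  by rewrite polyCB addrA subrK.
have weq z : z \in galois_orbit xi -> w ('X - z%:P)%R = mine b (ordx R (zeta - z)%R).
  move=> zs'; apply/eqP; rewrite eq_le wge andbT le_min zmax //= leNgt; apply/negP => lt.
  have h : mine (w ('X - z%:P)%R) (w ('X - zeta%:P)%R) <= ordx R (zeta - z)%R.
    rewrite -wc (_ : (zeta - z)%:P = ('X - z%:P) + - ('X - zeta%:P))%R; last first.
      by rewrite polyCB opprB [RHS]addrC addrA subrK.
    by apply: le_trans (wD _ _); rewrite le_min ge_min lexx /= ge_min (extN _ we) orbT.
  by move: h; apply/negP; rewrite -ltNge lt_min lt /= (lt_le_trans lt) // zmax.
have wsum t (eta : P) : {subset [seq ('X - z%:P)%R | z <- t] <= s} ->
    w (\prod_(z <- t) ('X - z%:P))%R = \sum_(z <- t) w ('X - z%:P)%R.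
  by move=> /wprod; rewrite !big_map.
split.
  rewrite nx_minf // -[LHS]wi minpE (wsum _ xi ss) /gauss_sum.
  by rewrite big_seq [RHS]big_seq; apply: eq_bigr => z zs'; apply: weq.
apply: sval_le_minf => // [|eta e0]; first exact: nx_VL.
rewrite nx_minf // -[X in _ <= X]wi minpE.
apply: (@le_trans _ _ (\sum_(z <- galois_orbit eta) w ('X - z%:P)%R)).
  by apply: lee_sum.
elim: (galois_orbit eta) => [|z t IH]; first by rewrite !big_nil.
by rewrite !big_cons; apply: le_trans (wM _ _); rewrite leeD2l.
Qed.

(** Two such points are comparable, since an extension of [nu] satisfies the
    ultrametric inequality at two linear factors. *)
Theorem contact_pair nu xi eta : VL nu -> pos xi -> pos eta -> exists a b,
  [/\ 0 <= a, 0 <= b, nu (minf xi) = nx xi a (minf xi) /\ sval_le (nx xi a) nu,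
      nu (minf eta) = nx eta b (minf eta) /\ sval_le (nx eta b) nu &
      sval_le (nx xi a) (nx eta b) \/ sval_le (nx eta b) (nx xi a)].
Proof.
move=> hnu x0 e0.
pose s := [seq ('X - z%:P)%R | z <- galois_orbit xi ++ galois_orbit eta].
have [w we] := extension (on_poly_x_semivaluation hnu) s.
have [w0 wD _ _ wc _] := we.
have sx : {subset [seq ('X - z%:P)%R | z <- galois_orbit xi] <= s}.
  by move=> p; rewrite /s map_cat mem_cat => ->.
have se : {subset [seq ('X - z%:P)%R | z <- galois_orbit eta] <= s}.
  by move=> p; rewrite /s map_cat mem_cat orbC => ->.
have [z zs hz] := contact_extension hnu x0 we sx.
have [y ys hy] := contact_extension hnu e0 we se.
exists (w ('X - z%:P)%R), (w ('X - y%:P)%R); split=> //.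
have z0 := galois_orbit_at0 x0 zs; have y0 := galois_orbit_at0 e0 ys.
have h : mine (w ('X - z%:P)%R) (w ('X - y%:P)%R) <= ordx R (z - y)%R.
  rewrite -wc (_ : (z - y)%:P = ('X - y%:P) + - ('X - z%:P))%R; last first.
    by rewrite polyCB opprB [RHS]addrC addrA subrK.
  by apply: le_trans (wD _ _); rewrite le_min !ge_min (extN _ we) lexx ?orbT.
rewrite -(nx_orbit x0 (w0 _) zs) -(nx_orbit e0 (w0 _) ys).
case: (leP (w ('X - z%:P)%R) (w ('X - y%:P)%R)) h => [zy|/ltW yz] h.
  by left; rewrite (nx_close h); apply: nx_le.
by right; rewrite -(@nx_close z) //; apply: nx_le.
Qed.

(** The largest exponent of a point of the segment of [xi] below [nu]. *)
Definition contact nu xi : \bar R :=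
  locked (xget 0 [set a | 0 <= a /\ nu (minf xi) = nx xi a (minf xi)]).

Lemma contact_unique nu xi a : pos xi -> 0 <= a -> nu (minf xi) = nx xi a (minf xi) ->
  contact nu xi = a.
Proof.
move=> x0 a0 na; rewrite /contact -lock; case: xgetP => [b _ [b0 nb]|/(_ a)[]//].
apply/eqP; rewrite eq_le; apply/andP.
by split; apply: (nx_minf_le x0) => //; rewrite -na -nb.
Qed.

Lemma contactP nu xi : VL nu -> pos xi ->
  [/\ 0 <= contact nu xi, nu (minf xi) = nx xi (contact nu xi) (minf xi) &
      sval_le (nx xi (contact nu xi)) nu].
Proof.
move=> hnu x0; have [a [_ [a0 _ [na le_a] _ _]]] := contact_pair hnu x0 x0.
by rewrite (contact_unique x0 a0 na).
Qed.

Lemma contact_comparable nu xi eta : VL nu -> pos xi -> pos eta ->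
  sval_le (nx xi (contact nu xi)) (nx eta (contact nu eta)) \/
  sval_le (nx eta (contact nu eta)) (nx xi (contact nu xi)).
Proof.
move=> hnu x0 e0; have [a [b [a0 b0 [na _] [nb _] h]]] := contact_pair hnu x0 e0.
by rewrite (contact_unique x0 a0 na) (contact_unique e0 b0 nb).
Qed.

Lemma le_contact nu xi a : VL nu -> pos xi -> 0 <= a ->
  nx xi a (minf xi) <= nu (minf xi) <-> a <= contact nu xi.
Proof.
move=> hnu x0 a0; have [c0 cE cle] := contactP hnu x0; rewrite cE.
by split=> [/(nx_minf_le x0 a0 c0)//|ac]; apply: nx_le.
Qed.

Lemma nx_le_contact nu xi a : VL nu -> pos xi -> 0 <= a ->
  sval_le (nx xi a) nu <-> a <= contact nu xi.
Proof.
move=> hnu x0 a0; have [c0 cE cle] := contactP hnu x0.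
split=> [h|ac]; first by apply/(le_contact hnu x0 a0)/h.
exact: sval_le_trans (nx_le x0 a0 ac) cle.
Qed.

(** The candidate has the exponent [contact mu xi]; at the minimal polynomial of
    any [eta], the value of [mu] is that of a point of the segment of [eta], which
    belongs to the segment of [xi] as it is below [nx xi b]. *)
Lemma downset mu xi b : VL mu -> pos xi -> 0 <= b -> sval_le mu (nx xi b) ->
  exists a, [/\ 0 <= a, a <= b & mu = nx xi a].
Proof.
move=> hmu x0 b0 h; have [c0 cE cle] := contactP hmu x0.
exists (contact mu xi); split=> //.
  by have [] := nx_le_nx x0 x0 c0 b0 (sval_le_trans cle h).
apply: sval_le_anti; last exact: cle.
apply: (sval_le_minf hmu (nx_VL x0 c0)) => eta e0.
have [d0 dE dle] := contactP hmu e0.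
have [_ de] := nx_le_nx x0 e0 d0 b0 (sval_le_trans dle h).
have dc : contact mu eta <= contact mu xi.
  by apply/(nx_le_contact hmu x0 d0); rewrite -de; exact: dle.
by rewrite dE de; exact: (nx_le x0 d0 dc (minf eta)).
Qed.

Lemma ord_along_le nu : VL nu -> sval_le (ord_along L) nu.
Proof.
move=> hnu; have p0 : pos (0 : P)%R by apply: pcoef0.
rewrite (ord_along_nu psi L 0%R); apply/nx_le_contact => //.
by have [] := contactP hnu p0.
Qed.

End Order.

(** * The image of the Eggers-Wall tree *)

Opaque nu_xi ord_along.

Section Image.
Variables (R : realType) (O : comAlgType R[i]).
Variable psi : {rmorphism O -> fps (fps R[i])}.
Variable L : set O.
Hypothesis hpsi : adapted_coordinates L psi.
Local Notation C := R[i].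
Local Notation P := (puiseux C).
Local Notation nx := (nu_xi L psi).
Local Notation VL := (semivals_L L).
Local Notation pos := (fun xi : P => pcoef xi 0 = 0).
Implicit Types (xi eta zeta : P) (nu mu : {ptws O -> \bar R}) (a b : \bar R).
Local Open Scope ereal_scope.

(** The tree of the branches in [B], described by Newton-Puiseux series. *)
Definition tree (B : set (set O)) : set {ptws O -> \bar R} := [set nu |
  nu = ord_along L \/
  exists xi a, [/\ pos xi, B (branch_of psi xi), 0 <= a & nu = nx xi a]].

(** The map [V_map] on representatives. *)
Definition V_rep (p : set O * \bar R) : {ptws O -> \bar R} :=
  if `[< p.1 = L >] then ord_along L else nx (xget 0%R (Zer psi p.1)) p.2.

Lemma V_rep_branch xi a : pos xi -> 0 <= a -> V_rep (branch_of psi xi, a) = nx xi a.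
Proof.
move=> x0 a0; rewrite /V_rep asboolF /=; last exact: branch_of_neqL.
case: xgetP => [z _ /(Zer_branch_of hpsi _ x0) zs|/(_ xi)[]]; first exact: (nx_orbit hpsi).
by apply/(Zer_branch_of hpsi _ x0)/galois_orbit_id.
Qed.

Lemma V_rep_L a : V_rep (L, a) = ord_along L.
Proof. by rewrite /V_rep asboolT. Qed.

Lemma V_rep_0 A : V_rep (A, 0) = ord_along L.
Proof. by rewrite /V_rep; case: asbool => //; rewrite -ord_along_nu. Qed.

(** As there are finitely many roots, the coincidence exponent is attained. *)
Lemma kL_attained xi eta : pos xi -> pos eta -> exists z y,
  [/\ z \in galois_orbit xi, y \in galois_orbit eta &
      kL psi (branch_of psi xi) (branch_of psi eta) <= ordx R (z - y)%R].
Proof.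
move=> x0 e0.
pose s := [seq (z, y) | z <- galois_orbit xi, y <- galois_orbit eta].
have xes : (xi, eta) \in s by apply: allpairs_f; apply: galois_orbit_id.
have [[z y] /allpairsP[[z' y'] /= [zs ys [-> ->]]] zymax] :=
  seq_argmax (fun p : P * P => ordx R (p.1 - p.2)%R) xes.
exists z', y'; split=> //; apply/ereal_supP.
move=> _ [u /(Zer_branch_of hpsi _ x0) us [v /(Zer_branch_of hpsi _ e0) vs <-]].
by apply: (zymax (u, v)); apply: allpairs_f.
Qed.

Lemma V_rep_glue (B : set (set O)) (p q : set_type (EW_points L B)) : B `<=` @branch O ->
  EW_glue psi p q -> V_rep (val p) = V_rep (val q).
Proof.
move=> hB [pq h]; have := set_mem (valP p); have := set_mem (valP q).
case: (val p) (val q) pq h => [A a] [A' a'] /= <- {a'} h [/= A'B _ A'0] [/= AB a0 A0].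
have [AL|AL] := pselect (A = L); first by rewrite (A0 AL) (V_rep_0 A) (V_rep_0 A').
have [A'L|A'L] := pselect (A' = L); first by rewrite (A'0 A'L) (V_rep_0 A) (V_rep_0 A').
have [xi x0 AE] := branchP hpsi (hB _ AB) AL.
have [eta e0 A'E] := branchP hpsi (hB _ A'B) A'L.
case: h => [h|h|h]; [by case: AL | by case: A'L |].
have e1 := V_rep_branch x0 a0.
have e2 := V_rep_branch e0 a0.
rewrite -AE in e1.
rewrite -A'E in e2.
rewrite e1.
rewrite e2.
have [z [y [zs ys zy]]] := kL_attained x0 e0.
rewrite -(nx_orbit hpsi x0 a0 zs) -(nx_orbit hpsi e0 a0 ys).
by apply: nx_close; apply: le_trans zy; rewrite -AE -A'E.
Qed.

Lemma V_rep_rel (B : set (set O)) (p q : set_type (EW_points L B)) : B `<=` @branch O ->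
  EW_rel psi p q -> V_rep (val p) = V_rep (val q).
Proof.
move=> hB /asboolP; elim=> [x y xy|x|x y _ e|x y z _ e _ e'].
- exact: V_rep_glue xy.
- by [].
- by rewrite e.
- by rewrite e e'.
Qed.

Lemma V_map_pi (B : set (set O)) (p : set_type (EW_points L B)) : B `<=` @branch O ->
  V_map (\pi_(Theta L psi B)%qT p) = V_rep (val p).
Proof.
move=> hB; rewrite -[LHS]/(V_rep (val (repr (\pi_(Theta L psi B)%qT p)))).
apply: V_rep_rel => //; apply/eqmodP; exact: reprK.
Qed.

Lemma V_imageE (B : set (set O)) : B `<=` @branch O -> B !=set0 -> V_image L psi B = tree B.
Proof.
move=> hB [A0 BA0]; apply/seteqP; split=> [_ [p _ <-]|nu].
  rewrite -[V_map p]/(V_rep (val (repr p))); have := set_mem (valP (repr p)).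
  case: (val (repr p)) => A a [/= BA a0 _].
  have [->|AL] := pselect (A = L); first by left; rewrite V_rep_L.
  have [xi x0 AE] := branchP hpsi (hB _ BA) AL.
  by right; exists xi, a; split=> //; rewrite -?AE // AE V_rep_branch.
have point A a : EW_points L B (A, a) -> V_image L psi B (V_rep (A, a)).
  move=> hA; pose p : set_type (EW_points L B) := exist _ (A, a) (mem_set hA).
  by exists (\pi_(Theta L psi B)%qT p) => //; rewrite V_map_pi.
move=> [->|[xi [a [x0 Bx a0 ->]]]].
  by rewrite -(V_rep_0 A0); apply: point; split.
rewrite -V_rep_branch //; apply: point; split=> //= xL.
by case: (branch_of_neqL hpsi x0).
Qed.

Lemma tree_VL (B : set (set O)) : tree B `<=` VL.
Proof.
move=> _ [->|[xi [a [x0 _ a0 ->]]]]; first exact: (ord_along_semivaluation hpsi).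
exact: nu_xi_semivaluation.
Qed.

Lemma tree_sub (B B' : set (set O)) : B `<=` B' -> tree B `<=` tree B'.
Proof.
move=> BB' nu [->|[xi [a [x0 Bx a0 ->]]]]; [by left | right].
by exists xi, a; split=> //; apply: BB'.
Qed.

Lemma tree_downset (B : set (set O)) mu nu : VL mu -> tree B nu -> sval_le mu nu -> tree B mu.
Proof.
move=> hmu [->|[xi [a [x0 Bx a0 ->]]]] h.
  by left; apply: (sval_le_anti h); apply: (ord_along_le hpsi hmu).
have [b [b0 _ ->]] := downset hpsi hmu x0 a0 h.
by right; exists xi, b.
Qed.

(** * Attaching points *)

(** [mu] is the largest point of the tree below [nu]. *)
Definition is_projection (B : set (set O)) nu mu :=
  [/\ tree B mu, sval_le mu nu & forall mu', tree B mu' -> sval_le mu' nu -> sval_le mu' mu].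

Lemma is_projection_unique (B : set (set O)) nu mu mu' :
  is_projection B nu mu -> is_projection B nu mu' -> mu = mu'.
Proof. by move=> [Bm mn mM] [Bm' mn' mM']; apply: sval_le_anti; [apply: mM' | apply: mM]. Qed.

Lemma is_projection_self (B : set (set O)) nu : tree B nu -> is_projection B nu nu.
Proof. by move=> Bn; split. Qed.

(** The points of the tree below [nu] have a maximum, as those on each branch do
    and any two of these are comparable. *)
Lemma projection_ex (B : set (set O)) nu : B `<=` @branch O -> finite_set B -> VL nu ->
  exists mu, is_projection B nu mu.
Proof.
move=> hB /finite_seqP[s sE] hnu; move: hB; rewrite {B}sE.
have oB := ord_along_le hpsi hnu.
suff h : [set` s] `<=` @branch O -> exists mu, is_projection [set` s] nu mu /\
    (mu = ord_along L \/ exists2 xi, pos xi & mu = nx xi (contact hpsi nu xi)).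
  by move=> /h[mu [hmu _]]; exists mu.
elim: s => [|A s IH] hs.
  exists (ord_along L); split; last by left.
  split; [by left | exact: oB | move=> mu' [-> _|[xi [a [_ xA _ _]]]]]; first by move=> f.
  by move: xA; rewrite /= in_nil.
have [|mu [[Bmu mun muM] muE]] := IH.
  by move=> A' A's; apply: hs; rewrite /= inE A's orbT.
have sub : tree [set` s] `<=` tree [set` A :: s].
  by apply: tree_sub => A' /= A's; rewrite inE A's orbT.
have [AL|AL] := pselect (A = L).
  exists mu; split=> //; split=> //; first exact: sub.
  move=> mu' [->|[xi [a [x0 /= xA a0 mE]]]] h; first by apply: muM => //; left.
  apply: muM => //; right; exists xi, a; split=> //.
  by move: xA; rewrite inE AL => /orP[/eqP /(branch_of_neqL hpsi x0)|].
have [xi x0 AE] : exists2 xi, pos xi & A = branch_of psi xi.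
  by apply: (branchP hpsi) => //; apply: hs; rewrite /= mem_head.
have [c0 cE cle] := contactP hpsi hnu x0.
pose kappa := nx xi (contact hpsi nu xi).
have Bk : tree [set` A :: s] kappa.
  by right; exists xi, (contact hpsi nu xi); split=> //=; rewrite AE mem_head.
have below mu' : tree [set` A :: s] mu' -> sval_le mu' nu ->
    sval_le mu' kappa \/ sval_le mu' mu.
  move=> [->|[eta [a [e0 /= eA a0 mE]]]] h.
    by right; apply: muM => //; left.
  move: eA; rewrite inE => /orP[/eqP eA|es]; last first.
    by right; apply: muM => //; right; exists eta, a.
  left; have zs : eta \in galois_orbit xi.
    apply/(Zer_branch_of hpsi _ x0); rewrite -AE -eA.
    by apply/(Zer_branch_of hpsi _ e0)/galois_orbit_id.
  move: h; rewrite mE (nx_orbit hpsi x0 a0 zs) => h.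
  by apply: (nx_le hpsi x0 a0); apply/(nx_le_contact hpsi hnu x0 a0).
have cmp : sval_le mu kappa \/ sval_le kappa mu.
  case: muE => [->|[eta e0 ->]]; last exact: contact_comparable.
  by left; apply: (ord_along_le hpsi); apply: tree_VL Bk.
case: cmp => mk.
  exists kappa; split; last by right; exists xi.
  split=> // mu' Bm' h; case: (below _ Bm' h) => // h'.
  exact: sval_le_trans h' mk.
exists mu; split=> //; split=> //; first exact: sub.
move=> mu' Bm' h; case: (below _ Bm' h) => // h'.
exact: sval_le_trans h' mk.
Qed.

(** A meet with a point of the tree lies in the tree, as it is closed downwards:
    the attaching point is the largest point of the tree below [nu]. *)
Lemma attaching_ptP (B : set (set O)) (T : set {ptws O -> \bar R}) nu mu :
  B `<=` @branch O -> finite_set B -> T `<=` VL -> tree B `<=` T -> T nu ->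
  attaching_pt (@sval_le R O) T (tree B) nu mu <-> is_projection B nu mu.
Proof.
move=> hB fB TVL BT Tnu; split=> [[Bmu seg]|[Bmu mn mM]].
  have [pi [Bpi pin piM]] := projection_ex hB fB (TVL _ Tnu).
  have : (segment (@sval_le R O) T mu nu `&` tree B) mu by rewrite seg.
  move=> [[_ [M [TM Mmu Mnu MM] _]] _].
  have BM : tree B M by apply: (tree_downset (TVL _ TM) Bmu Mmu).
  have : (segment (@sval_le R O) T mu nu `&` tree B) M.
    split=> //; split=> //; exists M => //; left; split=> // f.
  rewrite seg => /= Mmu'; rewrite Mmu' in Mnu MM.
  have : (segment (@sval_le R O) T mu nu `&` tree B) pi.
    split=> //; split; first exact: BT.
    exists mu; last by right; split=> //; apply: piM.
    by split=> //; exact: BT.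
  by rewrite seg => /= <-; split.
split=> //; apply/seteqP; split=> [z [[Tz [M [TM Mmu Mnu MM] h]] Bz]|_ ->].
  have muM : sval_le mu M by apply: MM => //; exact: BT.
  case: h => -[Mz zle]; apply: sval_le_anti => //.
  - exact: sval_le_trans muM Mz.
  - exact: mM.
  - exact: sval_le_trans muM Mz.
split=> //; split; first exact: BT.
have mumu : sval_le mu mu by move=> f; exact: lexx.
by exists mu; [split=> //; exact: BT | left].
Qed.

Lemma attachP (B : set (set O)) (T : set {ptws O -> \bar R}) nu :
  B `<=` @branch O -> finite_set B -> T `<=` VL -> tree B `<=` T -> T nu ->
  is_projection B nu (attach (@sval_le R O) T (tree B) nu).
Proof.
move=> hB fB TVL BT Tnu; rewrite /attach; case: xgetP => [mu _ /attaching_ptP|h]; first exact.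
have [mu hmu] := projection_ex hB fB (TVL _ Tnu).
by case: (h mu); apply/attaching_ptP.
Qed.

End Image.

(** * Continuity *)

Import numFieldNormedType.Exports.

Section Topology.

Lemma ptws_cvg (I : Type) (K : topologicalType) (F : set_system {ptws I -> K})
    (f : {ptws I -> K}) : Filter F ->
  (forall i, g i @[g --> F] --> f i) -> F --> f.
Proof.
move=> FF h; apply/cvg_sup => i U [V [[W oW <-] Wf WU]].
by apply: filterS WU _; apply: (h i); apply: open_nbhs_nbhs.
Qed.

Lemma ptws_eval_continuous (I : Type) (K : topologicalType) (i : I) :
  continuous (fun f : {ptws I -> K} => f i).
Proof.
move=> f U Uf; have /cvg_sup/(_ i) h : nbhs f --> f by apply: cvg_id.
by apply: h; exact: (@initial_continuous _ _ (fun g : {ptws I -> K} => g i) f U Uf).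
Qed.

Lemma ereal_cvg_rays (R : realType) (T : Type) (F : set_system T) (h : T -> \bar R) (x : \bar R) :
  Filter F -> (forall c : R, (c%:E < x)%E -> F [set t | (c%:E < h t)%E]) ->
  (forall c : R, (x < c%:E)%E -> F [set t | (h t < c%:E)%E]) -> h t @[t --> F] --> x.
Proof.
move=> FF lo hi U Ux; suff : F [set t | U (h t)] by [].
case: x lo hi Ux => [r| |] lo hi Ux.
- have /nbhs_ballP[e /= e0 eU] : nbhs r (fun y : R => U y%:E) by exact: Ux.
  have l1 : (((r - e)%:E : \bar R) < r%:E)%E by rewrite lte_fin gtrBl.
  have h1 : ((r%:E : \bar R) < (r + e)%:E)%E by rewrite lte_fin ltrDl.
  apply: filterS2 (lo _ l1) (hi _ h1) => t /=.
  case: (h t) => [y| |] //; rewrite !lte_fin => yl yh.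
  have rye : (`|r - y| < e)%R by rewrite ltr_distlC; apply/andP; split; lra.
  by have b : ball r e y; [rewrite -ball_normE | exact: (eU y b)].
- case: Ux => [M [_ MU]]; apply: filterS (lo M (ltry M)) => t; exact: MU.
- case: Ux => [M [_ MU]]; apply: filterS (hi M (ltNyr M)) => t; exact: MU.
Qed.

End Topology.

Section Continuity.
Variables (R : realType) (O : comAlgType R[i]).
Variable psi : {rmorphism O -> fps (fps R[i])}.
Variable L : set O.
Hypothesis hpsi : adapted_coordinates L psi.
Local Notation C := R[i].
Local Notation P := (puiseux C).
Local Notation nx := (nu_xi L psi).
Local Notation VL := (semivals_L L).
Local Notation pos := (fun xi : P => pcoef xi 0 = 0).
Local Notation minf := (minf hpsi).
Local Notation tree := (tree psi L).
Implicit Types (xi eta zeta : P) (nu mu : {ptws O -> \bar R}) (a b : \bar R).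
Local Open Scope ereal_scope.

Lemma small_step (d : R) (n : nat) : (0 < d)%R -> exists2 e : R, (0 < e)%R & (e *+ n < d)%R.
Proof.
move=> d0; exists (d / n.+1%:R)%R; first by rewrite divr_gt0.
rewrite -[(_ *+ n)%R]mulr_natr -mulrA gtr_pMr // mulrC ltr_pdivrMr ?ltr0n //.
by rewrite mul1r ltr_nat.
Qed.

Lemma nx_left_continuous xi a (c : R) f : pos xi -> 0 < a -> c%:E < nx xi a f ->
  exists2 r : R, (0 <= r)%R /\ r%:E < a & c%:E < nx xi r%:E f.
Proof.
move=> x0 a0 cf; have a0' := ltW a0.
have [f0|f0] := eqVneq f 0%R.
  by exists 0%R; rewrite ?f0 ?(nu_xi_0 hpsi x0) ?ltry.
have [n [s fs]] := has_roots_ex hpsi f0.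
rewrite (nu_xi_roots hpsi x0 a0' fs) -lteBlDl // -EFinB in cf.
suff [r [r0 ra] cr] : exists2 r : R, (0 <= r)%R /\ r%:E < a & (c - n%:R)%:E < gauss_sum xi r%:E s.
  exists r => //; have r0' : 0 <= r%:E by rewrite lee_fin.
  by rewrite (nu_xi_roots hpsi x0 r0' fs) -lteBlDl // -EFinB.
case: a a0 {a0'} cf => [a|_|//]; last first.
  by move=> /gauss_sum_oo[r r0 cr]; exists r => //; rewrite ltry.
rewrite lte_fin => a0 cf; have ga := gauss_sum_fin xi s (ltW a0).
rewrite -(fineK ga) lte_fin -subr_gt0 in cf.
have [e e0 ed] := small_step (size s) cf.
pose r := Num.max 0%R (a - e)%R.
have ra : (r < a)%R by rewrite /r gt_max a0 gtrBl e0.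
have r0 : (0 <= r)%R by rewrite /r le_max lexx.
exists r; first by split=> //; rewrite lte_fin.
have gr := gauss_sum_fin xi s r0.
have := gauss_sum_lip xi s (ltW ra).
rewrite -(fineK ga) -(fineK gr) -EFinD lee_fin lte_fin => h.
have : ((a - r) *+ size s <= e *+ size s)%R.
  by rewrite ler_wMn2r // lerBlDr -lerBlDl /r le_max lexx orbT.
by lra.
Qed.

Lemma nx_right_continuous xi (r c : R) f : pos xi -> (0 <= r)%R -> nx xi r%:E f < c%:E ->
  exists2 r' : R, (r < r')%R & nx xi r'%:E f < c%:E.
Proof.
move=> x0 r0 cf; have r0' : 0 <= r%:E by rewrite lee_fin.
have f0 : f != 0%R.
  by apply/eqP => f0; move: cf; rewrite f0 (nu_xi_0 hpsi x0) // ltNge leey.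
have [n [s fs]] := has_roots_ex hpsi f0.
have gr := gauss_sum_fin xi s r0.
rewrite (nu_xi_roots hpsi x0 r0' fs) -(fineK gr) -EFinD lte_fin -subr_gt0 in cf.
have [e e0 ed] := small_step (size s) cf.
have re : (r < r + e)%R by rewrite ltrDl.
exists (r + e)%R => //; have re0 : (0 <= r + e)%R by rewrite addr_ge0 // ltW.
have re0' : 0 <= (r + e)%:E by rewrite lee_fin.
rewrite (nu_xi_roots hpsi x0 re0' fs).
have := gauss_sum_lip xi s (ltW re); have ge := gauss_sum_fin xi s re0.
rewrite -(fineK gr) -(fineK ge) -!EFinD lee_fin lte_fin.
by rewrite [(r + e - r)%R]addrAC subrr add0r; lra.
Qed.

Lemma nx_minf_lt xi a b : pos xi -> 0 <= a -> 0 <= b -> a < b ->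
  nx xi a (minf xi) < nx xi b (minf xi).
Proof.
move=> x0 a0 b0 ab; rewrite ltNge; apply/negP => /(nx_minf_le x0 b0 a0).
by rewrite leNgt ab.
Qed.

Lemma near_eval nu f (U : set (\bar R)) : open U -> U (nu f) ->
  nbhs nu [set mu : {ptws O -> \bar R} | U (mu f)].
Proof. by move=> oU Uf; apply: (@ptws_eval_continuous O _ f nu); apply: open_nbhs_nbhs. Qed.

(** The value at [f] of the projection depends on [nu] through its values at the
    minimal polynomials of the branches: a lower bound needs a single point of
    the tree below [nu], an upper bound concerns the contact with each branch. *)
Lemma attach_continuous (B : set (set O)) (T : set {ptws O -> \bar R}) :
  B `<=` @branch O -> finite_set B -> T `<=` VL -> tree B `<=` T ->
  {within T, continuous (attach (@sval_le R O) T (tree B) :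
    {ptws O -> \bar R} -> {ptws O -> \bar R})}.
Proof.
move=> hB fB TVL BT.
have prP mu : T mu -> is_projection psi L B mu (attach (@sval_le R O) T (tree B) mu).
  exact: (attachP hpsi).
move: (attach _ _ _) prP => pr prP.
apply/subspace_continuousP => nu Tnu; rewrite /from_subspace.
apply: ptws_cvg => f.
have [Bn nn nM] := prP nu Tnu.
apply: ereal_cvg_rays => c cf.
  suff : nbhs nu [set mu | T mu -> c%:E < pr mu f] by [].
  case: (Bn) => [nE|[xi [a [x0 Bx a0 nE]]]].
    apply: filterE => mu Tmu; have [Bm mm mM] := prP mu Tmu.
    rewrite nE in cf; apply: lt_le_trans cf _.
    by apply: (ord_along_le hpsi); apply: (tree_VL hpsi Bm).
  have [a0'|a_gt0] := leP a 0.
    apply: filterE => mu Tmu; have [Bm mm mM] := prP mu Tmu.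
    have aE : a = 0 by apply/eqP; rewrite eq_le a0' a0.
    rewrite nE aE -ord_along_nu in cf; apply: lt_le_trans cf _.
    by apply: (ord_along_le hpsi); apply: (tree_VL hpsi Bm).
  rewrite nE in cf; have [r [r0 ra] cr] := nx_left_continuous x0 a_gt0 cf.
  have r0' : 0 <= r%:E by rewrite lee_fin.
  have lt : nx xi r%:E (minf xi) < nu (minf xi).
    by apply: lt_le_trans (nx_minf_lt x0 r0' a0 ra) _; rewrite -nE; apply: nn.
  apply: filterS (near_eval (@open_ereal_gt_ereal R (nx xi r%:E (minf xi))) lt).
  move=> mu lmu Tmu; have [Bm mm mM] := prP mu Tmu.
  apply: lt_le_trans cr _; apply: mM; first by right; exists xi, r%:E.
  by apply/(nx_le_contact hpsi (TVL _ Tmu) x0 r0')/(le_contact hpsi (TVL _ Tmu) x0 r0')/ltW.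
(* The neighbourhood is built branch by branch. *)
suff : nbhs nu [set mu | T mu -> pr mu f < c%:E] by [].
suff [U nU hU] : exists2 U, nbhs nu U & forall mu, U mu -> T mu ->
    forall xi, pos xi -> B (branch_of psi xi) -> nx xi (contact hpsi mu xi) f < c%:E.
  apply: filterS nU => mu Umu Tmu; have [Bm mm mM] := prP mu Tmu.
  case: (Bm) => [->|[xi [a [x0 Bx a0 mE]]]].
    by apply: le_lt_trans cf; apply: (ord_along_le hpsi); apply: (tree_VL hpsi Bn).
  rewrite mE in mm *; apply: le_lt_trans (hU mu Umu Tmu xi x0 Bx).
  by apply: (nx_le hpsi x0 a0); apply/(nx_le_contact hpsi (TVL _ Tmu) x0 a0).
move: (fB) => /finite_seqP[s sE].
have sB A : A \in s -> B A by rewrite sE.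
suff [U nU hU] : exists2 U, nbhs nu U & forall mu, U mu -> T mu -> forall xi, pos xi ->
    branch_of psi xi \in s -> nx xi (contact hpsi mu xi) f < c%:E.
  by exists U => // mu Umu Tmu xi x0 Bx; apply: hU => //; rewrite sE in Bx.
elim: s sB {sE} => [|A s IH] sB; first by exists setT => //; exact: filterT.
have [|U nU hU] := IH; first by move=> A' A's; apply: sB; rewrite inE A's orbT.
case: (pselect (exists2 xi, pos xi & A = branch_of psi xi)) => [[xi x0 AE]|nA]; last first.
  exists U => // mu Umu Tmu xi x0; rewrite inE => /orP[/eqP Ax|xs]; last exact: hU.
  by case: nA; exists xi.
have Bxi : B (branch_of psi xi) by rewrite -AE; apply: sB; rewrite mem_head.
suff [W nW hW] : exists2 W, nbhs nu W & forall mu, W mu -> T mu ->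
    nx xi (contact hpsi mu xi) f < c%:E.
  exists (U `&` W); first exact: filterI.
  move=> mu [Umu Wmu] Tmu eta e0; rewrite inE => /orP[/eqP eA|es]; last exact: hU.
  apply: le_lt_trans (hW mu Wmu Tmu).
  have es : eta \in galois_orbit xi.
    apply/(Zer_branch_of hpsi _ x0); rewrite -AE -eA.
    by apply/(Zer_branch_of hpsi _ e0)/galois_orbit_id.
  have [d0 dE dle] := contactP hpsi (TVL _ Tmu) e0.
  rewrite (nx_orbit hpsi x0 d0 es) in dle *.
  by apply: (nx_le hpsi x0 d0); apply/(nx_le_contact hpsi (TVL _ Tmu) x0 d0).
have [t0 tE tle] := contactP hpsi (TVL _ Tnu) x0.
have tf : nx xi (contact hpsi nu xi) f < c%:E.
  apply: le_lt_trans cf; apply: nM => //.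
  by right; exists xi, (contact hpsi nu xi).
case tau : (contact hpsi nu xi) t0 tf => [t| |] // t0 tf; last first.
  exists setT; first exact: filterT.
  move=> mu _ Tmu; have [d0 _ _] := contactP hpsi (TVL _ Tmu) x0.
  by apply: le_lt_trans tf; apply: (nx_le hpsi x0 d0); exact: leey.
rewrite lee_fin in t0; have [r tr rf] := nx_right_continuous x0 t0 tf.
have r0 : 0 <= r%:E by rewrite lee_fin ltW // (le_lt_trans t0).
have lt : nu (minf xi) < nx xi r%:E (minf xi).
  by rewrite tE tau; apply: nx_minf_lt; rewrite // lte_fin.
exists [set mu | mu (minf xi) < nx xi r%:E (minf xi)].
  exact: near_eval (@open_ereal_lt_ereal R (nx xi r%:E (minf xi))) lt.
move=> mu /= lmu Tmu; have [d0 _ _] := contactP hpsi (TVL _ Tmu) x0.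
apply: le_lt_trans rf; apply: (nx_le hpsi x0 d0).
rewrite leNgt; apply/negP => /ltW/(le_contact hpsi (TVL _ Tmu) x0 r0).
by rewrite leNgt lmu.
Qed.

End Continuity.

(** * The projective limit *)

Section Limit.
Variables (R : realType) (O : comAlgType R[i]).
Variable psi : {rmorphism O -> fps (fps R[i])}.
Variable L : set O.
Hypothesis hpsi : adapted_coordinates L psi.
Local Notation C := R[i].
Local Notation P := (puiseux C).
Local Notation nx := (nu_xi L psi).
Local Notation VL := (semivals_L L).
Local Notation pos := (fun xi : P => pcoef xi 0 = 0).
Local Notation minf := (minf hpsi).
Local Notation tree := (tree psi L).
Local Notation J := (curve_index O).
Local Notation projection := (is_projection psi L).
Implicit Types (j k l : J) (f g : O) (nu mu : {ptws O -> \bar R}).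
Local Open Scope ereal_scope.

Lemma index_branch j : sval j `<=` @branch O. Proof. by case: (svalP j). Qed.
Lemma index_finite j : finite_set (sval j). Proof. by case: (svalP j). Qed.

Lemma index_tree j : V_image L psi (sval j) = tree (sval j).
Proof. by case: (svalP j) => jB _ j0; apply: V_imageE. Qed.

Lemma index_union j k : exists l, sval j `<=` sval l /\ sval k `<=` sval l.
Proof.
have [jB fj j0] := svalP j; have [kB fk _] := svalP k.
have h : [/\ sval j `|` sval k `<=` @branch O, finite_set (sval j `|` sval k) &
    (sval j `|` sval k) !=set0].
  split; [by rewrite subUset | by rewrite finite_setU |].
  by case: j0 => A jA; exists A; left.
by exists (exist _ (sval j `|` sval k) h : J); split=> A h'; [left | right].
Qed.

(** A semivaluation and its projection agree at [f] if the tree contains the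
    branches of [f]: this holds at their minimal polynomials, and the values
    there determine the value at [f]. *)
Lemma projection_value (B : set (set O)) nu mu f n (s : seq P) :
  VL nu -> projection B nu mu -> has_roots psi f n s ->
  (forall z, z \in s -> B (branch_of psi z)) -> mu f = nu f.
Proof.
move=> hnu [Bmu le_mu maxmu] [u [p [uu wp pE fE]]] sB.
have hmu := tree_VL hpsi Bmu.
rewrite (VL_structure hpsi hnu uu fE) (VL_structure hpsi hmu uu fE); congr (_ + _).
have [t [ptE tp]] := minp_split wp.1.
have {}tp eta : eta \in t -> pos eta /\ B (branch_of psi eta).
  move=> /tp re; split; first exact: weierstrass_root wp re.
  by apply: sB; move: re; rewrite pE root_prod_XsubC.
rewrite ptE; elim: t tp {ptE} => [|eta t IH] tp.
  by rewrite big_nil !(xval1 (on_poly_x_semivaluation hpsi _)).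
rewrite big_cons !(xvalM (on_poly_x_semivaluation hpsi _)) //.
rewrite IH; last by move=> z zt; apply: tp; rewrite inE zt orbT.
congr (_ + _); have [e0 Be] := tp _ (mem_head _ _).
have [c0 cE cle] := contactP hpsi hnu e0.
apply/eqP; rewrite eq_le; apply/andP; split; first exact: le_mu.
rewrite [X in X <= _]cE; apply: maxmu => //.
by right; exists eta, (contact hpsi nu eta).
Qed.

(** The curve is that of the branches of [f], with the branch [y = 0] added so as
    to be non-empty. *)
Lemma curve_of f : exists j, forall B nu mu, VL nu -> sval j `<=` B ->
  projection B nu mu -> mu f = nu f.
Proof.
have p0 : pos (0 : P)%R by apply: pcoef0.
have [s [s0 sP]] : exists s : seq P, (forall z, z \in s -> pos z) /\
    forall (B : set (set O)) nu mu, VL nu -> (forall z, z \in s -> B (branch_of psi z)) ->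
      projection B nu mu -> mu f = nu f.
  have [->|f0] := eqVneq f 0%R.
    exists [::]; split=> // B nu mu hnu _ [Bmu _ _].
    by rewrite (VL0 hnu) (VL0 (tree_VL hpsi Bmu)).
  have [n [s fs]] := has_roots_ex hpsi f0; exists s; split=> [z|B nu mu hnu sB Bmu].
    exact: has_roots_at0 fs.
  exact: projection_value Bmu fs sB.
pose B0 : set (set O) := [set` [seq branch_of psi z | z <- 0%R :: s]].
have h : [/\ B0 `<=` @branch O, finite_set B0 & B0 !=set0].
  split; last by exists (branch_of psi 0%R); rewrite /B0 /= mem_head.
    move=> _ /= /mapP[z zs ->]; apply: (branch_of_branch hpsi).
    by move: zs; rewrite inE => /orP[/eqP ->|/s0].
  by apply/finite_seqP; exists [seq branch_of psi z | z <- 0%R :: s].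
exists (exist _ B0 h : J) => B nu mu hnu jB; apply: (sP B nu mu hnu) => z zs.
by apply: jB; apply: (map_f (branch_of psi)); rewrite inE zs orbT.
Qed.

Definition curve_index_of f : J := sval (cid (curve_of f)).
Lemma curve_index_ofP f B nu mu : VL nu -> sval (curve_index_of f) `<=` B ->
  projection B nu mu -> mu f = nu f.
Proof. exact: (svalP (cid (curve_of f))). Qed.

Lemma eval2_continuous j f :
  continuous (fun u : {ptws J -> {ptws O -> \bar R}} => u j f).
Proof.
move=> u; apply: (@continuous_comp _ _ _ (fun w : {ptws J -> {ptws O -> \bar R}} => w j)
  (fun nu : {ptws O -> \bar R} => nu f)); exact: ptws_eval_continuous.
Qed.

Section Glue.
Variable u : {ptws J -> {ptws O -> \bar R}}.
Hypothesis u_tree : forall j, tree (sval j) (u j).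
Hypothesis u_proj : forall j l, tree (sval j) `<=` tree (sval l) ->
  projection (sval j) (u l) (u j).

(** The values of a compatible family stabilize at each [f], as soon as the
    curve contains the branches of [f]. *)
Definition glue : {ptws O -> \bar R} := fun f => u (curve_index_of f) f.

Lemma glue_stable f l : sval (curve_index_of f) `<=` sval l -> u l f = glue f.
Proof.
move=> fl; apply/esym.
apply: (@curve_index_ofP f (sval (curve_index_of f)) (u l) (u (curve_index_of f))) => //.
  exact: (tree_VL hpsi (u_tree l)).
exact: u_proj (tree_sub fl).
Qed.

Lemma glue_finite (s : seq O) j : exists l, sval j `<=` sval l /\
  forall f, f \in s -> u l f = glue f.
Proof.
elim: s => [|f s [l [jl ls]]]; first by exists j; split=> [A|f]; rewrite ?in_nil.
have [m [lm fm]] := index_union l (curve_index_of f).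
have [k [mk sk]] : exists k, sval m `<=` sval k /\
    forall g, g \in s -> sval (curve_index_of g) `<=` sval k.
  elim: s {ls} => [|g s [k [mk sk]]]; first by exists m; split=> [A|g]; rewrite ?in_nil.
  have [k' [kk' gk']] := index_union k (curve_index_of g).
  exists k'; split; first exact: subset_trans mk kk'.
  move=> h; rewrite inE => /orP[/eqP -> //|/sk hk]; exact: subset_trans hk kk'.
exists k; split; first exact: subset_trans jl (subset_trans lm mk).
move=> g; rewrite inE => /orP[/eqP ->|gs]; apply: glue_stable; last exact: sk.
exact: subset_trans fm mk.
Qed.

(** Each axiom concerns at most three functions, for which the limit coincides
    with a single member of the family. *)
Lemma glue_VL : VL glue.
Proof.
have j0 := curve_index_of 0%R.
have uV l : VL (u l) := tree_VL hpsi (u_tree l).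
split; first split.
- by move=> f; apply: (VL_ge0 f (uV _)).
- move=> f g; have [l [_ ul]] := glue_finite [:: f; g; (f * g)%R] j0.
  by rewrite -!ul ?inE ?eqxx ?orbT // (VLM f g (uV l)).
- move=> f g; have [l [_ ul]] := glue_finite [:: f; g; (f + g)%R] j0.
  by rewrite -!ul ?inE ?eqxx ?orbT // (VLD f g (uV l)).
- by move=> c c0; case: (uV (curve_index_of c%:A%R)) => -[_ _ _ h _] _; apply: h.
- exact: (VL0 (uV _)).
- by move=> f fL; case: (uV (curve_index_of f)) => _; apply.
Qed.

(** Whether [nx xi a] is below a semivaluation is decided at the minimal
    polynomial of [xi], where the value of the limit is that of some [u l] with
    [l] larger than [j]. *)
Lemma glue_projection j : projection (sval j) glue (u j).
Proof.
split; first exact: u_tree.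
  move=> f; have [l [jl ul]] := glue_finite [:: f] j.
  by rewrite -(ul f) ?mem_head //; have [_ le_ul _] := u_proj (tree_sub jl); apply: le_ul.
have hj := tree_VL hpsi (u_tree j).
move=> _ [->|[xi [a [x0 jx a0 ->]]]] h; first exact: (ord_along_le hpsi hj).
have [l [jl ul]] := glue_finite [:: minf xi] j.
have hl := tree_VL hpsi (u_tree l).
apply/(nx_le_contact hpsi hj x0 a0)/(le_contact hpsi hj x0 a0).
apply: le_trans (h (minf xi)) _; rewrite -(ul (minf xi)) ?mem_head //.
have [c0 cE cle] := contactP hpsi hl x0.
rewrite cE; have [_ _] := u_proj (tree_sub jl); apply=> //.
by right; exists xi, (contact hpsi (u l) xi).
Qed.

End Glue.

Lemma glue_continuous :
  continuous (glue : {ptws J -> {ptws O -> \bar R}} -> {ptws O -> \bar R}).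
Proof.
move=> u; apply: ptws_cvg => [|f]; last exact: eval2_continuous.
by apply: fmap_filter; apply: nbhs_filter.
Qed.
End Limit.

Theorem theorem8p24 (R : realType) (O : comAlgType R[i]) (L : set O)
    (hL : smooth_branch L)
    (psi : {rmorphism O -> fps (fps R[i])}) (hpsi : adapted_coordinates L psi) :
  let J := curve_index O in
  let V := fun j : J => V_image L psi (sval j) in
  let le := @sval_le R O in
  let pi_lj := fun j l : J => attach le (V l) (V j) in
  let pi_j := fun j : J => attach le (semivals_L L) (V j) in
  [/\ directed_by_inclusion V,
      (forall j, V j `<=` semivals_L L /\
         forall P, semivals_L L P -> exists! Q, attaching_pt le (semivals_L L) (V j) P Q) /\
      (forall j l, V j `<=` V l ->
         forall P, V l P -> exists! Q, attaching_pt le (V l) (V j) P Q),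
      projective_system V pi_lj /\ projective_system_continuous V pi_lj &
      homeomorphism (semivals_L L) (projective_limit V pi_lj)
        ((fun nu j => pi_j j nu) : {ptws O -> \bar R} -> {ptws J -> {ptws O -> \bar R}})].
Proof.
move=> J V le pi_lj pi_j.
have VE j : V j = tree psi L (sval j) := index_tree hpsi j.
have VVL j : V j `<=` semivals_L L by rewrite VE; apply: tree_VL.
have subV (j l : J) : sval j `<=` sval l -> V j `<=` V l by rewrite !VE; apply: tree_sub.
have hB (j : J) := @index_branch _ _ j; have fB (j : J) := @index_finite _ _ j.
have attP (T : set {ptws O -> \bar R}) j nu : T `<=` semivals_L L -> V j `<=` T -> T nu ->
    is_projection psi L (sval j) nu (attach le T (V j) nu).
  by rewrite VE => TVL jT Tnu; exact: (attachP hpsi (@hB j) (fB j) TVL jT Tnu).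
have attU (T : set {ptws O -> \bar R}) j nu : T `<=` semivals_L L -> V j `<=` T -> T nu ->
    exists! Q, attaching_pt le T (V j) nu Q.
  rewrite VE => TVL jT Tnu; exists (attach le T (tree psi L (sval j)) nu).
  have h := attachP hpsi (@hB j) (fB j) TVL jT Tnu.
  have attE mu := attaching_ptP hpsi mu (@hB j) (fB j) TVL jT Tnu.
  by split=> [|mu /attE]; [apply: (attE _).2 | apply: is_projection_unique].
have pi_jP j nu : semivals_L L nu -> is_projection psi L (sval j) nu (pi_j j nu).
  by move=> hnu; apply: attP.
have pi_ljP j l nu : V j `<=` V l -> V l nu -> is_projection psi L (sval j) nu (pi_lj j l nu).
  by move=> jl lnu; apply: attP.
have trans j k (nu mu rho : {ptws O -> \bar R}) : V j `<=` V k ->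
    is_projection psi L (sval k) nu mu -> is_projection psi L (sval j) mu rho ->
    is_projection psi L (sval j) nu rho.
  rewrite !VE => jk [kmu munu muM] [jrho rhomu rhoM].
  split=> //; first exact: sval_le_trans rhomu munu.
  by move=> rho' jrho' h; apply: rhoM => //; apply: muM => //; apply: jk.
pose G (u : {ptws J -> {ptws O -> \bar R}}) : {ptws O -> \bar R} :=
  glue hpsi u.
split.
- move=> j k; have [l [jl kl]] := index_union j k.
  by exists l; split; apply: subV.
- split=> [j|j l jl P lP]; last exact: attU.
  by split=> [|P hP]; [exact: VVL | exact: attU].
- split; last first.
    move=> j l; rewrite /pi_lj !VE => jl.
    exact: (attach_continuous hpsi (@hB j) (fB j) (@tree_VL _ _ _ _ hpsi (sval l)) jl).
  split.
  + by move=> j l jl nu lnu; rewrite VE; have [] := pi_ljP j l nu jl lnu.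
  + move=> j nu; rewrite inE => jnu.
    apply: is_projection_unique (pi_ljP j j nu _ jnu) _ => //.
    by apply: is_projection_self; rewrite -VE.
  + move=> j k l jk kl nu; rewrite inE => lnu /=.
    have kmu := pi_ljP k l nu kl lnu.
    apply: is_projection_unique (pi_ljP j l nu _ lnu); last exact: subset_trans jk kl.
    by apply: (trans j k _ _ _ jk kmu); apply: pi_ljP => //; rewrite VE; case: kmu.
- have FG nu : semivals_L L nu -> G (fun j => pi_j j nu) = nu.
    move=> hnu; apply/funext => f; rewrite /G /glue.
    exact: (curve_index_ofP hnu _ (pi_jP _ _ hnu)).
  have limP u : projective_limit V pi_lj u ->
      (forall j, tree psi L (sval j) (u j)) /\
      forall j l, tree psi L (sval j) `<=` tree psi L (sval l) ->
        is_projection psi L (sval j) (u l) (u j).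
    move=> [uV uE]; split=> [j|j l]; first by rewrite -VE.
    by rewrite -!VE => jl; rewrite -(uE j l jl); apply: pi_ljP.
  split.
  + split.
    * move=> nu hnu; split=> [j|j l jl] /=; first by rewrite VE; case: (pi_jP j nu hnu).
      have lmu := pi_jP l nu hnu.
      apply: is_projection_unique (pi_jP j nu hnu).
      by apply: (trans j l _ _ _ jl lmu); apply: pi_ljP => //; rewrite VE; case: lmu.
    * move=> nu mu; rewrite !inE => hnu hmu e.
      by rewrite -(FG nu hnu) -(FG mu hmu) e.
    * move=> u hu; have [uT uP] := limP u hu.
      exists (G u); first exact: glue_VL uT uP.
      apply/funext => j; apply: is_projection_unique (glue_projection hpsi uT uP j).
      by apply: pi_jP; apply: glue_VL.
  + apply/subspace_continuousP => nu hnu; rewrite /from_subspace.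
    apply: ptws_cvg => j.
    have := @attach_continuous _ _ _ _ hpsi (sval j) (semivals_L L) (@hB j) (fB j).
    rewrite -VE => /(_ (fun _ h => h) (@VVL j))/subspace_continuousP; apply.
    exact: hnu.
  + exists G; last by move=> nu; rewrite inE => /FG.
    by apply: continuous_subspaceT; apply: glue_continuous.
Qed.
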